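(* $\mathsf{AVG}_\tau\text{-}\mathsf{LCL}[O(1)]\mathsf{P}=\mathsf{AVG}_\tau\text{-}\mathsf{LCL}[O(1)]\cap\mathsf{P}$.
   Context: A catalytic-type machine has a read-only input tape, a write-only output tape, a read-write work tape and a read-write catalytic tape initially holding an arbitrary string $\tau$. Let $d$ denote Hamming distance. $\mathsf{AVG}_\tau\text{-}\mathsf{LCL}[O(1)]$ is the class of languages $L$ for which there are constants $k,e$ and a deterministic such machine with $k\log n$ work bits and $n^k$ catalytic bits that, on every input $x$ and every initial catalytic content $\tau\in\{0,1\}^{n^k}$, outputs $L(x)$, and whose final catalytic content $\tau'$ satisfies $\mathbb{E}_\tau[d(\tau,\tau')]\le e$ for $\tau$ uniform (for every $x$). $\mathsf{AVG}_\tau\text{-}\mathsf{LCL}[O(1)]\mathsf{P}$ is the same class with the additional requirement that the machine always halts within $n^k$ steps. *)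

(* Defs.v *)
From mathcomp Require Import all_boot.
Set Implicit Arguments. Unset Strict Implicit. Unset Printing Implicit Defensive.

Inductive move := MLeft | MStay | MRight.

Definition mv (m : move) (p : nat) : nat :=
  match m with MLeft => p.-1 | MStay => p | MRight => p.+1 end.

Record trans (Q : Type) := Trans {
  nq   : Q;
  wbit : bool;
  cbit : bool;
  obit : option bool;
  mi   : move;
  mw   : move;
  mc   : move
}.

Record machine := Machine {
  state   : finType;
  start   : state;
  halting : state -> bool;
  (* state, input symbol (None = end marker), work symbol, catalytic symbol *)
  delta   : state -> option bool -> bool -> bool -> trans state
}.

Record config (M : machine) := Config {
  cst   : state M;
  ihead : nat;
  work  : seq bool;
  whead : nat;
  cat   : seq bool;
  chead : nat;
  out   : seq bool
}.

Definition read_in (x : seq bool) (i : nat) : option bool :=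
  if i < size x then Some (nth false x i) else None.

(* Writing on a bounded tape (never changes its length). *)
Definition wr (t : seq bool) (p : nat) (b : bool) : seq bool :=
  if p < size t then set_nth false t p b else t.

(* One step; halted configurations are fixed points. Heads are kept inside
   their tapes (the input head may sit on the right end marker). *)
Definition step (M : machine) (x : seq bool) (c : config M) : config M :=
  if halting (cst c) then c else
  let t := delta (cst c) (read_in x (ihead c))
                 (nth false (work c) (whead c)) (nth false (cat c) (chead c)) in
  @Config M (nq t)
    (minn (mv (mi t) (ihead c)) (size x))
    (wr (work c) (whead c) (wbit t))
    (minn (mv (mw t) (whead c)) (size (work c)).-1)
    (wr (cat c) (chead c) (cbit t))
    (minn (mv (mc t) (chead c)) (size (cat c)).-1)
    (if obit t is Some b then rcons (out c) b else out c).

Definition init (M : machine) (s : nat) (tau : seq bool) : config M :=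
  @Config M (start M) 0 (nseq s false) 0 tau 0 [::].

Definition run (M : machine) (x : seq bool) (c : config M) (t : nat) : config M :=
  iter t (step x) c.

Definition hamming (s t : seq bool) : nat :=
  \sum_(i < size s) (nth false s i != nth false t i).

(* log n, taken as the binary length floor(log2 n) + 1 (so >= 1). *)
Definition logn2 (n : nat) : nat := (trunc_log 2 n).+1.

(* AVG_tau-LCL[O(1)]: k log n work bits, n^k catalytic bits; on every input
   and every initial catalytic content the machine halts with output L(x);
   the expected Hamming distance between initial and final catalytic content,
   tau uniform in {0,1}^(n^k), is at most e, i.e.
   sum_tau d(tau, tau') <= e * 2^(n^k). *)
Definition in_AVG_LCL (L : seq bool -> bool) : Prop :=
  exists (k e : nat) (M : machine), forall x : seq bool,
    exists T : (size x ^ k).-tuple bool -> nat,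
      (forall tau : (size x ^ k).-tuple bool,
         let f := run x (init M (k * logn2 (size x)) tau) (T tau) in
         halting (cst f) /\ out f = [:: L x]) /\
      \sum_(tau : (size x ^ k).-tuple bool)
         hamming tau (cat (run x (init M (k * logn2 (size x)) tau) (T tau)))
      <= e * 2 ^ (size x ^ k).

Definition in_AVG_LCLP (L : seq bool -> bool) : Prop :=
  exists (k e : nat) (M : machine), forall x : seq bool,
    (forall tau : (size x ^ k).-tuple bool,
       let f := run x (init M (k * logn2 (size x)) tau) (size x ^ k + k) in
       halting (cst f) /\ out f = [:: L x]) /\
    \sum_(tau : (size x ^ k).-tuple bool)
       hamming tau (cat (run x (init M (k * logn2 (size x)) tau) (size x ^ k + k)))
    <= e * 2 ^ (size x ^ k).

(* P: decided by a machine of the same model (no catalytic tape), with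
   polynomially many work cells, halting within polynomial time. *)
Definition in_P (L : seq bool -> bool) : Prop :=
  exists (k : nat) (M : machine), forall x : seq bool,
    let f := run x (init M (size x ^ k + k) [::]) (size x ^ k + k) in
    halting (cst f) /\ out f = [:: L x].

(* Main.v *)
(* A halting time-unbounded machine M of the average-error class runs, from the
   tapes t of length N = n^k, along the edges of its configuration graph, which has
   2^N poly(n) nodes. Reading the graph as an in-forest, each t has a root (where M
   outputs); strings with the same root have the same final tape, so by Markov all but
   a quarter of the strings are in Hamming balls of polynomial size around it, and
   since the trees are disjoint at least half of the strings t have a tree of
   polynomial size.

   The Euler tour of such a tree is reversible: one step backwards is one step of the
   tour that explores children in the opposite order. A catalytic machine can thus tour
   the tree of the first N catalytic bits for a polynomial number of steps, note the
   answer if the root was seen, and undo the tour, restoring the bits exactly. With PT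
   disjoint blocks of N bits all of them fail with probability at most 2^-PT; in this
   case a polynomial time machine for L is run on the first PT catalytic cells, which
   costs at most PT errors, hence less than 1 on average.

   Conversely, a polynomial time machine for L simulates M on the all-zero catalytic
   tape. Both machines are compiled from arithmetic loop programs. *)
Require Import Defs.
From mathcomp Require Import all_boot zify.
From Stdlib Require Import FunctionalExtensionality.
Set Implicit Arguments. Unset Strict Implicit. Unset Printing Implicit Defensive.

(** * Structured programs for the machines *)

(** The work tape has only O(log n) bits, whereas a run of M may be exponentially long and
    overwrites the catalytic tape, so no undo log fits. The tour needs none: a predecessor is fixed
    by its core, i.e. all but the catalytic tape, and the one catalytic bit it scanned. So each node
    has polynomially many candidate predecessors, and beyond its current state the tour needs only
    the number of its steps in order to be undone. The graph is cut at the first output, which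
    already is the answer; the final tape is still a function of the root, since M is deterministic
    from there on. A tour cut off by its budget has met no terminal node at all, so it can be undone
    and cannot answer wrongly. The threshold for tree sizes is Z = 4 * ball * S, with ball a bound
    for Hamming balls of radius 4e and S the number of cores: at most 2^N * S / Z roots have larger
    trees, and at most ball near strings lead to each. Everything that the tour counts is polynomial
    in n and hence fits in O(log n) bits. This is why registers are kept in binary and why the loop
    language caps its variables by a polynomial. *)

Definition flags : finType := (bool * bool)%type.

Definition tact := flags -> option bool -> bool -> bool -> trans flags.

Inductive tcmd :=
| TAct of tact
| TSeq of tcmd & tcmd
| TIf of (flags -> bool) & tcmd & tcmd
| TWhile of (flags -> bool) & tcmd.

Record tst := TSt {
  tf : flags; tih : nat; tw : seq bool; twh : nat;
  tc : seq bool; tch : nat; tout : seq bool }.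

Definition tapp Q (x : seq bool) (t : trans Q) (f : flags) (s : tst) : tst :=
  TSt f (minn (mv (mi t) (tih s)) (size x))
    (wr (tw s) (twh s) (wbit t)) (minn (mv (mw t) (twh s)) (size (tw s)).-1)
    (wr (tc s) (tch s) (cbit t)) (minn (mv (mc t) (tch s)) (size (tc s)).-1)
    (if obit t is Some b then rcons (tout s) b else tout s).

Definition tstep (x : seq bool) (g : tact) (s : tst) : tst :=
  let t := g (tf s) (read_in x (tih s)) (nth false (tw s) (twh s))
             (nth false (tc s) (tch s)) in
  tapp x t (nq t) s.

Inductive texec (x : seq bool) : tcmd -> tst -> tst -> nat -> Prop :=
| TeAct g s : texec x (TAct g) s (tstep x g s) 1
| TeSeq a b s s1 s2 t1 t2 : texec x a s s1 t1 -> texec x b s1 s2 t2 ->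
    texec x (TSeq a b) s s2 (t1 + t2)
| TeIfT (b : flags -> bool) c1 c2 s s1 t : b (tf s) -> texec x c1 s s1 t ->
    texec x (TIf b c1 c2) s s1 t.+1
| TeIfF (b : flags -> bool) c1 c2 s s1 t : ~~ b (tf s) -> texec x c2 s s1 t ->
    texec x (TIf b c1 c2) s s1 t.+1
| TeWhF (b : flags -> bool) c s : ~~ b (tf s) -> texec x (TWhile b c) s s 1
| TeWhT (b : flags -> bool) c s s1 s2 t1 t2 : b (tf s) -> texec x c s s1 t1 ->
    texec x (TWhile b c) s1 s2 t2 -> texec x (TWhile b c) s s2 (t1 + t2).+1.

Definition tvalid (x : seq bool) (s : tst) :=
  [/\ tih s <= size x, twh s <= (size (tw s)).-1 & tch s <= (size (tc s)).-1].

Lemma size_wr t p b : size (wr t p b) = size t.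
Proof. by rewrite /wr; case: ifP => // h; rewrite size_set_nth; apply/maxn_idPr. Qed.

Lemma nth_wr t p b i : p < size t ->
  nth false (wr t p b) i = if i == p then b else nth false t i.
Proof. by move=> h; rewrite /wr h nth_set_nth. Qed.

Lemma wr_nth t p : wr t p (nth false t p) = t.
Proof.
rewrite /wr; case: ifP => // h; apply: (@eq_from_nth _ false).
  by rewrite size_set_nth; apply/maxn_idPr.
by move=> i _; rewrite nth_set_nth /=; case: eqP => [->|].
Qed.

Lemma tapp_valid Q x (t : trans Q) f s : tvalid x (tapp x t f s).
Proof. by split; rewrite /= ?size_wr geq_minr. Qed.

Lemma texec_valid x c s s' t : texec x c s s' t -> tvalid x s -> tvalid x s'.
Proof. by elim=> // *; auto; apply: tapp_valid. Qed.

(** The extra point [None] of a conditional or a loop is where its test is evaluated; passing it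
    costs one step. *)
Fixpoint pos (c : tcmd) : finType :=
  match c with
  | TAct _ => unit
  | TSeq a b => (pos a + pos b)%type
  | TIf _ a b => option (pos a + pos b)
  | TWhile _ a => option (pos a)
  end.

Fixpoint entry (c : tcmd) : pos c :=
  match c with
  | TAct _ => tt
  | TSeq a b => inl (entry a)
  | TIf _ _ _ => None
  | TWhile _ _ => None
  end.

Definition noop (f : flags) (w c : bool) : trans flags :=
  Trans f w c None MStay MStay MStay.

Fixpoint nxt (c : tcmd) :
  pos c -> flags -> option bool -> bool -> bool -> option (pos c) * trans flags :=
  match c return
    pos c -> flags -> option bool -> bool -> bool -> option (pos c) * trans flags with
  | TAct g => fun _ f i w k => (None, g f i w k)
  | TSeq a b => fun p f i w k =>
      match p with
      | inl p => let r := nxt p f i w k in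
                 (Some (if r.1 is Some p' then inl p' else inr (entry b)), r.2)
      | inr p => let r := nxt p f i w k in (omap inr r.1, r.2)
      end
  | TIf t a b => fun p f i w k =>
      match p with
      | None => (Some (Some (if t f then inl (entry a) else inr (entry b))), noop f w k)
      | Some (inl p) => let r := nxt p f i w k in (omap (fun p => Some (inl p)) r.1, r.2)
      | Some (inr p) => let r := nxt p f i w k in (omap (fun p => Some (inr p)) r.1, r.2)
      end
  | TWhile t a => fun p f i w k =>
      match p with
      | None => (if t f then Some (Some (entry a)) else None, noop f w k)
      | Some p => let r := nxt p f i w k in (Some r.1, r.2)
      end
  end.

Definition nxts x c (p : pos c) (s : tst) : option (pos c) * tst :=
  let r := nxt p (tf s) (read_in x (tih s)) (nth false (tw s) (twh s))
             (nth false (tc s) (tch s)) in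
  (r.1, tapp x r.2 (nq r.2) s).

Inductive exits x c : pos c -> tst -> tst -> nat -> Prop :=
| ExNow p s s' : nxts x p s = (None, s') -> exits x p s s' 1
| ExStep p p1 s s1 s' t : nxts x p s = (Some p1, s1) -> exits x p1 s1 s' t ->
    exits x p s s' t.+1.

(** The machine clamps its heads at every step, so a silent step is harmless only for heads that are
    already inside their tapes. *)
Lemma noopE x (s : tst) : tvalid x s ->
  tapp x (noop (tf s) (nth false (tw s) (twh s)) (nth false (tc s) (tch s)))
    (tf s) s = s.
Proof.
case: s => f ih w wh c ch o [] /= h1 h2 h3; rewrite /tapp /= !wr_nth.
by rewrite (minn_idPl h1) (minn_idPl h2) (minn_idPl h3).
Qed.

(** For a subprogram in tail position: leaving it leaves the whole program. *)
Lemma exits_emb x a c (e : pos a -> pos c) p s s' t :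
  (forall p f i w k, nxt (e p) f i w k = let r := nxt p f i w k in (omap e r.1, r.2)) ->
  @exits x a p s s' t -> @exits x c (e p) s s' t.
Proof.
move=> E; elim=> {p s s' t} [p s s'|p p1 s s1 s' t] h; last move=> _ ih.
  by apply: ExNow; move: h; rewrite /nxts E /=; case=> -> <-.
by apply: ExStep ih; move: h; rewrite /nxts E /=; case=> -> <-.
Qed.

(** For a subprogram with a continuation: leaving it leads to the control point [q], which for the
    body of a loop is the loop test. *)
Lemma exits_then x a c (e : pos a -> pos c) q p s s1 s2 t1 t2 :
  (forall p f i w k, nxt (e p) f i w k =
     let r := nxt p f i w k in (Some (oapp e q r.1), r.2)) ->
  @exits x a p s s1 t1 -> @exits x c q s1 s2 t2 -> @exits x c (e p) s s2 (t1 + t2).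
Proof.
move=> E H; elim: H s2 t2 => {p s s1 t1} [p s s'|p p1 s s1 s' t] h; last move=> _ ih.
  by move=> s2 t2 H; apply: ExStep H; move: h; rewrite /nxts E /=; case=> -> <-.
move=> s2 t2 /ih H; rewrite addSn; apply: ExStep H.
by move: h; rewrite /nxts E /=; case=> -> <-.
Qed.

Lemma texec_exits x c s s' t : texec x c s s' t -> tvalid x s ->
  @exits x c (entry c) s s' t.
Proof.
elim=> {c s s' t}.
- by move=> g s _; apply: ExNow.
- move=> a b s s1 s2 t1 t2 H1 I1 H2 I2 V.
  have V1 := texec_valid H1 V.
  apply: (@exits_then _ _ (TSeq a b) inl (inr (entry b))) (I1 V) _ => //.
  exact: (@exits_emb _ _ (TSeq a b) inr _ _ _ _ _ (I2 V1)).
- move=> b c1 c2 s s1 t hb _ I V.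
  apply: ExStep (@exits_emb _ _ (TIf b c1 c2) (Some \o inl) _ _ _ _ _ (I V)) => //.
  by rewrite /nxts /= hb noopE.
- move=> b c1 c2 s s1 t /negbTE hb _ I V.
  apply: ExStep (@exits_emb _ _ (TIf b c1 c2) (Some \o inr) _ _ _ _ _ (I V)) => //.
  by rewrite /nxts /= hb noopE.
- by move=> b c s /negbTE hb V; apply: ExNow; rewrite /nxts /= hb noopE.
- move=> b c s s1 s2 t1 t2 hb H1 I1 _ I2 V.
  have V1 := texec_valid H1 V.
  apply: ExStep (@exits_then _ _ (TWhile b c) Some None _ _ _ _ _ _ _ (I1 V) (I2 V1)).
    by rewrite /nxts /= hb noopE.
  by move=> p *; rewrite /=; case: (nxt _ _ _ _ _) => -[].
Qed.

Definition tmach (c : tcmd) : machine :=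
  @Machine (option (pos c) * flags)%type (Some (entry c), (false, false))
    (fun q => ~~ q.1)
    (fun q i w k =>
       if q.1 is Some p then
         let r := nxt p q.2 i w k in
         Trans (r.1, nq r.2) (wbit r.2) (cbit r.2) (obit r.2) (mi r.2) (mw r.2) (mc r.2)
       else Trans q w k None MStay MStay MStay).

Definition tcfg (c : tcmd) (p : option (pos c)) (s : tst) : config (tmach c) :=
  @Config (tmach c) (p, tf s) (tih s) (tw s) (twh s) (tc s) (tch s) (tout s).

Lemma run_exits x c p s s' t : @exits x c p s s' t ->
  run x (tcfg (Some p) s) t = tcfg None s'.
Proof.
elim=> {p s s' t} [p s s'|p p1 s s1 s' t] h; last move=> _ ih.
  rewrite /run /= /step /=; move: h; rewrite /nxts; case: nxt => o r /= [-> <-].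
  by rewrite /tcfg.
rewrite /run iterSr -/(run _ _ _) -ih; congr run.
by rewrite /step /=; move: h; rewrite /nxts; case: nxt => o r /= [-> <-].
Qed.

Lemma run_halted M x (c : config M) t : halting (cst c) -> run x c t = c.
Proof. by move=> h; elim: t => //= t ->; rewrite /step h. Qed.

Lemma run_add M x (c : config M) a b : run x c (a + b) = run x (run x c a) b.
Proof. by rewrite /run addnC iterD. Qed.

Lemma texec_run x c s tau s' t T :
  texec x c (TSt (false, false) 0 (nseq s false) 0 tau 0 [::]) s' t -> t <= T ->
  run x (init (tmach c) s tau) T = tcfg None s'.
Proof.
move=> H le; rewrite -(subnKC le) run_add.
rewrite [run _ _ t](_ : _ = tcfg None s'); first by rewrite run_halted.
exact: (run_exits (texec_exits H _)).
Qed.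

(** * Registers on the work tape *)

Definition texle x c s s' T := exists2 t, t <= T & texec x c s s' t.

Lemma texle_leq x c s s' T T' : T <= T' -> texle x c s s' T -> texle x c s s' T'.
Proof. by move=> h [t le H]; exists t => //; apply: leq_trans h. Qed.

Lemma texle_seq x a b s s1 s2 T1 T2 :
  texle x a s s1 T1 -> texle x b s1 s2 T2 -> texle x (TSeq a b) s s2 (T1 + T2).
Proof.
by move=> [t1 l1 H1] [t2 l2 H2]; exists (t1 + t2); [apply: leq_add|apply: TeSeq H1 H2].
Qed.

Lemma texle_ifT x (b : flags -> bool) c1 c2 s s1 T : b (tf s) ->
  texle x c1 s s1 T -> texle x (TIf b c1 c2) s s1 T.+1.
Proof. by move=> hb [t l H]; exists t.+1 => //; apply: TeIfT. Qed.

Lemma texle_ifF x (b : flags -> bool) c1 c2 s s1 T : ~~ b (tf s) ->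
  texle x c2 s s1 T -> texle x (TIf b c1 c2) s s1 T.+1.
Proof. by move=> hb [t l H]; exists t.+1 => //; apply: TeIfF. Qed.

Lemma texle_whF x (b : flags -> bool) c s : ~~ b (tf s) -> texle x (TWhile b c) s s 1.
Proof. by move=> hb; exists 1 => //; apply: TeWhF. Qed.

Lemma texle_whT x (b : flags -> bool) c s s1 s2 T1 T2 : b (tf s) ->
  texle x c s s1 T1 -> texle x (TWhile b c) s1 s2 T2 ->
  texle x (TWhile b c) s s2 (T1 + T2).+1.
Proof.
move=> hb [t1 l1 H1] [t2 l2 H2]; exists (t1 + t2).+1; last exact: TeWhT H1 H2.
by rewrite ltnS; apply: leq_add.
Qed.

Definition tnop := TAct (fun f i w k => noop f w k).

Fixpoint trep k c := if k is k'.+1 then TSeq c (trep k' c) else tnop.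

Definition tmvw m := TAct (fun f i w k => Trans f w k None MStay m MStay).

Definition setfl (sel : bool) (v : bool) (f : flags) : flags :=
  if sel then (f.1, v) else (v, f.2).

Definition trd (sel : bool) o := TSeq (trep o (tmvw MRight))
  (TSeq (TAct (fun f i w k => noop (setfl sel w f) w k)) (trep o (tmvw MLeft))).

Definition twrt o v := TSeq (trep o (tmvw MRight))
  (TSeq (TAct (fun f i w k => noop f v k)) (trep o (tmvw MLeft))).

Definition tsetf1 v := TAct (fun f i w k => noop (v, f.2) w k).

Section Work.
Variables (x : seq bool) (ih : nat) (c : seq bool) (ch : nat) (out : seq bool).
Hypotheses (Hih : ih <= size x) (Hch : ch <= (size c).-1).
Variables (G ng : nat).
Hypothesis G0 : 0 < G.

Definition TS f w h := TSt f ih w h c ch out.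

Lemma te_nop f w h : h < size w -> texle x tnop (TS f w h) (TS f w h) 1.
Proof.
move=> hw; exists 1 => //.
rewrite -[X in texec _ _ _ X _](@noopE x (TS f w h)); last by split => //=; lia.
exact: TeAct.
Qed.

Lemma te_mv m f w h : h < size w -> mv m h < size w ->
  texle x (tmvw m) (TS f w h) (TS f w (mv m h)) 1.
Proof.
move=> h1 h2; exists 1 => //; rewrite [X in texec _ _ _ X _](_ : _ = tstep x
  (fun f i w k => Trans f w k None MStay m MStay) (TS f w h)); first exact: TeAct.
rewrite /tstep /tapp /TS /= !wr_nth; congr TSt; lia.
Qed.

Lemma te_mvR k f w h : h + k < size w ->
  texle x (trep k (tmvw MRight)) (TS f w h) (TS f w (h + k)) k.+1.
Proof.
elim: k h => [|k IH] h hk /=; first by rewrite addn0; apply: te_nop; lia.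
rewrite -[k.+2]/(1 + k.+1) addnS -addSn; apply: texle_seq (IH h.+1 _); last by lia.
by apply: te_mv => /=; lia.
Qed.

Lemma te_mvL k f w h : h + k < size w ->
  texle x (trep k (tmvw MLeft)) (TS f w (h + k)) (TS f w h) k.+1.
Proof.
elim: k h => [|k IH] h hk /=; first by rewrite addn0; apply: te_nop; lia.
rewrite -[k.+2]/(1 + k.+1) addnS; apply: texle_seq (IH h _); last by lia.
by apply: (@te_mv MLeft) => /=; lia.
Qed.

Lemma te_rd sel o f w h : h + o < size w ->
  texle x (trd sel o) (TS f w h) (TS (setfl sel (nth false w (h + o)) f) w h) (2 * o + 3).
Proof.
move=> hw; rewrite (_ : 2 * o + 3 = o.+1 + (1 + o.+1)); last by lia.
apply: texle_seq (te_mvR f hw) _; apply: texle_seq (te_mvL _ hw).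
exists 1 => //; rewrite [X in texec _ _ _ X _](_ : _ = tstep x
  (fun f i w k => noop (setfl sel w f) w k) (TS f w (h + o))); first exact: TeAct.
rewrite /tstep /tapp /TS /= !wr_nth; congr TSt; lia.
Qed.

Lemma te_wrt o v f w h : h + o < size w ->
  texle x (twrt o v) (TS f w h) (TS f (wr w (h + o) v) h) (2 * o + 3).
Proof.
move=> hw; rewrite (_ : 2 * o + 3 = o.+1 + (1 + o.+1)); last by lia.
have hw' : h + o < size (wr w (h + o) v) by rewrite size_wr.
apply: texle_seq (te_mvR f hw) _; apply: texle_seq (te_mvL _ hw').
exists 1 => //; rewrite [X in texec _ _ _ X _](_ : _ = tstep x
  (fun f i w k => noop f v k) (TS f w (h + o))); first exact: TeAct.
rewrite /tstep /tapp /TS /= !wr_nth; congr TSt; lia.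
Qed.

(* The work tape is cut into groups of G cells: cell o of group j holds [lay j o]. *)
Definition wenc (lay : nat -> nat -> bool) (w : seq bool) :=
  ng * G <= size w /\
  forall j o, j < ng -> o < G -> nth false w (j * G + o) = lay j o.

(* Head positions of the work tape are first cells of groups, given by their group. *)
Definition TL cm (f : flags) lay (j : nat) (f' : flags) lay' (j' : nat) T :=
  forall w, wenc lay w -> exists w', [/\ wenc lay' w', size w' = size w &
    texle x cm (TS f w (j * G)) (TS f' w' (j' * G)) T].

Definition upd2 (lay : nat -> nat -> bool) j o v := fun j' o' =>
  if (j' == j) && (o' == o) then v else lay j' o'.

Definition c0 := 2 * G + 3.

Lemma pos_lt (w : seq bool) j o : ng * G <= size w -> j < ng -> o < G -> j * G + o < size w.
Proof. move=> h1 h2 h3; have : j.+1 * G <= ng * G by rewrite leq_mul2r h2 orbT. lia. Qed.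

Lemma TL_leq cm f lay j f' lay' j' T T' : T <= T' ->
  TL cm f lay j f' lay' j' T -> TL cm f lay j f' lay' j' T'.
Proof.
by move=> le H w /H [w' [h1 h2 h3]]; exists w'; split=> //; apply: texle_leq h3.
Qed.

Lemma TL_ext cm f lay1 lay2 j f' lay1' lay2' j' T :
  (forall i o, i < ng -> lay2 i o = lay1 i o) ->
  (forall i o, i < ng -> lay1' i o = lay2' i o) ->
  TL cm f lay1 j f' lay1' j' T -> TL cm f lay2 j f' lay2' j' T.
Proof.
move=> e1 e2 H w [sz hw]; case: (H w); first by split=> // i o hi ho; rewrite hw // e1.
move=> w' [[sz' hw'] h2 h3]; exists w'; split=> //; split => // i o hi ho.
by rewrite hw' // e2.
Qed.

Lemma TL_seq a b f lay j f1 lay1 j1 f2 lay2 j2 T1 T2 :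
  TL a f lay j f1 lay1 j1 T1 -> TL b f1 lay1 j1 f2 lay2 j2 T2 ->
  TL (TSeq a b) f lay j f2 lay2 j2 (T1 + T2).
Proof.
move=> H1 H2 w /H1 [w1 [/H2 [w2 [h1 h2 h3]] h4 h5]].
by exists w2; split=> //; [rewrite h2|apply: texle_seq h5 h3].
Qed.

Lemma TL_ifT (b : flags -> bool) c1 c2 f lay j f' lay' j' T : b f ->
  TL c1 f lay j f' lay' j' T -> TL (TIf b c1 c2) f lay j f' lay' j' T.+1.
Proof. by move=> hb H w /H [w1 [h1 h2 h3]]; exists w1; split=> //; apply: texle_ifT. Qed.

Lemma TL_ifF (b : flags -> bool) c1 c2 f lay j f' lay' j' T : ~~ b f ->
  TL c2 f lay j f' lay' j' T -> TL (TIf b c1 c2) f lay j f' lay' j' T.+1.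
Proof. by move=> hb H w /H [w1 [h1 h2 h3]]; exists w1; split=> //; apply: texle_ifF. Qed.

Lemma TL_whF (b : flags -> bool) cm f lay j : ~~ b f ->
  TL (TWhile b cm) f lay j f lay j 1.
Proof. by move=> hb w H; exists w; split=> //; apply: texle_whF. Qed.

Lemma TL_whT (b : flags -> bool) a f lay j f1 lay1 j1 f2 lay2 j2 T1 T2 : b f ->
  TL a f lay j f1 lay1 j1 T1 -> TL (TWhile b a) f1 lay1 j1 f2 lay2 j2 T2 ->
  TL (TWhile b a) f lay j f2 lay2 j2 (T1 + T2).+1.
Proof.
move=> hb H1 H2 w /H1 [w1 [/H2 [w2 [h1 h2 h3]] h4 h5]].
by exists w2; split=> //; [rewrite h2|apply: texle_whT h5 h3].
Qed.

Lemma TL_nop f lay j : j < ng -> TL tnop f lay j f lay j 1.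
Proof.
move=> hj w H; exists w; split=> //; apply: te_nop.
by rewrite -[j * G]addn0; apply: pos_lt; case: H.
Qed.

Lemma TL_setf1 v f lay j : j < ng -> TL (tsetf1 v) f lay j (v, f.2) lay j 1.
Proof.
move=> hj w H; exists w; split=> //.
have hw : j * G < size w by rewrite -[j * G]addn0; apply: pos_lt; case: H.
exists 1 => //; rewrite [X in texec _ _ _ X _](_ : _ = tstep x
  (fun f i w k => noop (v, f.2) w k) (TS f w (j * G))); first exact: TeAct.
rewrite /tstep /tapp /TS /= !wr_nth; congr TSt; lia.
Qed.

Lemma TL_rd sel o f lay j : j < ng -> o < G ->
  TL (trd sel o) f lay j (setfl sel (lay j o) f) lay j c0.
Proof.
move=> hj ho w H; exists w; split=> //; case: H => sz H.
by apply: texle_leq (_ : 2 * o + 3 <= _) _;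
  [rewrite /c0; lia|rewrite -H //; apply: te_rd; apply: pos_lt].
Qed.

Lemma TL_wrt o v f lay j : j < ng -> o < G ->
  TL (twrt o v) f lay j f (upd2 lay j o v) j c0.
Proof.
move=> hj ho w [sz H]; exists (wr w (j * G + o) v); split.
- split; rewrite ?size_wr // => j' o' hj' ho'; rewrite nth_wr ?pos_lt // H // /upd2.
  (* Distinct pairs of group and offset are distinct cells, by quotient and remainder modulo [G]. *)
  congr (if _ then _ else _); apply/eqP/andP => [e|[/eqP-> /eqP->]] //.
  have := congr1 (fun k => k %/ G) e; have := congr1 (fun k => k %% G) e.
  by rewrite !modnMDl !modn_small // !divnMDl // !divn_small // !addn0 => -> ->.
- by rewrite size_wr.
apply: texle_leq (_ : 2 * o + 3 <= _) _; first by rewrite /c0; lia.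
by apply: te_wrt; apply: pos_lt.
Qed.

Definition goR := trep G (tmvw MRight).
Definition goL := trep G (tmvw MLeft).

Lemma TL_goR f lay j : j.+1 < ng -> TL goR f lay j f lay j.+1 c0.
Proof.
move=> hj w H; exists w; split=> //; case: H => sz _.
apply: (@texle_leq _ _ _ _ G.+1); first by rewrite /c0; lia.
by rewrite mulSn addnC; apply: te_mvR; have := pos_lt sz hj G0; lia.
Qed.

Lemma TL_goL f lay j : j.+1 < ng -> TL goL f lay j.+1 f lay j c0.
Proof.
move=> hj w H; exists w; split=> //; case: H => sz _.
apply: (@texle_leq _ _ _ _ G.+1); first by rewrite /c0; lia.
by rewrite mulSn addnC; apply: te_mvL; have := pos_lt sz hj G0; lia.
Qed.

Arguments TL_rd : clear implicits.
Arguments TL_goL : clear implicits.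

(** Register commands start and end in group 0. The position of the head is stored nowhere, so the
    way back is found by the mark on track 0. *)
Definition home := TSeq (trd false 0)
  (TWhile (fun f => ~~ f.1) (TSeq goL (trd false 0))).

Lemma TL_home f lay j : (forall i, i < ng -> lay i 0 = (i == 0)) -> j < ng ->
  TL home f lay j (true, f.2) lay 0 ((j + 1) * (3 * c0)).
Proof.
move=> Hl hj; apply: (@TL_leq _ _ _ _ _ _ _ (c0 + (j * (3 * c0)).+1)); first by rewrite /c0; lia.
apply: TL_seq (TL_rd false 0 f lay j hj G0) _; rewrite /= Hl //.
elim: j hj => [|j IH] hj; first exact: TL_whF.
apply: TL_leq (_ : (c0 + c0 + (j * (3 * c0)).+1).+1 <= _) _; first by rewrite /c0; lia.
have hj' : j < ng by lia.
apply: TL_whT (IH hj') => //; apply: TL_seq (TL_goL _ _ _ hj) _.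
by have := TL_rd false 0 (j.+1 == 0, f.2) lay j hj' G0; rewrite Hl.
Qed.
End Work.

(* Bijective base 2: false is the digit 1 and true the digit 2, least significant first. *)
Fixpoint binc (s : seq bool) :=
  match s with
  | [::] => [:: false]
  | false :: s => true :: s
  | true :: s => false :: binc s
  end.

Fixpoint bdec (s : seq bool) :=
  match s with
  | [::] => [::]
  | true :: s => false :: s
  | false :: s => if s is [::] then [::] else true :: bdec s
  end.

Lemma binc_neq0 s : binc s != [::].
Proof. by case: s => [|[] s]. Qed.

Lemma bincK s : bdec (binc s) = s.
Proof.
elim: s => [|[] s IH] //=; rewrite IH.
by case: (binc s) (binc_neq0 s).
Qed.

Definition rep v := iter v binc [::].

(** Bijective numerals have no leading zeros: zero is the only number without digits, so a zero test
    looks at a single cell. *)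
Lemma rep_eq0 v : (size (rep v) == 0) = (v == 0).
Proof. by case: v => //= v; rewrite size_eq0 (negbTE (binc_neq0 _)). Qed.

(** The smallest value with s digits is that of s digits 1, namely 2^s - 1. This is what lets
    polynomially bounded registers fit on a logarithmic work tape. *)
Lemma size_rep v : 2 ^ size (rep v) <= v.+1.
Proof.
pose val := foldr (fun (b : bool) a => b.+1 + 2 * a) 0.
have vi s : val (binc s) = (val s).+1.
  by elim: s => [|[] s IH] //=; rewrite ?IH; lia.
have vr u : val (rep u) = u by elim: u => //= u IH; rewrite vi IH.
have vs s : 2 ^ size s <= (val s).+1 by elim: s => //= b s IH; rewrite expnS; lia.
by rewrite -{2}[v]vr.
Qed.

Definition upd T (f : nat -> T) r v := fun r' => if r' == r then v else f r'.

(* Track 0 marks the first group, tracks 1 and 2 are the head position and the contents of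
   a memory simulated on the work tape; then each register has two tracks: the presence
   of a digit in a group, and its value. *)
Definition lay (regs : nat -> nat) (X Y : nat -> bool) (j o : nat) : bool :=
  match o with
  | 0 => j == 0
  | 1 => X j
  | 2 => Y j
  | o'.+3 => if odd o' then nth false (rep (regs o'./2)) j
             else j < size (rep (regs o'./2))
  end.

Definition op r := r.*2.+3.
Definition od r := r.*2.+4.

Section Regs.
Variables (x : seq bool) (ih : nat) (c : seq bool) (ch : nat) (out : seq bool).
Hypotheses (Hih : ih <= size x) (Hch : ch <= (size c).-1).
Variables (R ng : nat).
Let G := 2 * R + 3.
Let G0 : 0 < G. Proof. by rewrite /G addn3. Qed.
Local Notation TL := (TL x ih c ch out G ng).
Local Notation c0 := (c0 G).
Local Notation goR := (goR G).
Local Notation goL := (goL G).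
Local Notation home := (home G).

Let RD := @TL_rd x ih c ch out Hih Hch G ng G0.
Let WR := @TL_wrt x ih c ch out Hih Hch G ng G0.
Let SF := @TL_setf1 x ih c ch out Hih Hch G ng G0.
Let GR := @TL_goR x ih c ch out Hih Hch G ng G0.
Let GL := @TL_goL x ih c ch out Hih Hch G ng G0.
Let HM := @TL_home x ih c ch out Hih Hch G ng G0.
Arguments RD : clear implicits.
Arguments WR : clear implicits.
Arguments SF : clear implicits.
Arguments GR : clear implicits.
Arguments GL : clear implicits.
Arguments HM : clear implicits.

Definition dg (s : seq bool) (j : nat) := (j < size s, nth false s j).
(** Shape of the invariant of the carry loops: the groups below [j] are finished, and the digits
    still to be processed start at group [j]. *)
Definition cmb T j (E D : nat -> T) i := if i < j then E i else D (i - j).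
Lemma cmb_shift T j (E D : nat -> T) d i :
  cmb j.+1 (cmb j E (fun=> d)) D i = cmb j E (fun k => if k is k'.+1 then D k' else d) i.
Proof.
rewrite /cmb ltnS; case: (ltngtP i j) => [//|l|->]; last by rewrite subnn.
by rewrite (_ : i - j = (i - j.+1).+1); last lia.
Qed.

Lemma cmb_ext T j (E D D' : nat -> T) i : D =1 D' -> cmb j E D i = cmb j E D' i.
Proof. by move=> e; rewrite /cmb e. Qed.

Lemma cmb_upd T j (E D : nat -> T) d i :
  upd (cmb j E D) j d i = cmb j E (fun k => if k is k'.+1 then D k'.+1 else d) i.
Proof.
rewrite /upd /cmb; case: (ltngtP i j) => [//|l|->]; last by rewrite subnn.
by rewrite (_ : i - j = (i - j.+1).+1); last lia.
Qed.

Definition Lr lay0 r (D : nat -> bool * bool) (j o : nat) : bool :=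
  if o == op r then (D j).1 else if o == od r then (D j).2 else lay0 j o.

Lemma layE regs X Y r v :
  lay (upd regs r v) X Y =2 Lr (lay regs X Y) r (dg (rep v)).
Proof.
move=> j o; rewrite /Lr /op /od; case: o => [|[|[|o]]] //=; rewrite /upd !eqSS.
case: (boolP (odd o)) => ho.
  have ->: (o == r.*2) = false by apply/eqP => e; move: ho; rewrite e odd_double.
  have ->: (o == (r.*2).+1) = (o./2 == r) by lia.
  by case: eqP.
have ->: (o == r.*2) = (o./2 == r) by lia.
have ->: (o == (r.*2).+1) = false by apply/eqP => e; move: ho; rewrite e /= odd_double.
by case: eqP.
Qed.

Lemma upd_id T (f : nat -> T) r : upd f r (f r) =1 f.
Proof. by move=> i; rewrite /upd; case: eqP => [->|]. Qed.

Lemma lay_ext regs regs' X Y : regs =1 regs' -> lay regs X Y =2 lay regs' X Y.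
Proof. by move=> e j [|[|[|o]]] //=; rewrite e. Qed.

Lemma Lr_op lay0 r D j : Lr lay0 r D j (op r) = (D j).1.
Proof. by rewrite /Lr eqxx. Qed.

Lemma Lr_od lay0 r D j : Lr lay0 r D j (od r) = (D j).2.
Proof. by rewrite /Lr /op /od eqxx; case: eqP => // h; exfalso; lia. Qed.

Lemma Lr_upd_op lay0 r D j v :
  upd2 (Lr lay0 r D) j (op r) v =2 Lr lay0 r (upd D j (v, (D j).2)).
Proof.
move=> i o; rewrite /upd2 /Lr /upd /op /od.
case: (i =P j) => [->|] //=; case: (o =P _) => //.
Qed.

Lemma Lr_upd_od lay0 r D j v :
  upd2 (Lr lay0 r D) j (od r) v =2 Lr lay0 r (upd D j ((D j).1, v)).
Proof.
move=> i o; rewrite /upd2 /Lr /upd /op /od.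
case: (i =P j) => [->|] //=; case: (o =P (r.*2).+4) => //=; case: (o =P _) => // ->.
by move=> h; exfalso; lia.
Qed.

Lemma Lr_ext lay0 r D D' i o : D i = D' i -> Lr lay0 r D i o = Lr lay0 r D' i o.
Proof. by rewrite /Lr => ->. Qed.

Variable (r : nat).
Hypothesis rR : r < R.
Let opG : op r < G. Proof. by rewrite /op /G; lia. Qed.
Let odG : od r < G. Proof. by rewrite /od /G; lia. Qed.

(** Flag 1 receives the presence of the digit and doubles as the carry: it stays set after a digit 2
    and is cleared once the carry is absorbed. *)
Definition tinc_loop := TWhile (fun f => f.1)
  (TSeq (trd false (op r)) (TSeq (trd true (od r))
    (TIf (fun f => f.1 && f.2) (TSeq (twrt (od r) false) goR)
      (TSeq (TIf (fun f => f.1) (twrt (od r) true) (twrt (op r) true)) (tsetf1 false))))).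

Lemma TL_inc_loop lay0 (s : seq bool) : forall j E (f : flags), f.1 -> j + size s < ng ->
  exists j' f', j' <= j + size s /\
   TL tinc_loop f (Lr lay0 r (cmb j E (dg s))) j
      f' (Lr lay0 r (cmb j E (dg (binc s)))) j' ((size s).+1 * (8 * c0)).
Proof.
have c0_1 : 0 < c0 by rewrite /c0; lia.
elim: s => [|[] s IH] j E f f1 hj.
- exists j, (false, false); split; first by rewrite addn0.
  have hj' : j < ng by lia.
  apply: TL_leq (_ : ((c0 + (c0 + (c0.+1 + 1).+1)) + 1).+1 <= _) _; first by move=> /=; lia.
  have D0 : cmb j E (dg [::]) j = (false, false) by rewrite /cmb ltnn subnn.
  apply: TL_whT; [exact: f1| |by apply: TL_whF] => /=.
  apply: TL_seq; first exact: (RD _ _ _ _ _ hj' opG).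
  rewrite Lr_op D0; apply: TL_seq; first exact: (RD _ _ _ _ _ hj' odG).
  rewrite Lr_od D0; apply: TL_ifF => //; apply: TL_seq.
    (* The value cell of an absent digit is false, so setting its presence cell creates a digit
       1. *)
    apply: TL_ifF => //; exact: (WR _ _ _ _ _ hj' opG).
  apply: TL_ext (SF _ _ _ _ hj') => // i o hi.
  rewrite Lr_upd_op D0; apply: Lr_ext; rewrite cmb_upd.
  by apply: cmb_ext => -[|[]].
- have hj' : j.+1 < ng by move: hj => /=; lia.
  have hj'' : j < ng by lia.
  pose E' := cmb j E (fun=> (true, false)).
  have [|j' [f' [h H]]] := IH j.+1 E' (true, true) isT; first by move: hj => /=; lia.
  exists j', f'; split; first by move: h => /=; lia.
  have D0 : cmb j E (dg (true :: s)) j = (true, true) by rewrite /cmb ltnn subnn.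
  apply: TL_leq (_ : ((c0 + (c0 + ((c0 + c0)).+1)) + (size s).+1 * (8 * c0)).+1 <= _) _.
    by move=> /=; lia.
  apply: TL_whT; first exact: f1.
    apply: TL_seq; first exact: (RD _ _ _ _ _ hj'' opG).
    rewrite Lr_op D0; apply: TL_seq; first exact: (RD _ _ _ _ _ hj'' odG).
    rewrite Lr_od D0; apply: TL_ifT => //; apply: TL_seq.
      exact: (WR _ _ _ _ _ hj'' odG).
    exact: (GR _ _ _ hj').
  apply: TL_ext H => i o hi.
    rewrite Lr_upd_od D0; apply: Lr_ext; rewrite cmb_upd cmb_shift.
    by apply: cmb_ext => -[].
  by apply: Lr_ext; rewrite cmb_shift; apply: cmb_ext => -[].
- exists j, (false, false); split; first by rewrite leq_addr.
  have hj' : j < ng by lia.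
  apply: TL_leq (_ : ((c0 + (c0 + (c0.+1 + 1).+1)) + 1).+1 <= _) _; first by move=> /=; lia.
  have D0 : cmb j E (dg (false :: s)) j = (true, false) by rewrite /cmb ltnn subnn.
  apply: TL_whT; [exact: f1| |by apply: TL_whF] => /=.
  apply: TL_seq; first exact: (RD _ _ _ _ _ hj' opG).
  rewrite Lr_op D0; apply: TL_seq; first exact: (RD _ _ _ _ _ hj' odG).
  rewrite Lr_od D0; apply: TL_ifF => //; apply: TL_seq.
    apply: TL_ifT => //; exact: (WR _ _ _ _ _ hj' odG).
  apply: TL_ext (SF _ _ _ _ hj') => // i o hi.
  rewrite Lr_upd_od D0; apply: Lr_ext; rewrite cmb_upd.
  by apply: cmb_ext => -[].
Qed.

(** A digit 1 borrows only if a higher digit exists, hence the look at the next group; otherwise it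
    is the top digit and is erased. *)
Definition tdec_loop := TWhile (fun f => f.1)
  (TSeq (trd true (od r))
    (TIf (fun f => f.2) (TSeq (twrt (od r) false) (tsetf1 false))
      (TSeq goR (TSeq (trd true (op r)) (TSeq goL
        (TIf (fun f => f.2) (TSeq (twrt (od r) true) goR)
           (TSeq (twrt (op r) false) (tsetf1 false)))))))).

Lemma TL_dec_loop lay0 (s : seq bool) : forall j E (f : flags),
  s != [::] -> f.1 -> j + size s < ng ->
  exists j' f', j' <= j + size s /\
   TL tdec_loop f (Lr lay0 r (cmb j E (dg s))) j
      f' (Lr lay0 r (cmb j E (dg (bdec s)))) j' ((size s).+1 * (10 * c0)).
Proof.
have c0_1 : 0 < c0 by rewrite /c0; lia.
elim: s => [//|[] s IH] j E f _ f1 hj.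
- have hj' : j < ng by lia.
  exists j, (false, true); split; first by rewrite leq_addr.
  apply: TL_leq (_ : ((c0 + (c0 + 1).+1) + 1).+1 <= _) _; first by move=> /=; lia.
  have D0 : cmb j E (dg (true :: s)) j = (true, true) by rewrite /cmb ltnn subnn.
  apply: TL_whT; [exact: f1| |by apply: TL_whF] => /=.
  apply: TL_seq; first exact: (RD _ _ _ _ _ hj' odG).
  rewrite Lr_od D0; apply: TL_ifT => //; apply: TL_seq.
    exact: (WR _ _ _ _ _ hj' odG).
  apply: TL_ext (SF _ _ _ _ hj') => // i o hi.
  rewrite Lr_upd_od D0; apply: Lr_ext; rewrite cmb_upd.
  by apply: cmb_ext => -[].
have hj' : j < ng by lia.
have hj1 : j.+1 < ng by move: hj => /=; lia.
have D0 : cmb j E (dg (false :: s)) j = (true, false) by rewrite /cmb ltnn subnn.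
have D1 : (cmb j E (dg (false :: s)) j.+1).1 = (s != [::]).
  rewrite /cmb ltnNge leqW //= (_ : j.+1 - j = 1); last lia.
  by case: (s).
have f1f : f.1 = true := f1.
case: (s =P [::]) => [s0|/eqP sn].
- exists j, (false, false); split; first by rewrite leq_addr.
  apply: TL_leq (_ : ((c0 + (c0 + (c0 + (c0 + (c0 + 1).+1))).+1) + 1).+1 <= _) _;
    first by move=> /=; lia.
  apply: TL_whT; [exact: f1| |by apply: TL_whF] => /=.
  apply: TL_seq; first exact: (RD _ _ _ _ _ hj' odG).
  rewrite Lr_od D0; apply: TL_ifF => //; apply: TL_seq; first exact: (GR _ _ _ hj1).
  apply: TL_seq; first exact: (RD _ _ _ _ _ hj1 opG).
  rewrite Lr_op D1 s0; apply: TL_seq; first exact: (GL _ _ _ hj1).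
  apply: TL_ifF => //; apply: TL_seq.
    exact: (WR _ _ _ _ _ hj' opG).
  apply: TL_ext (SF _ _ _ _ hj') => // i o hi.
  rewrite -s0 Lr_upd_op D0 s0; apply: Lr_ext; rewrite cmb_upd.
  by apply: cmb_ext => -[|[]].
pose E' := cmb j E (fun=> (true, true)).
have [|j' [f' [h H]]] := IH j.+1 E' (true, true) sn isT; first by move: hj => /=; lia.
exists j', f'; split; first by move: h => /=; lia.
apply: TL_leq (_ : ((c0 + (c0 + (c0 + (c0 + (c0 + c0).+1))).+1) +
  (size s).+1 * (10 * c0)).+1 <= _) _; first by move=> /=; lia.
apply: TL_whT; first exact: f1.
  apply: TL_seq; first exact: (RD _ _ _ _ _ hj' odG).
  rewrite Lr_od D0; apply: TL_ifF => //; apply: TL_seq; first exact: (GR _ _ _ hj1).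
  apply: TL_seq; first exact: (RD _ _ _ _ _ hj1 opG).
  rewrite Lr_op D1 sn; apply: TL_seq; first exact: (GL _ _ _ hj1).
  apply: TL_ifT => //; apply: TL_seq; first exact: (WR _ _ _ _ _ hj' odG).
  exact: (GR _ _ _ hj1).
rewrite /setfl /= f1f; apply: TL_ext H => i o hi.
  by rewrite Lr_upd_od D0; apply: Lr_ext; rewrite cmb_upd cmb_shift; apply: cmb_ext => -[].
rewrite (_ : (if s is [::] then [::] else true :: bdec s) = true :: bdec s); last by case: (s) sn.
by apply: Lr_ext; rewrite cmb_shift; apply: cmb_ext => -[].
Qed.

Definition tinc := TSeq (tsetf1 true) (TSeq tinc_loop home).
(** The presence cell of the lowest digit guards the loop, so that zero stays zero. *)
Definition tdec := TSeq (trd false (op r)) (TSeq tdec_loop home).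

Lemma lay0E regs X Y i : lay regs X Y i 0 = (i == 0). Proof. by []. Qed.

Lemma lay_upd_same regs X Y :
  lay regs X Y =2 Lr (lay regs X Y) r (cmb 0 (fun=> (false, false)) (dg (rep (regs r)))).
Proof.
move=> i o; rewrite (lay_ext _ _ (fun j => esym (upd_id regs r j))) layE.
by rewrite /Lr /cmb ltn0 subn0.
Qed.

Lemma lay_upd_rep regs X Y v E :
  Lr (lay regs X Y) r (cmb 0 E (dg (rep v))) =2 lay (upd regs r v) X Y.
Proof. by move=> i o; rewrite layE /Lr /cmb /= subn0. Qed.

(** At most 10 cell accesses per group in a carry loop and 3 per group on the way home, with room
    for the first access. *)
Definition costR := (ng + 1) * (14 * c0).

Lemma TL_inc regs X Y f : (size (rep (regs r))).+1 < ng ->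
  exists f', TL tinc f (lay regs X Y) 0 f' (lay (upd regs r (regs r).+1) X Y) 0 costR.
Proof.
have c0_1 : 0 < c0 by rewrite /c0; lia.
move=> h; have hng : 0 < ng by lia.
have [|j' [f' [h' H]]] := TL_inc_loop (lay regs X Y) (s := rep (regs r)) (j := 0)
  (fun=> (false, false)) (f := (true, f.2)) isT; first lia.
exists (true, f'.2).
apply: (@TL_leq _ _ _ _ _ _ _ _ _ _ _ _ _ _ (1 + ((size (rep (regs r))).+1 * (8 * c0) + (j' + 1) * (3 * c0)))).
  rewrite /costR.
  have : (size (rep (regs r))).+1 * (8 * c0) <= ng * (8 * c0) by apply: leq_mul => //; lia.
  have : (j' + 1) * (3 * c0) <= ng * (3 * c0) by apply: leq_mul => //; lia.
  lia.
apply: TL_seq; first exact: (SF _ _ _ _ hng).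
apply: TL_seq; first by apply: TL_ext H => i o hi; rewrite -?lay_upd_same.
apply: TL_ext (HM _ _ _ (fun i _ => lay0E (upd regs r (regs r).+1) X Y i) _) => //; last lia.
by move=> i o hi; rewrite -[binc _]/(rep (regs r).+1) lay_upd_rep.
Qed.

Lemma TL_dec regs X Y f : (size (rep (regs r))).+1 < ng ->
  exists f', TL tdec f (lay regs X Y) 0 f' (lay (upd regs r (regs r).-1) X Y) 0 costR.
Proof.
have c0_1 : 0 < c0 by rewrite /c0; lia.
move=> h; have hng : 0 < ng by lia.
have rdE : lay regs X Y 0 (op r) = (regs r != 0).
  by rewrite lay_upd_same Lr_op /cmb /dg /= lt0n rep_eq0.
case: (posnP (regs r)) => [r0|rn].
  exists (true, f.2).
  apply: (@TL_leq _ _ _ _ _ _ _ _ _ _ _ _ _ _ (c0 + (1 + (0 + 1) * (3 * c0)))).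
    by rewrite /costR; lia.
  apply: TL_seq; first exact: (RD _ _ _ _ _ hng opG).
  rewrite rdE r0 /=; apply: TL_seq; first exact: TL_whF.
  apply: TL_ext (HM _ _ _ (fun i _ => lay0E regs X Y i) hng) => // i o hi.
  by rewrite (lay_ext _ _ (fun j => esym (upd_id regs r j))) r0.
have [v rv] : exists v, regs r = v.+1 by exists (regs r).-1; lia.
have [||j' [f' [h' H]]] := TL_dec_loop (lay regs X Y) (s := rep (regs r)) (j := 0)
  (fun=> (false, false)) (f := (true, f.2)) _ isT.
- by rewrite -size_eq0 rep_eq0; lia.
- lia.
exists (true, f'.2).
apply: (@TL_leq _ _ _ _ _ _ _ _ _ _ _ _ _ _ (c0 + ((size (rep (regs r))).+1 * (10 * c0) + (j' + 1) * (3 * c0)))).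
  rewrite /costR.
  have : (size (rep (regs r))).+1 * (10 * c0) <= ng * (10 * c0) by apply: leq_mul => //; lia.
  have : (j' + 1) * (3 * c0) <= ng * (3 * c0) by apply: leq_mul => //; lia.
  lia.
apply: TL_seq; first exact: (RD _ _ _ _ _ hng opG).
rewrite rdE -lt0n rn; apply: TL_seq; first by apply: TL_ext H => i o hi; rewrite -?lay_upd_same.
apply: TL_ext (HM _ _ _ (fun i _ => lay0E (upd regs r (regs r).-1) X Y i) _) => //; last lia.
by move=> i o hi; rewrite rv /= bincK lay_upd_rep.
Qed.

Lemma TL_tst regs X Y f : 0 < ng ->
  TL (trd true (op r)) f (lay regs X Y) 0 (f.1, regs r != 0) (lay regs X Y) 0 c0.
Proof.
move=> h; have := RD true (op r) f (lay regs X Y) 0 h opG.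
by rewrite lay_upd_same Lr_op /cmb /dg /= lt0n rep_eq0.
Qed.
End Regs.

(** * Counter programs *)

Record ram := Ram {
  regs : nat -> nat; rih : nat; rmem : nat -> bool; rmh : nat; rout : seq bool }.

(** [Scan] is primitive because all other loops are driven by registers, which are zero at the
    start: the length of the input must first get into a register. *)
Inductive ract :=
| Inc of nat | Dec of nat | InR | InL | Scan of nat
| MemR | MemL | MemW of bool | Out of bool | Nop.

Inductive rtest := BZ of nat | BNone | BOne | BMem.

Inductive rcmd :=
| RAct of ract
| RSeq of rcmd & rcmd
| RIf of rtest & rcmd & rcmd
| RLoop of nat & rcmd.

Section Semantics.
Variables (x : seq bool) (R B : nat).

Definition asem (a : ract) (s : ram) : ram :=
  let: Ram g i m h o := s in
  match a with
  | Inc r => Ram (upd g r (g r).+1) i m h o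
  | Dec r => Ram (upd g r (g r).-1) i m h o
  | InR => Ram g (minn i.+1 (size x)) m h o
  | InL => Ram g i.-1 m h o
  | Scan r => Ram (upd g r (g r + (size x - i))) (size x) m h o
  | MemR => Ram g i m h.+1 o
  | MemL => Ram g i m h.-1 o
  | MemW b => Ram g i (upd m h b) h o
  | Out b => Ram g i m h (rcons o b)
  | Nop => s
  end.

(** An overflow of [B] makes an evaluation underivable instead of wrong, so each derivation carries
    the space bound, and with it the time bound. *)
Definition apre (a : ract) (s : ram) : bool :=
  match a with
  | Inc r => (r < R) && (regs s r < B)
  | Dec r => r < R
  | Scan r => (r < R) && (regs s r + size x <= B)
  | MemR => rmh s < B
  | _ => true
  end.

Definition tsem (b : rtest) (s : ram) : bool :=
  match b with
  | BZ r => regs s r == 0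
  | BNone => read_in x (rih s) == None
  | BOne => read_in x (rih s) == Some true
  | BMem => rmem s (rmh s)
  end.

Definition tpre (b : rtest) : bool := if b is BZ r then r < R else true.

(** The body of a loop must return the counter as it found it, so the loop makes exactly as many
    rounds as the counter says and ends with the counter at zero. *)
Inductive ev : rcmd -> ram -> ram -> Prop :=
| EvAct a s : apre a s -> ev (RAct a) s (asem a s)
| EvSeq c1 c2 s s1 s2 : ev c1 s s1 -> ev c2 s1 s2 -> ev (RSeq c1 c2) s s2
| EvIf b c1 c2 s s' : tpre b -> ev (if tsem b s then c1 else c2) s s' ->
    ev (RIf b c1 c2) s s'
| EvLoop0 r c s : r < R -> regs s r = 0 -> ev (RLoop r c) s s
| EvLoopS r c v s s1 s2 : r < R -> regs s r = v.+1 -> ev c (asem (Dec r) s) s1 ->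
    regs s1 r = v -> ev (RLoop r c) s1 s2 -> ev (RLoop r c) s s2.

Definition good (s : ram) :=
  [/\ forall r, regs s r <= B, rmh s <= B & rih s <= size x].

Lemma good_act a s : apre a s -> good s -> good (asem a s).
Proof.
case: s => g i m h o /= pre [/= g1 g2 g3].
have gu r v : v <= B -> forall k, upd g r v k <= B by move=> hv k; rewrite /upd; case: ifP.
case: a pre => /=.
- by move=> r /andP[_ h1]; split=> //=; apply: gu.
- by move=> r _; split=> //=; apply: gu; apply: leq_trans (g1 r); apply: leq_pred.
- by move=> _; split=> //=; apply: geq_minr.
- by move=> _; split=> //=; lia.
- by move=> r /andP[_ h1]; split=> //=; apply: gu; lia.
- by move=> h1; split.
- by move=> _; split=> //=; lia.
- by move=> b _; split.
- by move=> b _; split.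
- by move=> _; split.
Qed.

Lemma good_ev c s s' : ev c s s' -> good s -> good s'.
Proof.
elim=> {c s s'} //.
- exact: good_act.
- by move=> c1 c2 s s1 s2 _ h1 _ h2 /h1.
- move=> r c v s s1 s2 rR _ _ h1 _ _ h2 g; apply: h2; apply: h1; exact: good_act.
Qed.

(** Time in units of [tau], the cost of one basic command. A loop is charged [B] rounds, since no
    register exceeds [B]. *)
Fixpoint tb (c : rcmd) : nat :=
  match c with
  | RAct (Scan _) => 2 + (size x) * 4
  | RAct _ => 1
  | RSeq a b => tb a + tb b
  | RIf _ a b => 2 + (tb a + tb b)
  | RLoop _ c => 2 + B * (tb c + 3)
  end.
End Semantics.

(** The simulated bit memory is a parameter: it lies on the catalytic tape for the average-error
    class and on tracks 1 and 2 of the work tape for polynomial time. *)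
Record backend := Backend { bR : tcmd; bL : tcmd; bW : bool -> tcmd; bT : tcmd }.

Definition tin (p : option bool -> bool) :=
  TAct (fun f i w k => noop (f.1, p i) w k).
Definition tinm m := TAct (fun f i w k => Trans f w k None m MStay MStay).
Definition tout' b := TAct (fun f i w k => Trans f w k (Some b) MStay MStay MStay).

Section Translation.
Variables (R : nat) (M : backend).
Let G := 2 * R + 3.

Definition tra (a : ract) : tcmd :=
  match a with
  | Inc r => tinc R r
  | Dec r => tdec R r
  | InR => tinm MRight
  | InL => tinm MLeft
  | Scan r => TSeq (tin isSome) (TWhile (fun f => f.2)
                (TSeq (tinm MRight) (TSeq (tinc R r) (tin isSome))))
  | MemR => bR M
  | MemL => bL M
  | MemW b => bW M b
  | Out b => tout' b
  | Nop => tnop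
  end.

Definition trt (b : rtest) : tcmd :=
  match b with
  | BZ r => trd true (op r)
  | BNone => tin (fun i => i == None)
  | BOne => tin (fun i => i == Some true)
  | BMem => bT M
  end.

(** [BZ] reads a presence cell, which is set for nonzero registers, so its flag has the opposite
    meaning. *)
Definition pol (b : rtest) (f : flags) : bool := if b is BZ _ then ~~ f.2 else f.2.

Fixpoint tr (c : rcmd) : tcmd :=
  match c with
  | RAct a => tra a
  | RSeq a b => TSeq (tr a) (tr b)
  | RIf b c1 c2 => TSeq (trt b) (TIf (pol b) (tr c1) (tr c2))
  | RLoop r c => TSeq (trt (BZ r)) (TWhile (fun f => f.2)
      (TSeq (tdec R r) (TSeq (tr c) (trt (BZ r)))))
  end.

Variables (x : seq bool) (B ng cM : nat).
Variable MR : (nat -> bool) -> nat -> (nat -> bool) -> (nat -> bool) -> seq bool -> nat -> Prop.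

Definition simr (s : ram) (t : tst) := exists X Y,
  [/\ tih t = rih s, tout t = rout s, twh t = 0,
      wenc G ng (lay (regs s) X Y) (tw t)
    & MR (rmem s) (rmh s) X Y (tc t) (tch t) /\ tch t <= (size (tc t)).-1].

Hypothesis ngB : forall v, v <= B -> (size (rep v)).+1 < ng.

Hypothesis bR_ok : forall s t, simr s t -> good x B s -> rmh s < B ->
  exists2 t', simr (asem x MemR s) t' & texle x (bR M) t t' cM.
Hypothesis bL_ok : forall s t, simr s t -> good x B s ->
  exists2 t', simr (asem x MemL s) t' & texle x (bL M) t t' cM.
Hypothesis bW_ok : forall b s t, simr s t -> good x B s ->
  exists2 t', simr (asem x (MemW b) s) t' & texle x (bW M b) t t' cM.
Hypothesis bT_ok : forall s t, simr s t -> good x B s ->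
  exists2 t', simr s t' /\ (tf t').2 = rmem s (rmh s) & texle x (bT M) t t' cM.

Let ng0 : 0 < ng. Proof. by have := ngB (leq0n B); lia. Qed.

Lemma rel_TL cm g' s t T (P : flags -> Prop) : simr s t -> good x B s ->
  (forall X Y f, exists2 f', TL x (rih s) (tc t) (tch t) (rout s) G ng cm f
      (lay (regs s) X Y) 0 f' (lay g' X Y) 0 T & P f') ->
  exists2 t', simr (Ram g' (rih s) (rmem s) (rmh s) (rout s)) t' /\ P (tf t') &
    texle x cm t t' T.
Proof.
case: t => f ih w wh c ch o [X [Y [/= e1 e2 e3 hw hm]]] gd H; subst ih o wh.
have [f' /(_ w hw) [w' [h1 h2 h3]] Pf] := H X Y f.
by exists (TSt f' (rih s) w' 0 c ch (rout s)) => //; split => //; exists X, Y; split.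
Qed.

Lemma rel_inc r s t : simr s t -> good x B s -> r < R ->
  exists2 t', simr (asem x (Inc r) s) t' & texle x (tinc R r) t t' (costR R ng).
Proof.
move=> H gd rR; have [g1 g2 g3] := gd; have [X [Y [_ _ _ _ [_ hch]]]] := H.
have [|t' [h _] h2] := rel_TL (g' := upd (regs s) r (regs s r).+1) (cm := tinc R r)
   (P := fun=> True) (T := costR R ng) H gd; last by exists t' => //; case: (s) h.
move=> X' Y' f; have [f' h] := TL_inc (rout s) g3 hch rR X' Y' f (ngB (g1 r)).
by exists f'.
Qed.

Lemma rel_dec r s t : simr s t -> good x B s -> r < R ->
  exists2 t', simr (asem x (Dec r) s) t' & texle x (tdec R r) t t' (costR R ng).
Proof.
move=> H gd rR; have [g1 g2 g3] := gd; have [X [Y [_ _ _ _ [_ hch]]]] := H.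
have [|t' [h _] h2] := rel_TL (g' := upd (regs s) r (regs s r).-1) (cm := tdec R r)
   (P := fun=> True) (T := costR R ng) H gd; last by exists t' => //; case: (s) h.
move=> X' Y' f; have [f' h] := TL_dec (rout s) g3 hch rR X' Y' f (ngB (g1 r)).
by exists f'.
Qed.

Lemma rel_bz r s t : simr s t -> good x B s -> r < R ->
  exists2 t', simr s t' /\ (tf t').2 = (regs s r != 0) & texle x (trt (BZ r)) t t' (c0 G).
Proof.
move=> H gd rR; have [g1 g2 g3] := gd; have [X [Y [_ _ _ _ [_ hch]]]] := H.
have [|t' [h e] h2] := rel_TL (g' := regs s) (cm := trt (BZ r))
   (P := fun f => f.2 = (regs s r != 0)) (T := c0 G) H gd;
   last by exists t' => //; split=> //; case: (s) h.
move=> X' Y' f; exists (f.1, regs s r != 0) => //.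
exact: (TL_tst (rout s) g3 hch rR).
Qed.

Lemma rel_act g s t s' : simr s t -> good x B s ->
  (let r := g (tf t) (read_in x (tih t)) (nth false (tw t) (twh t))
              (nth false (tc t) (tch t)) in
   [/\ wbit r = nth false (tw t) (twh t), cbit r = nth false (tc t) (tch t),
     mw r = MStay & mc r = MStay] /\
   s' = Ram (regs s) (minn (mv (mi r) (rih s)) (size x)) (rmem s) (rmh s)
     (if obit r is Some b then rcons (rout s) b else rout s)) ->
  exists2 t', simr s' t' /\ tf t' = nq (g (tf t) (read_in x (tih t))
      (nth false (tw t) (twh t)) (nth false (tc t) (tch t))) &
    texle x (TAct g) t t' 1.
Proof.
move=> H gd; case: (H) => X [Y [e1 e2 e3 hw [hm hch]]].
set r := g _ _ _ _ => /= -[[w1 w2 w3 w4] ->]; exists (tstep x g t); last first.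
  by exists 1 => //; apply: TeAct.
split=> //; exists X, Y; rewrite /tstep -/r /tapp /= w1 w2 w3 w4 e1 e2 e3 /= ?min0n; split=> //.
  by rewrite wr_nth.
by rewrite wr_nth (minn_idPl hch).
Qed.

Definition tau := costR R ng + cM + c0 G + 5.

Lemma rel_loop_in r s t : simr s t -> good x B s -> r < R -> regs s r + size x <= B ->
  exists2 t', simr (asem x (Scan r) s) t' & texle x (tra (Scan r)) t t' ((2 + size x * 4) * tau).
Proof.
move=> H gd rR le.
have rd s1 t1 : simr s1 t1 -> good x B s1 -> exists2 t', simr s1 t' /\
    (tf t').2 = (rih s1 < size x) & texle x (tin isSome) t1 t' 1.
  move=> H1 gd1; have [|t' [h e] h2] := rel_act (g := fun f i w k => noop (f.1, isSome i) w k)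
     (s' := s1) H1 gd1.
    by split=> //=; have [_ _ h] := gd1; rewrite (minn_idPl h); case: (s1).
  exists t' => //; split=> //; rewrite e /=.
  have [X [Y [-> _ _ _ _]]] := H1.
  by rewrite /read_in; case: ifP.
suff loop k : forall s1 t1, simr s1 t1 -> good x B s1 -> rih s1 + k = size x ->
    regs s1 r + k <= B -> (tf t1).2 = (rih s1 < size x) ->
    exists2 t', simr (asem x (Scan r) s1) t' & texle x (TWhile (fun f => f.2)
                (TSeq (tinm MRight) (TSeq (tinc R r) (tin isSome)))) t1 t' (1 + k * 3 * tau).
  have [t1 [h1 e1] x1] := rd _ _ H gd; have [g1 g2 g3] := gd.
  have [||t2 h2 x2] := loop (size x - rih s) _ _ h1 gd _ _ e1; [by clear -g3; lia|by clear -le; lia|].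
  exists t2 => //; apply: texle_leq (texle_seq x1 x2).
  have : (size x - rih s) * 3 * tau <= size x * 3 * tau by rewrite leq_mul2r leq_mul2r; lia.
  rewrite /tau; lia.
elim: k => [|k IH] s1 t1 h1 gd1 ek lek f1.
  exists t1; last by apply: texle_whF; rewrite f1; lia.
  case: s1 h1 {gd1 lek f1} ek => g i m h o H1 /=; rewrite addn0 => ei.
  move: H1; rewrite ei subnn addn0 => -[X [Y [a1 a2 a3 [a4 a5] a6]]]; exists X, Y; split=> //.
  by split=> // j p hj hp; rewrite (lay_ext _ _ (upd_id g r)) a5.
have [|t2 [h2 _] x2] := rel_act (g := fun f i w k => Trans f w k None MRight MStay MStay)
     (s' := asem x InR s1) h1 gd1; first by case: (s1).
have gd2 : good x B (asem x InR s1) by apply: (@good_act x R B InR).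
have [t3 h3 x3] := rel_inc h2 gd2 rR.
have gd3 : good x B (asem x (Inc r) (asem x InR s1)).
  apply: (@good_act _ R) => //=; rewrite rR /=; move: lek; case: (s1) => /=; lia.
have [t4 [h4 e4] x4] := rd _ _ h3 gd3.
have [||t5 h5 x5] := IH _ _ h4 gd3 _ _ e4.
- by move: ek; case: (s1) => /= g i m h o; lia.
- by move: lek; case: (s1) => /= g i m h o; rewrite /upd eqxx; lia.
exists t5.
  move: h5 ek; case: (s1) => g i m h o /= H5 ek.
  move: H5; rewrite /= => -[X [Y [/= a1 a2 a3 [a4 a5] a6]]]; exists X, Y; split=> //.
  split=> // j p hj hp; rewrite a5 //; apply: lay_ext => q; rewrite /upd eqxx.
  by rewrite /= /upd; case: eqP => //= _; lia.
apply: texle_leq (_ : (1 + (costR R ng + 1) + (1 + k * 3 * tau)).+1 <= _) _.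
  rewrite /tau; lia.
apply: texle_whT x5; first by rewrite f1; lia.
by apply: texle_seq x2 _; apply: texle_seq x3 x4.
Qed.

Lemma tra_ok a s t : simr s t -> good x B s -> apre x R B a s ->
  exists2 t', simr (asem x a s) t' & texle x (tra a) t t' (tb x B (RAct a) * tau).
Proof.
have le1 T u u' cm : T <= tau -> texle x cm u u' T -> texle x cm u u' (1 * tau).
  by move=> h; apply: texle_leq; rewrite mul1n.
move=> H gd; have [g1 g2 g3] := gd; case: a => [r|r|||r|||b|b|] /= pre.
- have /andP[rR _] := pre; have [t' h1 h2] := rel_inc H gd rR.
  by exists t' => //; apply: le1 h2; rewrite /tau; lia.
- have [t' h1 h2] := rel_dec H gd pre.
  by exists t' => //; apply: le1 h2; rewrite /tau; lia.
- have [|t' [h1 _] h2] := rel_act (g := fun f i w k => Trans f w k None MRight MStay MStay)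
     (s' := asem x InR s) H gd; first by case: (s).
  by exists t' => //; apply: le1 h2; rewrite /tau; lia.
- have [|t' [h1 _] h2] := rel_act (g := fun f i w k => Trans f w k None MLeft MStay MStay)
     (s' := asem x InL s) H gd.
    by split=> //; move: g3; case: (s) => g i m h o /= g3; congr Ram; lia.
  by exists t' => //; apply: le1 h2; rewrite /tau; lia.
- by have /andP[rR le] := pre; apply: rel_loop_in.
- have [t' h1 h2] := bR_ok H gd pre.
  by exists t' => //; apply: le1 h2; rewrite /tau; lia.
- have [t' h1 h2] := bL_ok H gd.
  by exists t' => //; apply: le1 h2; rewrite /tau; lia.
- have [t' h1 h2] := bW_ok b H gd.
  by exists t' => //; apply: le1 h2; rewrite /tau; lia.
- have [|t' [h1 _] h2] := rel_act (g := fun f i w k => Trans f w k (Some b) MStay MStay MStay)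
     (s' := asem x (Out b) s) H gd.
    by split=> //; move: g3; case: (s) => g i m h o /= g3; congr Ram; lia.
  by exists t' => //; apply: le1 h2; rewrite /tau; lia.
- have [|t' [h1 _] h2] := rel_act (g := fun f i w k => noop f w k)
     (s' := asem x Nop s) H gd.
    by split=> //; move: g3; case: (s) => g i m h o /= g3; congr Ram; lia.
  by exists t' => //; apply: le1 h2; rewrite /tau; lia.
Qed.

Lemma trt_ok b s t : simr s t -> good x B s -> tpre R b ->
  exists2 t', simr s t' /\ pol b (tf t') = tsem x b s & texle x (trt b) t t' tau.
Proof.
have le1 T u u' cm : T <= tau -> texle x cm u u' T -> texle x cm u u' tau by apply: texle_leq.
have rd p s1 t1 : simr s1 t1 -> good x B s1 -> exists2 t', simr s1 t' /\
    (tf t').2 = p (read_in x (rih s1)) & texle x (tin p) t1 t' 1.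
  move=> H1 gd1; have [|t' [h e] h2] := rel_act (g := fun f i w k => noop (f.1, p i) w k)
     (s' := s1) H1 gd1.
    by split=> //=; have [_ _ h] := gd1; rewrite (minn_idPl h); case: (s1).
  exists t' => //; split=> //; rewrite e /=.
  by have [X [Y [-> _ _ _ _]]] := H1.
move=> H gd; case: b => [r|||] /= pre.
- have [t' [h1 e] h2] := rel_bz H gd pre; exists t'; first by rewrite e negbK.
  by apply: le1 h2; rewrite /tau; lia.
- have [t' [h1 e] h2] := rd (fun i => i == None) _ _ H gd; exists t' => //.
  by apply: le1 h2; rewrite /tau; lia.
- have [t' [h1 e] h2] := rd (fun i => i == Some true) _ _ H gd; exists t' => //.
  by apply: le1 h2; rewrite /tau; lia.
- have [t' [h1 e] h2] := bT_ok H gd; exists t' => //.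
  by apply: le1 h2; rewrite /tau; lia.
Qed.

Lemma ev_loop_inv r c s s' : ev x R B (RLoop r c) s s' ->
  (regs s r = 0 /\ s' = s) \/ exists v s1, [/\ regs s r = v.+1,
    ev x R B c (asem x (Dec r) s) s1, regs s1 r = v & ev x R B (RLoop r c) s1 s'].
Proof.
move=> H; inversion H as [| | |r1 d1 u1 rR e|r1 d1 v u1 s1 u2 rR e E1 e1 E2]; subst; first by left.
by right; exists (regs s1 r), s1; split.
Qed.

Lemma tr_ok c : forall s s' t, ev x R B c s s' -> good x B s -> simr s t ->
  exists2 t', simr s' t' & texle x (tr c) t t' (tb x B c * tau).
Proof.
elim: c => [a|c1 h1 c2 h2|b c1 h1 c2 h2|r c IH] s s' t E.
- by inversion E; subst => gd H; apply: tra_ok.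
- inversion E as [|d1 d2 u s1 u' e1 e2| | |]; subst=> gd H.
  have [t1 H1 x1] := h1 _ _ t e1 gd H; have [t2 H2 x2] := h2 _ _ t1 e2 (good_ev e1 gd) H1.
  by exists t2 => //=; rewrite mulnDl; apply: texle_seq x1 x2.
- inversion E as [| |d d1 d2 u u' pre e1| |]; subst=> gd H.
  have [t1 [H1 eb] x1] := trt_ok H gd pre.
  case hb: (tsem x b s) e1 => e1.
    have [t2 H2 x2] := h1 _ _ t1 e1 gd H1; exists t2 => //=.
    apply: texle_leq (texle_seq x1 (texle_ifT _ _ x2)); last by rewrite eb hb.
    by rewrite /tau; lia.
  have [t2 H2 x2] := h2 _ _ t1 e1 gd H1; exists t2 => //=.
  apply: texle_leq (texle_seq x1 (texle_ifF _ _ x2)); last by rewrite eb hb.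
  by rewrite /tau; lia.
move=> gd H; have rR : r < R by inversion E.
suff loop v : forall s t, regs s r = v -> ev x R B (RLoop r c) s s' -> good x B s ->
    simr s t -> (tf t).2 = (v != 0) -> exists2 t', simr s' t' &
    texle x (TWhile (fun f => f.2) (TSeq (tdec R r) (TSeq (tr c) (trt (BZ r))))) t t'
     (1 + v * ((tb x B c + 3) * tau)).
  have [t1 [H1 e1] x1] := rel_bz H gd rR.
  have [t2 H2 x2] := loop _ _ _ erefl E gd H1 e1.
  exists t2 => //; apply: texle_leq (texle_seq x1 x2) => /=.
  have [g1 _ _] := gd; have : regs s r * ((tb x B c + 3) * tau) <= B * ((tb x B c + 3) * tau).
    by rewrite leq_mul2r g1 orbT.
  have : c0 G + 5 <= tau by rewrite /tau; lia.
  set Q := regs s r * _; set Q' := B * _; rewrite mulnDl; lia.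
elim: v => [|v IHv] {E gd H t} u t ru E gd H ft.
  exists t; last by apply: texle_whF; rewrite ft.
  by have [[_ ->]//|[v [s1 [e]]]] := ev_loop_inv E; rewrite ru in e.
have [[e]|[v' [s1 [e E1 r1 E2]]]] := ev_loop_inv E; first by rewrite ru in e.
have ev' : v' = v by move: e; rewrite ru => -[].
rewrite ev' in r1; have [t1 H1 x1] := rel_dec H gd rR.
have gd1 : good x B (asem x (Dec r) u) by apply: (@good_act _ R).
have [t2 H2 x2] := IH _ _ _ E1 gd1 H1.
have gd2 := good_ev E1 gd1.
have [t3 [H3 e3] x3] := rel_bz H2 gd2 rR.
have [t4 H4 x4] := IHv _ _ r1 E2 gd2 H3 (etrans e3 (congr1 (fun v => v != 0) r1)).
exists t4 => //; apply: texle_leq (_ : (costR R ng + (tb x B c * tau + c0 G) +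
   (1 + v * ((tb x B c + 3) * tau))).+1 <= _) _.
  have : costR R ng + c0 G + 5 <= tau by rewrite /tau; lia.
  rewrite mulSn; set Q := v * _; rewrite mulnDl; lia.
apply: texle_whT x4; first by rewrite ft.
by apply: texle_seq x1 _; apply: texle_seq x2 x3.
Qed.
End Translation.

(** * Bit memory on the catalytic tape or on the work tape *)

Section Catalytic.
Variables (R : nat) (x : seq bool) (B ng N : nat).

(** The agreement extends beyond the end of the tape, where the memory must read false; it survives
    writes because the head stays below the length of the tape. *)
Definition MRc (m : nat -> bool) (h : nat) (X Y : nat -> bool) (c : seq bool) (ch : nat) :=
  [/\ size c = N, ch = h & forall p, nth false c p = m p].

Definition bcat : backend := Backend
  (TAct (fun f i w k => Trans f w k None MStay MStay MRight))
  (TAct (fun f i w k => Trans f w k None MStay MStay MLeft))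
  (fun b => TAct (fun f i w k => Trans f w b None MStay MStay MStay))
  (TAct (fun f i w k => noop (f.1, k) w k)).

Hypothesis BN : B < N.

Lemma bcat_R s t : simr R ng MRc s t -> good x B s -> rmh s < B ->
  exists2 t', simr R ng MRc (asem x MemR s) t' & texle x (bR bcat) t t' 1.
Proof.
case: s t => g i m h o [f ih w wh c ch o'] [X [Y [/= e1 e2 e3 hw [[e4 e5 e6] e7]]]].
move=> [/= g1 g2 g3] hB; eexists; last by exists 1; [|apply: TeAct].
exists X, Y; subst; rewrite /tstep /tapp /= !wr_nth; split=> //; first exact/minn_idPl.
  by rewrite min0n.
split; last exact: geq_minr.
by split=> //; apply/minn_idPl; lia.
Qed.

Lemma bcat_L s t : simr R ng MRc s t -> good x B s ->
  exists2 t', simr R ng MRc (asem x MemL s) t' & texle x (bL bcat) t t' 1.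
Proof.
case: s t => g i m h o [f ih w wh c ch o'] [X [Y [/= e1 e2 e3 hw [[e4 e5 e6] e7]]]].
move=> [/= g1 g2 g3]; eexists; last by exists 1; [|apply: TeAct].
exists X, Y; subst; rewrite /tstep /tapp /= !wr_nth; split=> //; first exact/minn_idPl.
  by rewrite min0n.
split; last exact: geq_minr.
by split=> //; apply/minn_idPl; lia.
Qed.

Lemma bcat_W b s t : simr R ng MRc s t -> good x B s ->
  exists2 t', simr R ng MRc (asem x (MemW b) s) t' & texle x (bW bcat b) t t' 1.
Proof.
case: s t => g i m h o [f ih w wh c ch o'] [X [Y [/= e1 e2 e3 hw [[e4 e5 e6] e7]]]].
move=> [/= g1 g2 g3]; eexists; last by exists 1; [|apply: TeAct].
exists X, Y; subst; rewrite /tstep /tapp /= !wr_nth; split=> //; first exact/minn_idPl.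
  by rewrite min0n.
split; last by rewrite size_wr geq_minr.
split; rewrite ?size_wr //; first exact/minn_idPl.
by move=> p; rewrite nth_wr ?e6 //; lia.
Qed.

Lemma bcat_T s t : simr R ng MRc s t -> good x B s ->
  exists2 t', simr R ng MRc s t' /\ (tf t').2 = rmem s (rmh s) & texle x (bT bcat) t t' 1.
Proof.
case: s t => g i m h o [f ih w wh c ch o'] [X [Y [/= e1 e2 e3 hw [[e4 e5 e6] e7]]]].
move=> [/= g1 g2 g3]; eexists; last by exists 1; [|apply: TeAct].
split; last by rewrite /tstep /tapp /= e5 e6.
exists X, Y; subst; rewrite /tstep /tapp /= !wr_nth; split=> //; first exact/minn_idPl.
  by rewrite min0n.
split; last exact: geq_minr.
by split=> //; apply/minn_idPl.
Qed.
End Catalytic.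

Section WorkMemory.
Variables (R : nat) (x : seq bool) (B ng : nat).
Let G := 2 * R + 3.
Let G0 : 0 < G. Proof. by rewrite /G addn3. Qed.
Let G1 : 1 < G. Proof. by rewrite /G addn3. Qed.
Let G2 : 2 < G. Proof. by rewrite /G addn3. Qed.

Definition MRw (m : nat -> bool) (h : nat) (X Y : nat -> bool) (c : seq bool) (ch : nat) :=
  [/\ c = [::], ch = 0, X =1 (fun j => j == h) & Y =1 m].

Definition tfind := TSeq (trd false 1)
  (TWhile (fun f => ~~ f.1) (TSeq (goR G) (trd false 1))).

(** Each operation searches the mark of the simulated head from group 0. A move to the left first
    reads track 0, since a head on the first cell has to stay there. *)
Definition bwork : backend := Backend
  (TSeq tfind (TSeq (twrt 1 false) (TSeq (goR G) (TSeq (twrt 1 true) (home G)))))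
  (TSeq tfind (TSeq (trd true 0) (TSeq
     (TIf (fun f => f.2) tnop (TSeq (twrt 1 false) (TSeq (goL G) (twrt 1 true)))) (home G))))
  (fun b => TSeq tfind (TSeq (twrt 2 b) (home G)))
  (TSeq tfind (TSeq (trd true 2) (home G))).

Hypothesis Bng : B.+1 < ng.

Section TL.
Variables (ih : nat) (out : seq bool).
Hypothesis Hih : ih <= size x.
Local Notation TL := (TL x ih [::] 0 out G ng).
Local Notation c0 := (c0 G).
Let Hch : 0 <= (size ([::] : seq bool)).-1. Proof. by []. Qed.
Let RD := @TL_rd x ih [::] 0 out Hih Hch G ng G0.
Let WR := @TL_wrt x ih [::] 0 out Hih Hch G ng G0.
Let GR := @TL_goR x ih [::] 0 out Hih Hch G ng G0.
Let GL := @TL_goL x ih [::] 0 out Hih Hch G ng G0.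
Let NP := @TL_nop x ih [::] 0 out Hih Hch G ng G0.
Let HM := @TL_home x ih [::] 0 out Hih Hch G ng G0.
Arguments RD : clear implicits.
Arguments WR : clear implicits.
Arguments GR : clear implicits.
Arguments GL : clear implicits.
Arguments NP : clear implicits.
Arguments HM : clear implicits.

Lemma TL_find f g X Y h : X =1 (fun j => j == h) -> h < ng ->
  TL tfind f (lay g X Y) 0 (true, f.2) (lay g X Y) h ((h + 1) * (3 * c0)).
Proof.
have c0_1 : 0 < c0 by rewrite /c0; lia.
move=> hX hh; have ng0 : 0 < ng by lia.
apply: (@TL_leq _ _ _ _ _ _ _ _ _ _ _ _ _ _ (c0 + (1 + h * (3 * c0)))); first lia.
apply: TL_seq; first exact: (RD _ _ _ _ _ ng0 G1).
rewrite [lay _ _ _ 0 1]hX /setfl.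
suff H k : forall j, j + k = h -> TL (TWhile (fun f => ~~ f.1) (TSeq (goR G) (trd false 1)))
    (j == h, f.2) (lay g X Y) j (true, f.2) (lay g X Y) h (1 + k * (3 * c0)).
  exact: (H h 0).
elim: k => [|k IH] j e.
  have -> : j = h by lia.
  by rewrite eqxx; apply: TL_whF.
apply: TL_leq (_ : (c0 + c0 + (1 + k * (3 * c0))).+1 <= _) _; first by rewrite mulSn; lia.
have hj : j.+1 < ng by lia.
apply: TL_whT (IH j.+1 _); [by rewrite /=; lia| |lia].
apply: TL_seq; first exact: (GR _ _ _ hj).
by have := RD false 1 (j == h, f.2) (lay g X Y) _ hj G1; rewrite [lay _ _ _ _ 1]hX.
Qed.

Lemma upd2_X g X Y j v : upd2 (lay g X Y) j 1 v =2 lay g (upd X j v) Y.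
Proof. by move=> i [|[|[|o]]]; rewrite /upd2 /upd /= ?andbF ?andbT. Qed.

Lemma upd2_Y g X Y j v : upd2 (lay g X Y) j 2 v =2 lay g X (upd Y j v).
Proof. by move=> i [|[|[|o]]]; rewrite /upd2 /upd /= ?andbF ?andbT. Qed.

Definition cW := (ng + 1) * (10 * c0).

Let cWle h T : h < ng -> T <= (h + 1) * (3 * c0) + (4 * c0 + (h.+1 + 1) * (3 * c0)) -> T <= cW.
Proof.
have c0_1 : 0 < c0 by rewrite /c0; lia.
move=> hh; rewrite /cW => h1.
have : h.+1 * (10 * c0) <= ng * (10 * c0) by rewrite leq_mul2r hh orbT.
lia.
Qed.

Lemma TL_bR f g X Y h : X =1 (fun j => j == h) -> h.+1 < ng ->
  TL (bR bwork) f (lay g X Y) 0 (true, f.2) (lay g (fun j => j == h.+1) Y) 0 cW.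
Proof.
move=> hX hh; have h1 : h < ng by lia.
apply: TL_leq (cWle h1 (leqnn _)) _.
apply: TL_seq; first exact: TL_find.
apply: TL_leq (_ : c0 + (c0 + (c0 + (h.+1 + 1) * (3 * c0))) <= _) _; first lia.
apply: TL_seq; first exact: (WR _ _ _ _ _ h1 G1).
apply: TL_seq; first exact: (GR _ _ _ hh).
apply: TL_seq; first exact: (WR _ _ _ _ _ hh G1).
apply: TL_ext (HM (true, f.2) (lay g (fun j => j == h.+1) Y) h.+1 _ hh) => // i o hi.
rewrite {1}/upd2 upd2_X; case: o => [|[|o]] /=; rewrite ?andbF ?andbT //.
by rewrite /upd hX; case: eqP => // n; case: eqP.
Qed.

Lemma TL_bL f g X Y h : X =1 (fun j => j == h) -> h < ng ->
  exists f', TL (bL bwork) f (lay g X Y) 0 f' (lay g (fun j => j == h.-1) Y) 0 cW.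
Proof.
move=> hX hh; have := cWle hh (leqnn _).
case: h hX hh => [|h] hX hh le.
  exists (true, true); apply: TL_leq le _.
  apply: TL_seq; first exact: TL_find.
  apply: TL_leq (_ : c0 + (1.+1 + (0 + 1) * (3 * c0)) <= _) _; first by rewrite /c0; lia.
  apply: TL_seq; first exact: (RD _ _ _ _ _ hh G0).
  apply: TL_seq; first by apply: TL_ifT => //; exact: (NP _ _ _ hh).
  apply: TL_ext (HM _ (lay g (fun j => j == 0) Y) 0 _ hh) => // i o hi.
  by case: o => [|[|o]] //=; rewrite hX.
have h1 : h < ng by lia.
exists (true, false); apply: TL_leq le _.
apply: TL_seq; first exact: TL_find.
apply: TL_leq (_ : c0 + ((c0 + (c0 + c0)).+1 + (h + 1) * (3 * c0)) <= _) _;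
  first by rewrite /c0; lia.
apply: TL_seq; first exact: (RD _ _ _ _ _ hh G0).
apply: TL_seq.
  apply: TL_ifF => //.
  apply: TL_seq; first exact: (WR _ _ _ _ _ hh G1).
  apply: TL_seq; first exact: (GL _ _ _ hh).
  exact: (WR _ _ _ _ _ h1 G1).
apply: TL_ext (HM _ (lay g (fun j => j == h) Y) h _ h1) => // i o hi.
rewrite {1}/upd2 upd2_X; case: o => [|[|o]] /=; rewrite ?andbF ?andbT //.
by rewrite /upd hX; case: eqP => // n; case: eqP.
Qed.

Lemma TL_bW b f g X Y h : X =1 (fun j => j == h) -> h < ng ->
  TL (bW bwork b) f (lay g X Y) 0 (true, f.2) (lay g X (upd Y h b)) 0 cW.
Proof.
move=> hX hh; apply: TL_leq (cWle hh (leqnn _)) _.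
apply: TL_seq; first exact: TL_find.
apply: TL_leq (_ : c0 + (h + 1) * (3 * c0) <= _) _; first lia.
apply: TL_seq; first exact: (WR _ _ _ _ _ hh G2).
apply: TL_ext (HM _ (lay g X (upd Y h b)) h _ hh) => // i o hi.
by rewrite upd2_Y.
Qed.

Lemma TL_bT f g X Y h : X =1 (fun j => j == h) -> h < ng ->
  TL (bT bwork) f (lay g X Y) 0 (true, Y h) (lay g X Y) 0 cW.
Proof.
move=> hX hh; apply: TL_leq (cWle hh (leqnn _)) _.
apply: TL_seq; first exact: TL_find.
apply: TL_leq (_ : c0 + (h + 1) * (3 * c0) <= _) _; first lia.
apply: TL_seq; first exact: (RD _ _ _ _ _ hh G2).
exact: (HM (true, Y h) (lay g X Y) h (fun i _ => erefl) hh).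
Qed.
End TL.

Lemma bwork_TL cm s t (m' : nat -> bool) h' (P : flags -> Prop) : simr R ng MRw s t -> good x B s ->
  (forall X Y f, X =1 (fun j => j == rmh s) -> Y =1 rmem s -> exists f' X' Y',
     [/\ TL x (rih s) [::] 0 (rout s) G ng cm f (lay (regs s) X Y) 0 f' (lay (regs s) X' Y') 0 cW,
      X' =1 (fun j => j == h'), Y' =1 m' & P f']) ->
  exists2 t', simr R ng MRw (Ram (regs s) (rih s) m' h' (rout s)) t' /\ P (tf t') &
    texle x cm t t' cW.
Proof.
case: t => f ih w wh c ch o [X [Y [/= e1 e2 e3 hw [[e4 e5 e6 e7] _]]]] gd H; subst.
have [f' [X' [Y' [/(_ w hw) [w' [h1 h2 h3]] h4 h5 h6]]]] := H X Y f e6 e7.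
by exists (TSt f' (rih s) w' 0 [::] 0 (rout s)) => //; split=> //; exists X', Y'; split.
Qed.

Lemma bwork_R s t : simr R ng MRw s t -> good x B s -> rmh s < B ->
  exists2 t', simr R ng MRw (asem x MemR s) t' & texle x (bR bwork) t t' cW.
Proof.
move=> H gd hB; have [g1 g2 g3] := gd.
have [|t' [h1 _] h2] := bwork_TL (cm := bR bwork) (m' := rmem s) (h' := (rmh s).+1)
  (P := fun=> True) H gd; last by exists t' => //; case: (s) h1.
move=> X Y f hX hY; exists (true, f.2), (fun j => j == (rmh s).+1), Y; split=> //.
by apply: TL_bR => //; lia.
Qed.

Lemma bwork_L s t : simr R ng MRw s t -> good x B s ->
  exists2 t', simr R ng MRw (asem x MemL s) t' & texle x (bL bwork) t t' cW.
Proof.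
move=> H gd; have [g1 g2 g3] := gd.
have [|t' [h1 _] h2] := bwork_TL (cm := bL bwork) (m' := rmem s) (h' := (rmh s).-1)
  (P := fun=> True) H gd; last by exists t' => //; case: (s) h1.
move=> X Y f hX hY; have [|f' h] := TL_bL (rout s) g3 f (regs s) Y hX; first lia.
by exists f', (fun j => j == (rmh s).-1), Y; split.
Qed.

Lemma bwork_W b s t : simr R ng MRw s t -> good x B s ->
  exists2 t', simr R ng MRw (asem x (MemW b) s) t' & texle x (bW bwork b) t t' cW.
Proof.
move=> H gd; have [g1 g2 g3] := gd.
have [|t' [h1 _] h2] := bwork_TL (cm := bW bwork b) (m' := upd (rmem s) (rmh s) b) (h' := rmh s)
  (P := fun=> True) H gd; last by exists t' => //; case: (s) h1.
move=> X Y f hX hY; exists (true, f.2), X, (upd Y (rmh s) b); split=> //.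
  by apply: TL_bW => //; lia.
by move=> j; rewrite /upd hY.
Qed.

Lemma bwork_T s t : simr R ng MRw s t -> good x B s ->
  exists2 t', simr R ng MRw s t' /\ (tf t').2 = rmem s (rmh s) & texle x (bT bwork) t t' cW.
Proof.
move=> H gd; have [g1 g2 g3] := gd.
have [|t' [h1 h3] h2] := bwork_TL (cm := bT bwork) (m' := rmem s) (h' := rmh s)
  (P := fun f => f.2 = rmem s (rmh s)) H gd; last by exists t' => //; split=> //; case: (s) h1.
move=> X Y f hX hY; exists (true, Y (rmh s)), X, Y; split=> //; last by rewrite /= hY.
by apply: TL_bT => //; lia.
Qed.
End WorkMemory.

(** * Arithmetic expressions and loops *)

Inductive expr :=
| EVar of nat | ECst of nat
| EAdd of expr & expr | ESub of expr & expr | EMul of expr & expr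
| EDiv of expr & expr | EMod of expr & expr
| ETab of seq nat & expr | EIn of expr | EMem of expr.

(** The value 2 stands for the end marker, and for every position beyond it. *)
Definition sym (x : seq bool) (i : nat) : nat :=
  if read_in x i is Some b then b else 2.

Fixpoint eval x (g : nat -> nat) (m : nat -> bool) (e : expr) : nat :=
  match e with
  | EVar v => g v
  | ECst c => c
  | EAdd a b => eval x g m a + eval x g m b
  | ESub a b => eval x g m a - eval x g m b
  | EMul a b => eval x g m a * eval x g m b
  | EDiv a b => eval x g m a %/ eval x g m b
  | EMod a b => eval x g m a %% eval x g m b
  | ETab s a => nth 0 s (eval x g m a)
  | EIn a => sym x (eval x g m a)
  | EMem a => m (eval x g m a)
  end.

Fixpoint evars V (e : expr) : bool :=
  match e with
  | EVar v => v < V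
  | ECst _ => true
  | EAdd a b | ESub a b | EMul a b | EDiv a b | EMod a b => evars V a && evars V b
  | ETab _ a | EIn a | EMem a => evars V a
  end.

(** The operands are counted even where the value is smaller than they are, as in a difference or a
    quotient, because they occupy registers on the way. *)
Fixpoint eb (e : expr) (A : nat) : nat :=
  match e with
  | EVar _ => A
  | ECst c => c
  | EAdd a b | ESub a b | EDiv a b | EMod a b => eb a A + eb b A
  | EMul a b => eb a A * eb b A + (eb a A + eb b A)
  | ETab s a => sumn s + eb a A
  | EIn a => 2 + eb a A
  | EMem a => 1 + eb a A
  end.

Fixpoint need (e : expr) : nat :=
  match e with
  | EVar _ | ECst _ => 2
  | EAdd a b | ESub a b | EMul a b | EDiv a b | EMod a b => need a + need b + 4
  | ETab _ a | EIn a | EMem a => need a + 2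
  end.

Lemma nth_sumn s i : nth 0 s i <= sumn s.
Proof. by elim: s i => [|v s IH] [|i] //=; [lia|have := IH i; lia]. Qed.

Lemma eval_le x g m e A V : evars V e -> (forall r, r < V -> g r <= A) ->
  eval x g m e <= eb e A.
Proof.
move=> + H; elim: e => //=.
- by move=> a Ha b Hb /andP[/Ha {}Ha /Hb {}Hb]; lia.
- by move=> a Ha b Hb /andP[/Ha {}Ha /Hb {}Hb]; lia.
- move=> a Ha b Hb /andP[/Ha {}Ha /Hb {}Hb].
  by have := leq_mul Ha Hb; lia.
- move=> a Ha b Hb /andP[/Ha {}Ha /Hb {}Hb].
  by have := leq_div (eval x g m a) (eval x g m b); lia.
- move=> a Ha b Hb /andP[/Ha {}Ha /Hb {}Hb].
  by have := leq_mod (eval x g m a) (eval x g m b); lia.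
- by move=> s a _ _; have := nth_sumn s (eval x g m a); lia.
- by move=> a _ _; rewrite /sym; case: read_in => // -[] /=; lia.
- by move=> a _ _; case: (m _); lia.
Qed.

Lemma eval_ext x g g' m e V : evars V e -> (forall r, r < V -> g r = g' r) ->
  eval x g m e = eval x g' m e.
Proof.
move=> + H; elim: e => //=.
- by move=> a Ha b Hb /andP[/Ha -> /Hb ->].
- by move=> a Ha b Hb /andP[/Ha -> /Hb ->].
- by move=> a Ha b Hb /andP[/Ha -> /Hb ->].
- by move=> a Ha b Hb /andP[/Ha -> /Hb ->].
- by move=> a Ha b Hb /andP[/Ha -> /Hb ->].
- by move=> s a Ha /Ha ->.
- by move=> a Ha /Ha ->.
- by move=> a Ha /Ha ->.
Qed.

Notation "a ;; b" := (RSeq a b) (at level 61, right associativity).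
Definition clr r := RLoop r (RAct Nop).
Definition mvadd r q := RLoop r (RAct (Inc q)).
Definition mvsub r q := RLoop r (RAct (Dec q)).
Definition mvadd2 r q p := RLoop r (RAct (Inc q) ;; RAct (Inc p)).
Fixpoint incs r c := if c is c'.+1 then RAct (Inc r) ;; incs r c' else RAct Nop.
Fixpoint ctab s t := if s is v :: s'
  then RIf (BZ t) (incs t v) (RAct (Dec t) ;; ctab s' t) else clr t.

(** While the dividend is counted down, [t.+1] holds the divisor minus the current remainder, [t.+2]
    the remainder and [t.+3] the quotient. When [t.+1] reaches zero, a multiple is complete and the
    divisor is restored from the remainder. *)
Definition cdivmod t := RLoop t (RAct (Dec t.+1) ;; RAct (Inc t.+2) ;;
  RIf (BZ t.+1) (mvadd t.+2 t.+1 ;; RAct (Inc t.+3)) (RAct Nop)).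

(** Protocol: all registers from [t] on are zero before, and only [t] may differ from that
    afterwards. Reading a variable by a loop destroys it, so it is copied twice and one copy is
    moved back. *)
Fixpoint cexp (e : expr) (t : nat) : rcmd :=
  match e with
  | EVar v => mvadd2 v t t.+1 ;; mvadd t.+1 v
  | ECst c => incs t c
  | EAdd a b => cexp a t ;; cexp b t.+1 ;; mvadd t.+1 t
  | ESub a b => cexp a t ;; cexp b t.+1 ;; mvsub t.+1 t
  | EMul a b => cexp a t ;; cexp b t.+1 ;;
      RLoop t (mvadd2 t.+1 t.+2 t.+3 ;; mvadd t.+3 t.+1) ;; clr t.+1 ;; mvadd t.+2 t
  | EDiv a b => cexp a t ;; cexp b t.+1 ;;
      RIf (BZ t.+1) (clr t)
        (cdivmod t ;; clr t.+1 ;; clr t.+2 ;; mvadd t.+3 t)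
  | EMod a b => cexp a t ;; cexp b t.+1 ;;
      RIf (BZ t.+1) (RAct Nop)
        (cdivmod t ;; clr t.+1 ;; clr t.+3 ;; mvadd t.+2 t)
  | ETab s a => cexp a t ;; ctab s t
  | EIn a => cexp a t ;; RLoop t (RAct InR ;; RAct (Inc t.+1)) ;;
      RIf BNone (incs t 2) (RIf BOne (RAct (Inc t)) (RAct Nop)) ;; RLoop t.+1 (RAct InL)
  | EMem a => cexp a t ;; RLoop t (RAct MemR ;; RAct (Inc t.+1)) ;;
      RIf BMem (RAct (Inc t)) (RAct Nop) ;; RLoop t.+1 (RAct MemL)
  end.

Ltac ueq := apply: functional_extensionality => ?; rewrite /upd;
  rewrite ?eqxx; repeat (case: eqP => ? //; subst => //; rewrite ?eqxx); try lia.

Lemma eq_succ t : ((t == t.+1) = false) * ((t == t.+2) = false) * ((t == t.+3) = false)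
  * ((t.+1 == t) = false) * ((t.+2 == t) = false) * ((t.+3 == t) = false).
Proof. by do !split; apply/eqP; lia. Qed.

Ltac rsplit r t oth :=
  have: r = t \/ r = t.+1 \/ r = t.+2 \/ r = t.+3 \/
    (r <> t /\ r <> t.+1 /\ r <> t.+2 /\ r <> t.+3); [lia|];
  move=> [-> | [-> | [-> | [-> | [? [? [? ?]]]]]]];
  rewrite ?eqSS ?eq_succ ?eqxx /=; try lia;
  repeat (case: eqP => ?; [by lia|]); rewrite ?oth //.

Section Compile.
Variables (x : seq bool) (R B : nat).
Local Notation ev := (ev x R B).

(** The state after each round is supplied in closed form by [st], so the proofs about arithmetic
    loops reduce to one round. *)
Lemma ev_loop r c (st : nat -> ram) n : r < R ->
  (forall i, i <= n -> regs (st i) r = n - i) ->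
  (forall i, i < n -> ev c (asem x (Dec r) (st i)) (st i.+1)) ->
  ev (RLoop r c) (st 0) (st n).
Proof.
move=> rR h1 h2.
suff H k : k <= n -> ev (RLoop r c) (st (n - k)) (st n).
  by have := H n (leqnn n); rewrite subnn.
elim: k => [|k IH] hk.
  by rewrite subn0; apply: EvLoop0 => //; rewrite h1 // subnn.
apply: (@EvLoopS _ _ _ r c k _ (st (n - k)) _) => //; last by apply: IH; lia.
- by rewrite h1; lia.
- by have := h2 (n - k.+1); rewrite (_ : (n - k.+1).+1 = n - k); [apply; lia|lia].
- by rewrite h1; lia.
Qed.

Lemma ev_act a s s' : apre x R B a s -> asem x a s = s' -> ev (RAct a) s s'.
Proof. by move=> h <-; apply: EvAct. Qed.

Lemma ev_clr r g i m h o : r < R ->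
  ev (clr r) (Ram g i m h o) (Ram (upd g r 0) i m h o).
Proof.
move=> rR; have := @ev_loop r (RAct Nop) (fun k => Ram (upd g r (g r - k)) i m h o) (g r) rR.
rewrite /= subn0 subnn (_ : upd g r (g r) = g); last by ueq.
apply => [k _|k hk]; first by rewrite /upd eqxx.
apply: ev_act => //=; congr Ram; ueq.
Qed.

Lemma ev_mvadd r q g i m h o : r < R -> q < R -> r != q -> g q + g r <= B ->
  ev (mvadd r q) (Ram g i m h o) (Ram (upd (upd g q (g q + g r)) r 0) i m h o).
Proof.
move=> rR qR /eqP nq le; have := @ev_loop r (RAct (Inc q))
  (fun k => Ram (upd (upd g q (g q + k)) r (g r - k)) i m h o) (g r) rR.
rewrite /= subn0 addn0 subnn (_ : upd (upd g q _) r (g r) = g); last by ueq.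
apply => [k _|k hk]; first by rewrite /upd eqxx.
apply: ev_act => /=; last by congr Ram; ueq.
by rewrite qR /upd eqxx; repeat (case: eqP => ? //; subst => //); lia.
Qed.

Lemma ev_mvsub r q g i m h o : r < R -> q < R -> r != q ->
  ev (mvsub r q) (Ram g i m h o) (Ram (upd (upd g q (g q - g r)) r 0) i m h o).
Proof.
move=> rR qR /eqP nq; have := @ev_loop r (RAct (Dec q))
  (fun k => Ram (upd (upd g q (g q - k)) r (g r - k)) i m h o) (g r) rR.
rewrite /= subn0 subn0 subnn (_ : upd (upd g q _) r (g r) = g); last by ueq.
apply => [k _|k hk]; first by rewrite /upd eqxx.
by apply: ev_act => //=; congr Ram; ueq.
Qed.

Lemma ev_mvadd2 r q p g i m h o : r < R -> q < R -> p < R -> r != q -> r != p -> q != p ->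
  g q + g r <= B -> g p + g r <= B ->
  ev (mvadd2 r q p) (Ram g i m h o)
     (Ram (upd (upd (upd g q (g q + g r)) p (g p + g r)) r 0) i m h o).
Proof.
move=> rR qR pR /eqP n1 /eqP n2 /eqP n3 le1 le2; have := @ev_loop r (RAct (Inc q) ;; RAct (Inc p))
  (fun k => Ram (upd (upd (upd g q (g q + k)) p (g p + k)) r (g r - k)) i m h o) (g r) rR.
rewrite /= subn0 !addn0 subnn (_ : upd _ r (g r) = g); last by ueq.
apply => [k _|k hk]; first by rewrite /upd eqxx.
apply: EvSeq; first apply: ev_act => //=.
  by rewrite qR /upd eqxx; repeat case: eqP => // ?; lia.
apply: ev_act => /=; last by congr Ram; ueq.
by rewrite pR /upd eqxx; repeat case: eqP => // ?; lia.
Qed.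

Lemma ev_incs r c g i m h o : r < R -> g r + c <= B ->
  ev (incs r c) (Ram g i m h o) (Ram (upd g r (g r + c)) i m h o).
Proof.
move=> rR; elim: c g => [|c IH] g le /=.
  by apply: ev_act => //=; congr Ram; ueq.
apply: EvSeq; first by apply: ev_act; [|exact: erefl]; rewrite /= rR; lia.
rewrite [X in ev _ _ X](_ : _ = Ram (upd (upd g r (g r).+1) r (upd g r (g r).+1 r + c)) i m h o).
  by apply: IH; rewrite /upd eqxx; lia.
by congr Ram; ueq; rewrite ?eqxx; lia.
Qed.

Lemma ev_tab s t g i m h o : t < R -> sumn s <= B ->
  ev (ctab s t) (Ram g i m h o) (Ram (upd g t (nth 0 s (g t))) i m h o).
Proof.
move=> tR; elim: s g => [|v s IH] g /= le; first by rewrite nth_nil; apply: ev_clr.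
apply: EvIf => //=; case: eqP => e.
  have := @ev_incs t v g i m h o tR; rewrite e; apply; lia.
apply: EvSeq; first by apply: ev_act; [|exact: erefl].
rewrite [X in ev _ _ X](_ : _ = Ram (upd (upd g t (g t).-1) t
   (nth 0 s (upd g t (g t).-1 t))) i m h o); first by apply: IH; lia.
by congr Ram; ueq; rewrite ?eqxx; case: (g t) e.
Qed.

Lemma ev_mul t g i m h o : t.+3 < R -> g t.+2 = 0 -> g t.+3 = 0 ->
  g t * g t.+1 + g t + g t.+1 <= B ->
  ev (RLoop t (mvadd2 t.+1 t.+2 t.+3 ;; mvadd t.+3 t.+1) ;; clr t.+1 ;; mvadd t.+2 t)
    (Ram g i m h o) (Ram (upd (upd g t (g t * g t.+1)) t.+1 0) i m h o).
Proof.
move=> tR e2 e3 le.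
have L := @ev_loop t (mvadd2 t.+1 t.+2 t.+3 ;; mvadd t.+3 t.+1)
  (fun k => Ram (upd (upd g t (g t - k)) t.+2 (k * g t.+1)) i m h o) (g t).
rewrite /= subn0 subnn in L.
rewrite (_ : upd (upd g t (g t)) t.+2 (0 * g t.+1) = g) in L; last by ueq.
apply: EvSeq; first apply: L.
- lia.
- by move=> k hk; rewrite /upd eqxx; case: eqP => //; lia.
- move=> k hk /=; have lk : k.+1 * g t.+1 <= g t * g t.+1 by rewrite leq_mul2r hk orbT.
  set g1 := upd _ t _.
  have a1 : g1 t.+1 = g t.+1 by rewrite /g1 /upd; repeat case: eqP => ?; lia.
  have a2 : g1 t.+2 = k * g t.+1 by rewrite /g1 /upd; repeat case: eqP => ?; lia.
  have a3 : g1 t.+3 = 0 by rewrite /g1 /upd; repeat case: eqP => ?; lia.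
  apply: EvSeq; first apply: ev_mvadd2; rewrite ?a1 ?a2 ?a3; try lia.
  set g2 := upd _ t.+1 0.
  have b1 : g2 t.+1 = 0 by rewrite /g2 /upd eqxx.
  have b3 : g2 t.+3 = g t.+1 by rewrite /g2 /upd; repeat case: eqP => ?; lia.
  rewrite [X in ev _ _ X](_ : _ = Ram (upd (upd g2 t.+1 (g2 t.+1 + g2 t.+3)) t.+3 0) i m h o).
    by apply: ev_mvadd; rewrite ?b1 ?b3; lia.
  congr Ram; apply: functional_extensionality => r; rewrite b1 b3 /g2 /g1 /upd !eqxx.
  by repeat (case: eqP => ?; subst => //); lia.
apply: EvSeq; first by apply: ev_clr; lia.
set g2 := upd _ t.+1 0.
have b0 : g2 t = 0 by rewrite /g2 /upd; repeat case: eqP => ?; lia.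
have b2 : g2 t.+2 = g t * g t.+1 by rewrite /g2 /upd; repeat case: eqP => ?; lia.
rewrite [X in ev _ _ X](_ : _ = Ram (upd (upd g2 t (g2 t + g2 t.+2)) t.+2 0) i m h o).
  by apply: ev_mvadd; rewrite ?b0 ?b2; lia.
congr Ram; apply: functional_extensionality => r; rewrite b0 b2 /g2 /upd.
by repeat (case: eqP => ?; subst => //); lia.
Qed.

Lemma ev_divmod t g i m h o : t.+3 < R -> g t.+2 = 0 -> g t.+3 = 0 ->
  0 < g t.+1 -> g t + g t.+1 <= B ->
  ev (cdivmod t) (Ram g i m h o)
    (Ram (upd (upd (upd (upd g t 0) t.+1 (g t.+1 - g t %% g t.+1)) t.+2 (g t %% g t.+1))
      t.+3 (g t %/ g t.+1)) i m h o).
Proof.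
move=> tR e2 e3 dp le; set d := g t.+1 in dp *.
have L := @ev_loop t (RAct (Dec t.+1) ;; RAct (Inc t.+2) ;;
  RIf (BZ t.+1) (mvadd t.+2 t.+1 ;; RAct (Inc t.+3)) (RAct Nop))
  (fun k => Ram (upd (upd (upd (upd g t (g t - k)) t.+1 (d - k %% d)) t.+2 (k %% d))
      t.+3 (k %/ d)) i m h o) (g t).
rewrite /= subn0 subnn mod0n div0n subn0 in L.
rewrite (_ : upd (upd (upd (upd g t (g t)) t.+1 d) t.+2 0) t.+3 0 = g) in L; last by ueq.
apply: L; first lia.
  by move=> k _; rewrite /upd; repeat case: eqP => ? //; lia.
move=> k hk; have md : k %% d < d by rewrite ltn_mod.
have mk : k %% d <= k by apply: leq_mod.
have dk : k %/ d <= k by apply: leq_div.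
have kd := divn_eq k d.
apply: EvSeq; first by apply: ev_act; [rewrite /=; lia|exact: erefl].
apply: EvSeq; first (apply: ev_act; last exact: erefl).
  by rewrite /= /upd; repeat case: eqP => ?; lia.
apply: EvIf; first by rewrite /=; lia.
rewrite /=; set g1 := upd _ t.+2 _.
have a0 : g1 t = g t - k.+1 by rewrite /g1 /upd; repeat case: eqP => ?; lia.
have a1 : g1 t.+1 = d - (k %% d).+1 by rewrite /g1 /upd; repeat case: eqP => ?; lia.
have a2 : g1 t.+2 = (k %% d).+1 by rewrite /g1 /upd; repeat case: eqP => ?; lia.
have a3 : g1 t.+3 = k %/ d by rewrite /g1 /upd; repeat case: eqP => ?; lia.
have other r : r <> t -> r <> t.+1 -> r <> t.+2 -> r <> t.+3 -> g1 r = g r.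
  by rewrite /g1 /upd; repeat case: eqP => ? //; lia.
clearbody g1; rewrite a1; case: eqP => ed.
  have dd : d = (k %% d).+1 by lia.
  have [dv mo] : k.+1 %/ d = (k %/ d).+1 /\ k.+1 %% d = 0.
    have e : k.+1 = (k %/ d).+1 * d by rewrite mulSn; lia.
    by rewrite e mulnK // modnMl.
  apply: EvSeq; first by apply: ev_mvadd; rewrite ?a1 ?a2; lia.
  apply: ev_act => /=; first by rewrite /upd; repeat case: eqP => ?; lia.
  congr Ram; apply: functional_extensionality => r; rewrite dv mo /upd.
  rsplit r t other.
have [dv mo] : k.+1 %/ d = k %/ d /\ k.+1 %% d = (k %% d).+1.
  have e : k.+1 = k %/ d * d + (k %% d).+1 by lia.
  have l : (k %% d).+1 < d by lia.
  by rewrite e divnMDl // (divn_small l) modnMDl (modn_small l) addn0.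
apply: ev_act => //=; congr Ram; apply: functional_extensionality => r; rewrite dv mo /upd.
by rsplit r t other.
Qed.

Lemma ev_in t g m h o : t.+1 < R -> g t.+1 = 0 -> g t + 2 <= B ->
  ev (RLoop t (RAct InR ;; RAct (Inc t.+1)) ;;
      RIf BNone (incs t 2) (RIf BOne (RAct (Inc t)) (RAct Nop)) ;; RLoop t.+1 (RAct InL))
   (Ram g 0 m h o) (Ram (upd g t (sym x (g t))) 0 m h o).
Proof.
move=> tR e1 le; set v := g t in le *.
have L := @ev_loop t (RAct InR ;; RAct (Inc t.+1))
  (fun k => Ram (upd (upd g t (v - k)) t.+1 k) (minn k (size x)) m h o) v.
rewrite /= subn0 min0n (_ : upd (upd g t v) _ 0 = g) in L; last by ueq.
apply: EvSeq; first apply: L; first lia.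
- by move=> k _; rewrite /upd; repeat case: eqP => ? //; lia.
- move=> k hk; apply: EvSeq; first by apply: ev_act; [|exact: erefl].
  apply: ev_act => /=; first by rewrite /upd; repeat case: eqP => ?; lia.
  by congr Ram; [ueq; rewrite /=; repeat case: eqP => ?; lia|lia].
rewrite subnn; apply: (@EvSeq _ _ _ _ _ _ (Ram (upd (upd g t (sym x v)) t.+1 v) (minn v (size x)) m h o)).
  have sE : sym x v = if read_in x (minn v (size x)) is Some b then b else 2.
    rewrite /sym /read_in; case: (ltnP v (size x)) => hv.
      by rewrite hv.
    by rewrite ltnn.
  apply: EvIf => //=; rewrite sE; case er: (read_in x _) => [[]|] /=.
  + apply: EvIf => //=; rewrite er; apply: ev_act => /=.
      by rewrite /upd; repeat case: eqP => ?; lia.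
    by congr Ram; ueq; repeat case: eqP => ?; lia.
  + apply: EvIf => //=; rewrite er; apply: ev_act => //=.
  rewrite [X in ev _ _ X](_ : _ = Ram (upd (upd (upd g t 0) t.+1 v) t
    (upd (upd g t 0) t.+1 v t + 2)) (minn v (size x)) m h o).
    by apply: (@ev_incs t 2); rewrite /upd; repeat case: eqP => ?; lia.
  by congr Ram; ueq; repeat case: eqP => ?; lia.
(* The walk back makes [v] steps even if the end marker stopped the head earlier; the surplus steps
   are absorbed at position 0. *)
have L2 := @ev_loop t.+1 (RAct InL)
  (fun k => Ram (upd (upd g t (sym x v)) t.+1 (v - k)) (minn v (size x) - k) m h o) v.
rewrite /= !subn0 subnn in L2.
rewrite (_ : minn v (size x) - v = 0) in L2; last lia.
rewrite (_ : upd (upd g t (sym x v)) t.+1 0 = upd g t (sym x v)) in L2; last by ueq.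
apply: L2; first lia.
- by move=> k _; rewrite /upd; repeat case: eqP => ? //; lia.
- by move=> k hk; apply: ev_act => //=; congr Ram; [ueq|lia].
Qed.

Lemma ev_seek t g i m o : t.+1 < R -> g t.+1 = 0 -> g t <= B ->
  ev (RLoop t (RAct MemR ;; RAct (Inc t.+1))) (Ram g i m 0 o)
    (Ram (upd (upd g t 0) t.+1 (g t)) i m (g t) o).
Proof.
move=> tR e1 le; set v := g t in le *.
have L := @ev_loop t (RAct MemR ;; RAct (Inc t.+1))
  (fun k => Ram (upd (upd g t (v - k)) t.+1 k) i m k o) v.
rewrite /= subn0 (_ : upd (upd g t v) _ 0 = g) in L; last by ueq.
rewrite subnn in L; apply: L; first lia.
- by move=> k _; rewrite /upd; repeat case: eqP => ? //; lia.
- move=> k hk; apply: EvSeq; first by apply: ev_act; [rewrite /=; lia|exact: erefl].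
  apply: ev_act => /=; first by rewrite /upd; repeat case: eqP => ?; lia.
  by congr Ram; ueq; repeat case: eqP => ?; lia.
Qed.

Lemma ev_unseek t g i m o : t < R ->
  ev (RLoop t (RAct MemL)) (Ram g i m (g t) o) (Ram (upd g t 0) i m 0 o).
Proof.
move=> tR; have L := @ev_loop t (RAct MemL)
  (fun k => Ram (upd g t (g t - k)) i m (g t - k) o) (g t).
rewrite /= subn0 subnn (_ : upd g t (g t) = g) in L; last by ueq.
apply: L => //.
- by move=> k _; rewrite /upd eqxx.
- by move=> k hk; apply: ev_act => //=; congr Ram; [ueq|lia].
Qed.

Lemma ev_mem t g i m o : t.+1 < R -> g t.+1 = 0 -> g t + 1 <= B ->
  ev (RLoop t (RAct MemR ;; RAct (Inc t.+1)) ;;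
      RIf BMem (RAct (Inc t)) (RAct Nop) ;; RLoop t.+1 (RAct MemL))
   (Ram g i m 0 o) (Ram (upd g t (m (g t))) i m 0 o).
Proof.
move=> tR e1 le; apply: EvSeq; first by apply: ev_seek; lia.
set v := g t in le *.
set g2 := upd (upd g t (m v)) t.+1 v.
apply: (@EvSeq _ _ _ _ _ _ (Ram g2 i m v o)).
  apply: EvIf => //=; case hm: (m v).
    apply: ev_act; first by rewrite /= /upd; repeat case: eqP => ?; lia.
    by rewrite /=; congr Ram; rewrite /g2 hm; ueq; repeat case: eqP => ?; lia.
  by apply: ev_act => //=; congr Ram; rewrite /g2 hm.
have -> : v = g2 t.+1 by rewrite /g2 /upd eqxx.
rewrite (_ : upd g t _ = upd g2 t.+1 0); first by apply: ev_unseek; lia.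
by rewrite /g2; ueq; rewrite ?eqxx.
Qed.

Section Expr.
Variables (V A : nat).

Lemma ev_exp e : forall t g m o, evars V e -> V <= t -> t + need e <= R ->
  (forall r, t <= r -> g r = 0) -> (forall r, r < V -> g r <= A) -> eb e A <= B ->
  ev (cexp e t) (Ram g 0 m 0 o) (Ram (upd g t (eval x g m e)) 0 m 0 o).
Proof.
pose P e := forall t g m o, evars V e -> V <= t -> t + need e <= R ->
  (forall r, t <= r -> g r = 0) -> (forall r, r < V -> g r <= A) -> eb e A <= B ->
  ev (cexp e t) (Ram g 0 m 0 o) (Ram (upd g t (eval x g m e)) 0 m 0 o).
have bin a b op t g m o w : P a -> P b ->
  evars V a && evars V b -> V <= t -> t + (need a + need b + 4) <= R ->
  (forall r, t <= r -> g r = 0) -> (forall r, r < V -> g r <= A) -> eb a A + eb b A <= B ->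
  (let g' := upd (upd g t (eval x g m a)) t.+1 (eval x g m b) in
   g' t = eval x g m a -> g' t.+1 = eval x g m b -> g' t.+2 = 0 -> g' t.+3 = 0 ->
   ev op (Ram g' 0 m 0 o) (Ram (upd (upd g' t.+1 0) t w) 0 m 0 o)) ->
  ev (cexp a t ;; cexp b t.+1 ;; op) (Ram g 0 m 0 o) (Ram (upd g t w) 0 m 0 o).
  move=> Ha Hb /andP[va vb] Vt nR z gA le H.
  apply: EvSeq; first by apply: Ha => //; lia.
  apply: EvSeq.
    apply: Hb => //; try lia.
    + by move=> r hr; rewrite /upd z; [case: eqP => //; lia|lia].
    + by move=> r hr; rewrite /upd; case: eqP => // h; [lia|apply: gA].
  rewrite (@eval_ext _ _ g _ b V) //; last first.
    by move=> r hr; rewrite /upd; case: eqP => //; lia.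
  have -> : upd g t w = upd (upd (upd (upd g t (eval x g m a)) t.+1 (eval x g m b)) t.+1 0) t w.
    by ueq; rewrite z.
  by apply: H; rewrite /upd; repeat case: eqP => ? //; rewrite ?z //; lia.
elim: e => [v|c|a Ha b Hb|a Ha b Hb|a Ha b Hb|a Ha b Hb|a Ha b Hb|s a Ha|a Ha|a Ha] t g m o
  /= vars Vt nR z gA le.
- have gv := gA _ vars.
  apply: EvSeq; first by apply: ev_mvadd2; rewrite ?(z t) ?(z t.+1) //; lia.
  set g1 := upd _ v 0.
  have a1 : g1 t.+1 = g v by rewrite /g1 /upd (z t.+1) //; repeat case: eqP => ?; lia.
  have a2 : g1 v = 0 by rewrite /g1 /upd eqxx.
  rewrite (_ : upd g t (g v) = upd (upd g1 v (g1 v + g1 t.+1)) t.+1 0).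
    by apply: ev_mvadd; rewrite ?a1 ?a2; lia.
  rewrite a1 a2 /g1; apply: functional_extensionality => r; rewrite /upd (z t) //.
  by repeat (case: eqP => ?; subst => //); rewrite ?(z t.+1) //; lia.
- have -> : upd g t c = upd g t (g t + c) by rewrite z.
  by apply: ev_incs; rewrite ?z //; lia.
- have va := @eval_le x g m (EAdd a b) A V vars gA; rewrite /= in va.
  apply: bin => // g' e0 e1 e2 e3.
  have := @ev_mvadd t.+1 t g' 0 m 0 o; rewrite e0 e1 => H.
  rewrite (_ : upd (upd g' _ _) t _ = upd (upd g' t (eval x g m a + eval x g m b)) t.+1 0).
    by apply: H; lia.
  by ueq.
- apply: bin => // g' e0 e1 e2 e3.
  have := @ev_mvsub t.+1 t g' 0 m 0 o; rewrite e0 e1 => H.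
  rewrite (_ : upd (upd g' _ _) t _ = upd (upd g' t (eval x g m a - eval x g m b)) t.+1 0).
    by apply: H; lia.
  by ueq.
- have /andP[v1 v2] := vars.
  have va := @eval_le x g m a A V v1 gA; have vb := @eval_le x g m b A V v2 gA.
  have vm := leq_mul va vb.
  apply: bin => //; first lia.
  move=> g' e0 e1 e2 e3.
  have := @ev_mul t g' 0 m 0 o; rewrite e0 e1 => H.
  rewrite (_ : upd (upd g' _ _) t _ = upd (upd g' t (eval x g m a * eval x g m b)) t.+1 0).
    by apply: H => //; lia.
  by ueq.
- have /andP[v1 v2] := vars.
  have va := @eval_le x g m a A V v1 gA; have vb := @eval_le x g m b A V v2 gA.
  apply: bin => // g' e0 e1 e2 e3.
  have vd := leq_div (eval x g m a) (eval x g m b).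
  apply: EvIf; first by rewrite /=; lia.
  rewrite /= e1; case: eqP => d0.
    rewrite d0 divn0 (_ : upd (upd g' _ _) t 0 = upd g' t 0); last by ueq; lia.
    by apply: ev_clr; lia.
  apply: EvSeq; first by apply: ev_divmod; rewrite ?e0 ?e1; lia.
  apply: EvSeq; first by apply: ev_clr; lia.
  apply: EvSeq; first by apply: ev_clr; lia.
  rewrite e0 e1; set g2 := upd _ t.+2 0.
  have b0 : g2 t = 0 by rewrite /g2 /upd; repeat case: eqP => ?; lia.
  have b3 : g2 t.+3 = eval x g m a %/ eval x g m b by rewrite /g2 /upd; repeat case: eqP => ?; lia.
  rewrite (_ : upd (upd g' _ _) t _ = upd (upd g2 t (g2 t + g2 t.+3)) t.+3 0).
    by apply: ev_mvadd; rewrite ?b0 ?b3; lia.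
  rewrite b0 b3 /g2; apply: functional_extensionality => r; rewrite /upd.
  by repeat (case: eqP => ?; subst => //); lia.
- have /andP[v1 v2] := vars.
  have va := @eval_le x g m a A V v1 gA; have vb := @eval_le x g m b A V v2 gA.
  apply: bin => // g' e0 e1 e2 e3.
  have vd := leq_mod (eval x g m a) (eval x g m b).
  apply: EvIf; first by rewrite /=; lia.
  rewrite /= e1; case: eqP => d0.
    rewrite d0 modn0 (_ : upd (upd g' _ _) t _ = g'); last first.
      by apply: functional_extensionality => r; rewrite {1 2}/upd;
         repeat (case: eqP => ?; subst => //); lia.
    exact: ev_act.
  apply: EvSeq; first by apply: ev_divmod; rewrite ?e0 ?e1; lia.
  apply: EvSeq; first by apply: ev_clr; lia.
  apply: EvSeq; first by apply: ev_clr; lia.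
  rewrite e0 e1; set g2 := upd _ t.+3 0.
  have b0 : g2 t = 0 by rewrite /g2 /upd; repeat case: eqP => ?; lia.
  have b3 : g2 t.+2 = eval x g m a %% eval x g m b by rewrite /g2 /upd; repeat case: eqP => ?; lia.
  rewrite (_ : upd (upd g' _ _) t _ = upd (upd g2 t (g2 t + g2 t.+2)) t.+2 0).
    by apply: ev_mvadd; rewrite ?b0 ?b3; lia.
  rewrite b0 b3 /g2; apply: functional_extensionality => r; rewrite /upd.
  by repeat (case: eqP => ?; subst => //); lia.
- apply: EvSeq; first by apply: Ha => //; lia.
  rewrite (_ : upd g t (nth 0 s _) = upd (upd g t (eval x g m a)) t
     (nth 0 s (upd g t (eval x g m a) t))).
    by apply: ev_tab; lia.
  by ueq; rewrite ?eqxx.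
- have va := @eval_le x g m a A V vars gA.
  apply: EvSeq; first by apply: Ha => //; lia.
  rewrite (_ : upd g t (sym x _) = upd (upd g t (eval x g m a)) t
     (sym x (upd g t (eval x g m a) t))).
    by apply: ev_in; rewrite /upd ?eqxx ?(z t.+1) //; repeat case: eqP => ? //; lia.
  by ueq; rewrite ?eqxx.
- have va := @eval_le x g m a A V vars gA.
  apply: EvSeq; first by apply: Ha => //; lia.
  rewrite (_ : upd g t (m _ : nat) = upd (upd g t (eval x g m a)) t
     (m (upd g t (eval x g m a) t))).
    by apply: ev_mem; rewrite /upd ?eqxx ?(z t.+1) //; repeat case: eqP => ? //; lia.
  by ueq; rewrite ?eqxx.
Qed.
End Expr.
End Compile.

(** * Loop programs with capped variables *)

Inductive hcmd :=
| HSkip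
| HSet of nat & expr
| HWr of expr & expr
| HOut of expr
| HSeq of hcmd & hcmd
| HIf of expr & hcmd & hcmd
| HFor of expr & hcmd.

Record hst := Hst { henv : nat -> nat; hmem : nat -> bool; hout : seq bool }.

(* Assignments saturate at the value of variable 0, which is never assigned: this
   bounds all variables of all runs, and therefore the running time. *)
Fixpoint den (x : seq bool) (c : hcmd) (s : hst) : hst :=
  let ev := eval x (henv s) (hmem s) in
  match c with
  | HSkip => s
  | HSet v e => Hst (upd (henv s) v (minn (henv s 0) (ev e))) (hmem s) (hout s)
  | HWr a e => Hst (henv s) (upd (hmem s) (ev a) (ev e != 0)) (hout s)
  | HOut e => Hst (henv s) (hmem s) (rcons (hout s) (ev e != 0))
  | HSeq c1 c2 => den x c2 (den x c1 s)
  | HIf e c1 c2 => if ev e != 0 then den x c1 s else den x c2 s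
  | HFor e c => iter (ev e) (den x c) s
  end.

Definition EMin a b := ESub a (ESub a b).
Definition EMax a b := EAdd b (ESub a b).

Fixpoint hwf V (c : hcmd) : bool :=
  match c with
  | HSkip => true
  | HSet v e => [&& 0 < v, v < V & evars V e]
  | HWr a e => evars V a && evars V e
  | HOut e => evars V e
  | HSeq c1 c2 => hwf V c1 && hwf V c2
  | HIf e c1 c2 => [&& evars V e, hwf V c1 & hwf V c2]
  | HFor e c => evars V e && hwf V c
  end.

(** Nested loops do not multiply: variables stay below the cap [A] throughout, so only the values of
    single expressions have to be bounded. *)
Fixpoint hb (c : hcmd) (A : nat) : nat :=
  match c with
  | HSkip => 0
  | HSet v e => A + (A + eb e A)
  | HWr a e => eb a A + eb e A
  | HOut e => eb e A
  | HSeq c1 c2 => hb c1 A + hb c2 A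
  | HIf e c1 c2 => eb e A + hb c1 A + hb c2 A
  | HFor e c => eb e A + hb c A
  end.

Fixpoint hneed (c : hcmd) : nat :=
  match c with
  | HSkip => 0
  | HSet v e => need (EMin (EVar 0) e)
  | HWr a e => need a + need e + 4
  | HOut e => need e
  | HSeq c1 c2 => hneed c1 + hneed c2
  | HIf e c1 c2 => need e + hneed c1 + hneed c2
  | HFor e c => need e + hneed c + 1
  end.

(** Between commands the input head and the memory head are at 0 and all registers from [t] on are
    zero. A loop keeps its counter in [t], so its body gets the scratch registers from [t.+1] on. *)
Fixpoint chl (c : hcmd) (t : nat) : rcmd :=
  match c with
  | HSkip => RAct Nop
  | HSet v e => cexp (EMin (EVar 0) e) t ;; clr v ;; mvadd t v
  | HWr a e => cexp e t ;; cexp a t.+1 ;; RLoop t.+1 (RAct MemR ;; RAct (Inc t.+2)) ;;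
      RIf (BZ t) (RAct (MemW false)) (RAct (MemW true) ;; clr t) ;;
      RLoop t.+2 (RAct MemL)
  | HOut e => cexp e t ;; RIf (BZ t) (RAct (Out false)) (RAct (Out true) ;; clr t)
  | HSeq c1 c2 => chl c1 t ;; chl c2 t
  | HIf e c1 c2 => cexp e t ;; RIf (BZ t) (chl c2 t) (clr t ;; chl c1 t)
  | HFor e c => cexp e t ;; RLoop t (chl c t.+1)
  end.

Definition mix V (env g : nat -> nat) r := if r < V then env r else g r.

Lemma need_gt1 e : 1 < need e.
Proof. by elim: e => //= *; lia. Qed.

Section Cmd.
Variables (x : seq bool) (R B V A : nat).
Hypothesis V0 : 0 < V.
Local Notation ev := (ev x R B).

Definition henv_ok (s : hst) := henv s 0 = A /\ forall r, r < V -> henv s r <= A.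

Lemma den_ok c s : hwf V c -> henv_ok s -> henv_ok (den x c s).
Proof.
elim: c s => [|v e|a e|e|c1 IH1 c2 IH2|e c1 IH1 c2 IH2|e c IH] s //=.
- move=> /and3P[v0 vV _] [h1 h2]; split => /=; first by rewrite /upd; case: eqP => //; lia.
  move=> r hr; rewrite /upd; case: eqP => _; last exact: h2.
  by rewrite h1 geq_minl.
- by move=> /andP[w1 w2] h; apply: IH2 => //; apply: IH1.
- by move=> /and3P[_ w1 w2] h; case: ifP => _; [apply: IH1|apply: IH2].
- move=> /andP[_ w] h; elim: (eval _ _ _ _) => //= n IHn; exact: IH.
Qed.

Lemma mix_id env g : (forall r, r < V -> g r = env r) -> mix V env g = g.
Proof. by move=> h; apply: functional_extensionality => r; rewrite /mix; case: ifP => // /h. Qed.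

Lemma ev_chl c : forall t g s, hwf V c -> V <= t -> t + hneed c <= R -> hb c A <= B ->
  henv_ok s -> (forall r, r < V -> g r = henv s r) -> (forall r, t <= r -> g r = 0) ->
  ev (chl c t) (Ram g 0 (hmem s) 0 (hout s))
     (Ram (mix V (henv (den x c s)) g) 0 (hmem (den x c s)) 0 (hout (den x c s))).
Proof.
have EX e t g s : evars V e -> V <= t -> t + need e <= R -> eb e A <= B ->
   henv_ok s -> (forall r, r < V -> g r = henv s r) -> (forall r, t <= r -> g r = 0) ->
   ev (cexp e t) (Ram g 0 (hmem s) 0 (hout s))
     (Ram (upd g t (eval x (henv s) (hmem s) e)) 0 (hmem s) 0 (hout s)).
  move=> ve Vt nR le [h1 h2] ge z.
  rewrite -(@eval_ext x g (henv s) _ e V) //; apply: (@ev_exp x R B V A) => //.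
  by move=> r hr; rewrite ge // h2.
elim: c => [|v e|a e|e|c1 IH1 c2 IH2|e c1 IH1 c2 IH2|e c IH] t g s.
- by move=> _ _ _ _ _ h _ /=; rewrite mix_id //; apply: ev_act.
- move=> /= /and3P[v0 vV we] Vt nR le ok ge z; have [h1 h2] := ok.
  apply: EvSeq; first by apply: (EX (EMin (EVar 0) e) _ _ s) => //=; lia.
  rewrite (_ : eval x _ _ (EMin _ _) = minn (henv s 0) (eval x (henv s) (hmem s) e)); last first.
    by rewrite minnE.
  set w := minn _ _; have wA : w <= A by rewrite /w h1 geq_minl.
  apply: EvSeq; first by apply: ev_clr; lia.
  set g2 := upd _ v 0.
  have a1 : g2 v = 0 by rewrite /g2 /upd eqxx.
  have a2 : g2 t = w by rewrite /g2 /upd eqxx; case: eqP => //; lia.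
  rewrite (_ : mix _ _ _ = upd (upd g2 v (g2 v + g2 t)) t 0).
    by apply: ev_mvadd; rewrite ?a1 ?a2; lia.
  rewrite a1 a2 /g2; apply: functional_extensionality => r; rewrite /mix /upd.
  case: ltnP => hr; first by repeat (case: eqP => ?; subst => //); rewrite ?ge //; lia.
  by repeat (case: eqP => ?; subst => //); rewrite ?z //; lia.
- move=> /= /andP[wa we] Vt nR le ok ge z; have [h1 h2] := ok.
  have va : eval x (henv s) (hmem s) a <= eb a A by apply: eval_le wa h2.
  have n1 := need_gt1 a; have n2 := need_gt1 e.
  apply: EvSeq; first by apply: (EX e _ _ s) => //=; lia.
  set ve := eval x _ _ e; set va' := eval x _ _ a in va *.
  apply: EvSeq.
    apply: (EX a _ _ s) => //=; try lia.
    + by move=> r hr; rewrite /upd; case: eqP => [?|_]; [lia|apply: ge].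
    + by move=> r hr; rewrite /upd z; [case: eqP => //; lia|lia].
  rewrite -/va'; set g2 := upd (upd g t ve) _ _.
  have b0 : g2 t = ve by rewrite /g2 /upd eqxx; case: eqP => //; lia.
  have b1 : g2 t.+1 = va' by rewrite /g2 /upd eqxx.
  have b2 : g2 t.+2 = 0 by rewrite /g2 /upd; repeat case: eqP => ?; rewrite ?z; lia.
  apply: EvSeq; first by apply: ev_seek; rewrite ?b1; lia.
  rewrite b1 mix_id //.
  set g3 := upd g t.+2 va'.
  have g3E : upd (upd g2 t.+1 0) t.+2 va' = upd g3 t ve.
    rewrite /g3 /g2; apply: functional_extensionality => r; rewrite /upd.
    by repeat (case: eqP => ?; subst => //); rewrite ?z; lia.
  have g3t : upd g3 t 0 = g3.
    by rewrite /g3; ueq; rewrite z.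
  rewrite g3E; apply: (@EvSeq _ _ _ _ _ _ (Ram g3 0 (upd (hmem s) va' (ve != 0)) va' (hout s))).
    apply: EvIf; first by rewrite /=; lia.
    rewrite /= {1}/upd eqxx; case: eqP => hv /=.
      apply: ev_act => //=; congr Ram; rewrite hv; exact: g3t.
    apply: EvSeq; first by apply: ev_act; last exact: erefl.
    rewrite [X in ev _ _ X](_ : _ = Ram (upd (upd g3 t ve) t 0) 0 (upd (hmem s) va' true) va' (hout s)).
      by apply: ev_clr; lia.
    by congr Ram; rewrite -[LHS]g3t; ueq.
  have {2}-> : va' = g3 t.+2 by rewrite /g3 /upd eqxx.
  have -> : g = upd g3 t.+2 0 by rewrite /g3; ueq; rewrite z //; lia.
  by apply: ev_unseek; lia.
- move=> /= we Vt nR le ok ge z; have [h1 h2] := ok; have n2 := need_gt1 e.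
  apply: EvSeq; first by apply: (EX e _ _ s) => //=; lia.
  set ve := eval x _ _ e; rewrite mix_id //.
  have gt0 : upd g t 0 = g by ueq; rewrite z.
  apply: EvIf; first by rewrite /=; lia.
  rewrite /= {1}/upd eqxx; case: eqP => hv /=.
    by rewrite hv gt0; apply: ev_act.
  apply: EvSeq; first by apply: ev_act; last exact: erefl.
  rewrite [X in ev _ _ X](_ : _ = Ram (upd (upd g t ve) t 0) 0 (hmem s) 0 (rcons (hout s) true)).
    by apply: ev_clr; lia.
  by congr Ram; rewrite -[LHS]gt0; ueq.
- move=> /= /andP[w1 w2] Vt nR le ok ge z.
  apply: EvSeq; first by apply: (IH1 _ _ s) => //; lia.
  set s1 := den x c1 s.
  have := IH2 t (mix V (henv s1) g) s1 w2 Vt _ _ (den_ok w1 ok); rewrite -/s1.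
  rewrite (_ : mix V (henv (den x c2 s1)) (mix V _ g) = mix V (henv (den x c2 s1)) g); last first.
    by apply: functional_extensionality => r; rewrite /mix; case: (r < V).
  apply; try lia.
  + by move=> r hr; rewrite /mix hr.
  + by move=> r hr; rewrite /mix z //; case: ltnP => //; lia.
- move=> /= /and3P[we w1 w2] Vt nR le ok ge z; have n1 := need_gt1 e.
  apply: EvSeq; first by apply: (EX e _ _ s) => //=; lia.
  set ve := eval x _ _ e; apply: EvIf; first by rewrite /=; lia.
  have gE : upd (upd g t ve) t 0 = g by ueq; rewrite z.
  rewrite /= {1}/upd eqxx; case: eqP => hv /=.
    by rewrite hv (_ : upd g t 0 = g); [apply: (IH2 _ _ s) => //; lia|ueq; rewrite z].
  apply: EvSeq; first by apply: ev_clr; lia.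
  by rewrite gE; apply: (IH1 _ _ s) => //; lia.
- move=> /= /andP[we w] Vt nR le ok ge z; have n1 := need_gt1 e.
  apply: EvSeq; first by apply: (EX e _ _ s) => //=; lia.
  set ve := eval x _ _ e.
  pose st k := iter k (den x c) s.
  have okst k : henv_ok (st k) by elim: k => //= k IHk; apply: den_ok.
  have L := @ev_loop x R B t (chl c t.+1) (fun k =>
    Ram (mix V (henv (st k)) (upd g t (ve - k))) 0 (hmem (st k)) 0 (hout (st k))) ve.
  rewrite /= subn0 subnn in L.
  rewrite mix_id in L; last by move=> r hr; rewrite /upd ge //; case: eqP => //; lia.
  rewrite (_ : upd g t 0 = g) in L; last by ueq; rewrite z.
  apply: L; first lia.
  + by move=> k hk; rewrite /mix /upd eqxx; case: ltnP => //; lia.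
  move=> k hk; set g1 := upd _ t _.
  have := IH t.+1 g1 (st k) w _ _ _ (okst k); rewrite -/(st k.+1).
  rewrite (_ : mix V _ g1 = mix V (henv (st k.+1)) (upd g t (ve - k.+1))); last first.
    apply: functional_extensionality => r; rewrite /mix /g1 /upd /mix eqxx.
    have -> : (t < V) = false by lia.
    by case: (r < V) => //; case: eqP => // _; lia.
  apply; try lia.
  + by move=> r hr; rewrite /g1 /upd /mix hr; case: eqP => //; lia.
  + move=> r hr; rewrite /g1 /upd /mix.
    have -> : (r == t) = false by lia.
    have -> : (r < V) = false by lia.
    by apply: z; lia.
Qed.
End Cmd.

(** * Compiled machines *)

(** With n > 1 a single power absorbs constants and sums. *)
Definition poly (f : nat -> nat) := exists k, forall n, 1 < n -> f n <= n ^ k.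

Lemma poly_le f g : (forall n, 1 < n -> f n <= g n) -> poly g -> poly f.
Proof. by move=> h [k hk]; exists k => n n1; apply: leq_trans (h n n1) (hk n n1). Qed.

Lemma leq_expn n i j : 1 < n -> i <= j -> n ^ i <= n ^ j.
Proof. by move=> n1 h; rewrite leq_exp2l. Qed.

Lemma poly_cst c : poly (fun=> c).
Proof.
exists c => n n1; apply: leq_trans (ltnW (ltn_expl c (isT : 1 < 2))) _.
by case: c => // c; rewrite leq_exp2r.
Qed.

Lemma poly_id : poly id. Proof. by exists 1 => n _; rewrite expn1. Qed.

Lemma poly_mul f g : poly f -> poly g -> poly (fun n => f n * g n).
Proof.
move=> [k hk] [l hl]; exists (k + l) => n n1; rewrite expnD.
by apply: leq_mul; auto.
Qed.

Lemma poly_add f g : poly f -> poly g -> poly (fun n => f n + g n).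
Proof.
move=> [k hk] [l hl]; exists (maxn k l).+1 => n n1; rewrite expnS.
have h1 := leq_trans (hk n n1) (leq_expn n1 (leq_maxl k l)).
have h2 := leq_trans (hl n n1) (leq_expn n1 (leq_maxr k l)).
by apply: leq_trans (leq_add h1 h2) _; rewrite addnn -mul2n leq_mul2r n1 orbT.
Qed.

Lemma poly_exp f k : poly f -> poly (fun n => f n ^ k).
Proof.
move=> [l hl]; exists (l * k) => n n1; rewrite expnM.
by case: k => // k; rewrite leq_exp2r //; apply: hl.
Qed.

Lemma poly_eb e f : poly f -> poly (fun n => eb e (f n)).
Proof.
move=> pf; elim: e => /= *; do ?[exact: pf|exact: poly_cst|apply: poly_add|apply: poly_mul] => //.
Qed.

Lemma poly_hb c f : poly f -> poly (fun n => hb c (f n)).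
Proof.
move=> pf; elim: c => /= *; do ?[exact: pf|exact: poly_cst|exact: poly_eb|apply: poly_add] => //.
Qed.

(** The time bound depends on the input only through its length, so a constant string of that length
    can stand for it. *)
Lemma poly_tb c f : poly f -> poly (fun n => tb (nseq n false) (f n) c).
Proof.
move=> pf; elim: c => [a|c1 h1 c2 h2|b c1 h1 c2 h2|r c h] /=.
- case: a => *; try exact: poly_cst.
  apply: poly_add (poly_cst _) _; apply: poly_mul (poly_cst _).
  by apply: poly_le poly_id => n _; rewrite size_nseq.
- exact: poly_add.
- by apply: poly_add (poly_cst _) _; apply: poly_add.
- by do ?[exact: pf|exact: poly_cst|exact: h|apply: poly_add|apply: poly_mul].
Qed.

Lemma tb_size x y B c : size x = size y -> tb x B c = tb y B c.
Proof. by move=> e; elim: c => [a|c1 h1 c2 h2|b c1 h1 c2 h2|r c h] /=; rewrite ?e ?h1 ?h2 ?h. Qed.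

Fixpoint epow e k := if k is k'.+1 then EMul e (epow e k') else ECst 1.

Lemma eval_epow x g m e k : eval x g m (epow e k) = eval x g m e ^ k.
Proof. by elim: k => //= k ->; rewrite expnS. Qed.

Lemma evars_epow V e k : evars V e -> evars V (epow e k).
Proof. by move=> h; elim: k => //= k ->; rewrite h. Qed.

Section Prog.
Variables (V a : nat) (c : hcmd).
Hypotheses (a0 : 0 < a) (V1 : 1 < V) (wf : hwf V c).

(** Rewinding the input head doubles as the copy of the length into variable 1, from which the cap
    n^a of variable 0 is computed. *)
Definition rprog :=
  RAct (Scan V) ;; RLoop V (RAct InL ;; RAct (Inc 1)) ;;
  cexp (epow (EVar 1) a) V ;; mvadd V 0 ;; chl c V.

Definition env0 (n r : nat) := if r == 0 then n ^ a else if r == 1 then n else 0.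

Definition pR := V + (hneed c + need (epow (EVar 1) a) + 2).
Definition pB n := n + eb (epow (EVar 1) a) n + n ^ a + hb c (n ^ a).

Definition fin x m := den x c (Hst (env0 (size x)) m [::]).

Lemma ev_prog x m : 1 < size x ->
  exists g, ev x pR (pB (size x)) rprog (Ram (fun=> 0) 0 m 0 [::])
    (Ram g 0 (hmem (fin x m)) 0 (hout (fin x m))).
Proof.
set n := size x => n1; have na : n <= n ^ a by rewrite -{1}(expn1 n) leq_exp2l.
exists (mix V (henv (fin x m)) (env0 n)).
apply: EvSeq; first by apply: ev_act; [|exact: erefl]; rewrite /= /pR /pB; lia.
rewrite /= add0n subn0.
apply: EvSeq.
  have := @ev_loop x pR (pB n) V (RAct InL ;; RAct (Inc 1)) (fun k =>
    Ram (upd (upd (fun=> 0) 1 k) V (n - k)) (n - k) m 0 [::]) n.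
  rewrite subn0 (_ : upd (upd (fun=> 0) 1 0) V n = upd (fun=> 0) V n); last by ueq.
  apply; first by rewrite /pR; lia.
  - by move=> k _; rewrite /= /upd eqxx.
  - move=> k hk; apply: EvSeq; first by apply: ev_act; [|exact: erefl].
    apply: ev_act => /=; first by rewrite /pR /pB /upd; repeat case: eqP => ?; lia.
    by congr Ram; [ueq|lia].
rewrite subnn; set g1 := upd _ V 0.
have g1E r : r <> 1 -> g1 r = 0 by rewrite /g1 /upd; repeat case: eqP => ? //.
have g11 : g1 1 = n by rewrite /g1 /upd; repeat case: eqP => ? //; lia.
apply: EvSeq.
  apply: (@ev_exp x pR (pB n) V n).
  - by apply: evars_epow; rewrite /=; lia.
  - by [].
  - by rewrite /pR; lia.
  - by move=> r hr; apply: g1E; lia.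
  - by move=> r hr; case: (r =P 1) => [->|h]; [rewrite g11|rewrite g1E].
  - by rewrite /pB; lia.
rewrite eval_epow /= g11; set g2 := upd g1 V _.
have g20 : g2 0 = 0 by rewrite /g2 /upd g1E //; case: eqP => //; lia.
have g2V : g2 V = n ^ a by rewrite /g2 /upd eqxx.
apply: EvSeq; first by apply: ev_mvadd; rewrite ?g20 ?g2V /pR /pB; lia.
rewrite g20 g2V (_ : upd (upd g2 0 _) V 0 = env0 n); last first.
  apply: functional_extensionality => r; rewrite /env0 /upd /g2 /upd.
  case: (r =P V) => [->|h]; first by repeat case: eqP => ?; lia.
  by case: (r =P 0) => // h0; case: (r =P 1) => [->|h1 //]; rewrite ?g11 ?g1E.
apply: (@ev_chl x pR (pB n) V (n ^ a) _ c V (env0 n) (Hst (env0 n) m [::])) => //=.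
- lia.
- by rewrite /pR; lia.
- by rewrite /pB; lia.
- split; rewrite /henv /env0 //= => r hr; case: eqP => // _; case: eqP => // _.
- by move=> r hr; rewrite /env0; repeat case: eqP => ?; lia.
Qed.
End Prog.

(** * Answers on short inputs *)

Definition tin2 := TAct (fun f i w k => noop (i == None, i == Some true) w k).

Section Wrapper.
Variables (L : seq bool -> bool) (main : tcmd).

(* Polynomials n^k give no room on inputs of length < 2, which are answered from a table. *)
Definition wrap1 o := TSeq (tinm MRight) (TSeq tin2
  (TIf (fun f => f.1) (tout' o) (TSeq (tinm MLeft)
    (TSeq (TAct (fun f i w k => noop (false, false) w k)) main)))).

Definition twrap := TSeq tin2 (TIf (fun f => f.1) (tout' (L [::]))
   (TIf (fun f => f.2) (wrap1 (L [:: true])) (wrap1 (L [:: false])))).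

Variables (x w c : seq bool).
Local Notation St f i o := (TSt f i w 0 c 0 o).

Lemma te_in2 f i o : i <= size x ->
  texle x tin2 (St f i o) (St (read_in x i == None, read_in x i == Some true) i o) 1.
Proof.
move=> hi; exists 1 => //; rewrite [X in texec _ _ _ X _](_ : _ = tstep x
  (fun f i w k => noop (i == None, i == Some true) w k) (St f i o)); first exact: TeAct.
by rewrite /tstep /tapp /= !wr_nth !min0n (minn_idPl hi).
Qed.

Lemma te_inm m f i o :
  texle x (tinm m) (St f i o) (St f (minn (mv m i) (size x)) o) 1.
Proof.
exists 1 => //; rewrite [X in texec _ _ _ X _](_ : _ = tstep x
  (fun f i w k => Trans f w k None m MStay MStay) (St f i o)); first exact: TeAct.
by rewrite /tstep /tapp /= !wr_nth !min0n.
Qed.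

Lemma te_out b f i o : i <= size x ->
  texle x (tout' b) (St f i o) (St f i (rcons o b)) 1.
Proof.
move=> hi; exists 1 => //; rewrite [X in texec _ _ _ X _](_ : _ = tstep x
  (fun f i w k => Trans f w k (Some b) MStay MStay MStay) (St f i o)); first exact: TeAct.
by rewrite /tstep /tapp /= !wr_nth !min0n (minn_idPl hi).
Qed.

Lemma wrap_small f : size x < 2 -> exists f' i',
  texle x twrap (St f 0 [::]) (St f' i' [:: L x]) 10.
Proof.
move=> hx; have i0 := te_in2 f [::] (leq0n (size x)).
have i2 g i := @te_in2 g i [::]; have i3 b g i := @te_out b g i [::]; have i1 := te_inm.
case: x hx i0 i1 i2 i3 => [|b [|//]] _ i0 i1 i2 i3.
  exists (true, false), 0; apply: (@texle_leq _ _ _ _ (1 + 2)) => //.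
  by apply: texle_seq i0 _; apply: texle_ifT => //; apply: i3.
exists (true, false), 1.
have w1 f' : texle [:: b] (wrap1 (L [:: b])) (St f' 0 [::]) (St (true, false) 1 [:: L [:: b]]) 6.
  apply: (@texle_leq _ _ _ _ (1 + (1 + 2))) => //.
  apply: texle_seq (i1 MRight f' 0 [::]) _; apply: texle_seq (i2 _ 1 _) _ => //.
  by apply: texle_ifT => //; apply: i3.
apply: (@texle_leq _ _ _ _ (1 + 8)) => //.
apply: texle_seq i0 _; apply: texle_ifF => //.
by case: (b) w1 => w1; [apply: texle_ifT|apply: texle_ifF] => //; apply: texle_leq (w1 _).
Qed.
End Wrapper.

Lemma wrap_big L main x w c f s' T : 1 < size x ->
  texle x main (TSt (false, false) 0 w 0 c 0 [::]) s' T ->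
  texle x (twrap L main) (TSt f 0 w 0 c 0 [::]) s' (T + 10).
Proof.
move=> hx H; have i0 := te_in2 w c f [::] (leq0n (size x)).
have w1 f' o : texle x (wrap1 main o) (TSt f' 0 w 0 c 0 [::]) s' (T + 6).
  have i1 := te_inm x w c MRight f' 0 [::].
  rewrite /= (minn_idPl (ltnW hx)) in i1.
  have i2 := te_in2 w c f' [::] (ltnW hx).
  have i3 g := te_inm x w c MLeft g 1 [::]; rewrite /= min0n in i3.
  apply: texle_leq (texle_seq i1 (texle_seq i2 (texle_ifF _ _ (texle_seq (i3 _)
    (texle_seq (T1 := 1) _ H))))).
  - by lia.
  - by rewrite /= /read_in hx.
  exists 1 => //; set s := TSt _ _ _ _ _ _ _.
  rewrite [X in texec _ _ _ X _](_ : _ = tstep x (fun f i w k => noop (false, false) w k) s).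
    exact: TeAct.
  by rewrite /tstep /tapp /= !wr_nth !min0n.
apply: (@texle_leq _ _ _ _ (1 + (T + 6).+2)); first lia.
apply: texle_seq i0 _; apply: texle_ifF; first by rewrite /= /read_in (ltnW hx).
by case e: (read_in x 0 == Some true); [exact: texle_ifT|apply: texle_ifF => //=].
Qed.

Lemma size_rep_le v : size (rep v) <= v.
Proof. by have := size_rep v; have := ltn_expl (size (rep v)) (isT : 1 < 2); lia. Qed.

Lemma ltn_logn2 n : n < 2 ^ logn2 n.
Proof. by rewrite /logn2; apply: trunc_log_ltn. Qed.

Lemma logn2_le n : logn2 n <= n.+1.
Proof.
rewrite /logn2 ltnS; case: n => // n; have [h _] := andP (trunc_log_bounds (isT : 1 < 2) (ltn0Sn n)).
by apply: ltnW; apply: leq_trans h; apply: ltn_expl.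
Qed.

(** Zero has no digits, so a blank tape with one mark is already the layout of registers that are
    all zero. *)
Lemma wenc_nseq G ng s : 0 < ng -> 2 < G -> ng * G <= s ->
  wenc G ng (lay (fun=> 0) xpred0 xpred0) (wr (nseq s false) 0 true).
Proof.
move=> hn hG hs; split; first by rewrite size_wr size_nseq.
have s0 : 0 < s by apply: leq_trans hs; rewrite muln_gt0 hn; lia.
move=> j o hj ho; rewrite nth_wr ?size_nseq // nth_nseq if_same.
rewrite addn_eq0 muln_eq0 /lay; case: o ho => [|[|[|o]]] ho /=; rewrite ?andbF ?andbT //.
  by case: eqP => //= _; have -> : (G == 0) = false by lia.
by case: ifP => _; rewrite ?nth_nil.
Qed.

Section Machines.
Variables (L : seq bool -> bool) (V a : nat) (c : hcmd).
Hypotheses (a0 : 0 < a) (V1 : 1 < V) (wf : hwf V c).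

Let R := pR V a c.
Let G := 2 * R + 3.
Let B := pB a c.
Let prog := rprog V a c.
Let G0 : 0 < G. Proof. by rewrite /G addn3. Qed.
Let G2 : 2 < G. Proof. by rewrite /G addn3. Qed.

Lemma poly_pB : poly B.
Proof.
rewrite /B /pB; apply: poly_add; last by apply: poly_hb; apply: poly_exp poly_id.
apply: poly_add; last by apply: poly_exp poly_id.
apply: poly_add; first exact: poly_id.
exact: poly_eb poly_id.
Qed.

Definition prog_time (ng cM : nat -> nat) n :=
  tb (nseq n false) (B n) prog * tau R (ng n) (cM n) + 3 * c0 G + 20.

Lemma poly_prog_time ng cM : poly ng -> poly cM -> poly (prog_time ng cM).
Proof.
move=> p1 p2; rewrite /prog_time; apply: poly_add (poly_cst _); apply: poly_add (poly_cst _).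
apply: poly_mul; first exact: poly_tb poly_pB.
rewrite /tau /costR; apply: poly_add (poly_cst _); apply: poly_add (poly_cst _).
apply: poly_add p2; apply: poly_mul (poly_cst _); exact: poly_add (poly_cst _).
Qed.

Lemma wrap_run x main w tau0 f' i' s' T T' :
  texle x (twrap L main) (TSt (false, false) 0 (nseq w false) 0 tau0 0 [::])
     (TSt f' i' (tw s') (twh s') (tc s') (tch s') (tout s')) T -> T <= T' ->
  exists c', [/\ run x (init (tmach (twrap L main)) w tau0) T' = c',
    halting (cst c'), Defs.cat c' = tc s' & out c' = tout s'].
Proof.
move=> [t le H] le'; eexists; split; first exact: (texec_run H (leq_trans le le')).
all: by [].
Qed.

Definition main_cat := TSeq (twrt 0 true) (tr R bcat prog).

Lemma main_cat_ok x tau0 ng w f : 1 < size x ->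
  B (size x) < size tau0 -> ng * G <= w ->
  (forall v, v <= B (size x) -> (size (rep v)).+1 < ng) ->
  exists2 s', [/\ size (tc s') = size tau0,
      forall p, nth false (tc s') p = hmem (fin a c x (nth false tau0)) p &
      tout s' = hout (fin a c x (nth false tau0))]
    & texle x main_cat (TSt f 0 (nseq w false) 0 tau0 0 [::]) s'
      (tb x (B (size x)) prog * tau R ng 1 + c0 G).
Proof.
move=> n1 hB hw hng; have ng1 : 1 < ng by have := hng 0 isT.
have w0 : 0 < w by apply: leq_trans hw; rewrite muln_gt0 (ltnW ng1) G0.
have [g E] := ev_prog a0 V1 wf (nth false tau0) n1.
have := @te_wrt x 0 tau0 0 [::] (leq0n _) (leq0n _) G G0 0 true f (nseq w false) 0.
rewrite size_nseq => /(_ w0); rewrite /TS addn0 => x1.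
have gd : good x (B (size x)) (Ram (fun=> 0) 0 (nth false tau0) 0 [::]) by split.
have S0 : simr R ng (MRc (size tau0)) (Ram (fun=> 0) 0 (nth false tau0) 0 [::])
    (TSt f 0 (wr (nseq w false) 0 true) 0 tau0 0 [::]).
  by exists xpred0, xpred0; split=> //; apply: wenc_nseq => //; apply: ltnW.
have [s' S1 x2] := tr_ok hng (@bcat_R R x (B (size x)) ng _ hB)
  (@bcat_L R x (B (size x)) ng _ hB) (@bcat_W R x (B (size x)) ng _ hB)
  (@bcat_T R x (B (size x)) ng _) E gd S0.
exists s'; last first.
  apply: texle_leq (texle_seq x1 x2); rewrite [X in _ <= X]addnC leq_add2r /c0; lia.
by have [X [Y [_ -> _ _ [[-> _ h] _]]]] := S1.
Qed.

Definition main_work := TSeq (twrt 0 true) (TSeq (twrt 1 true) (tr R (bwork R) prog)).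

Lemma main_work_ok x ng w f : 1 < size x -> ng * G <= w -> (B (size x)).+1 < ng ->
  exists2 s', tout s' = hout (fin a c x xpred0)
    & texle x main_work (TSt f 0 (nseq w false) 0 [::] 0 [::]) s'
      (tb x (B (size x)) prog * tau R ng (cW R ng) + 3 * c0 G).
Proof.
move=> n1 hw hB.
have hng v : v <= B (size x) -> (size (rep v)).+1 < ng.
  by move=> h; have := size_rep_le v; lia.
have ng1 : 1 < ng by lia.
have ng0 : 0 < ng by lia.
have w0 : 0 < w by apply: leq_trans hw; rewrite muln_gt0 ng0 G0.
have w1 : 1 < w by apply: leq_trans hw; apply: leq_trans (leq_mul ng0 (leqnn G)); lia.
have [g E] := ev_prog a0 V1 wf xpred0 n1.
have := @te_wrt x 0 [::] 0 [::] (leq0n _) (leq0n _) G G0 0 true f (nseq w false) 0.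
rewrite size_nseq => /(_ w0); rewrite /TS addn0 => x1.
have W := wenc_nseq ng0 G2 hw.
have [w' [W' _ x2]] := @TL_wrt x 0 [::] 0 [::] (leq0n _) (leq0n _) G ng G0 1 true f
  (lay (fun=> 0) xpred0 xpred0) 0 ng0 (ltnW G2) _ W.
have gd : good x (B (size x)) (Ram (fun=> 0) 0 xpred0 0 [::]) by split.
have S0 : simr R ng MRw (Ram (fun=> 0) 0 xpred0 0 [::]) (TSt f 0 w' 0 [::] 0 [::]).
  exists (fun j => j == 0), xpred0; split=> //; case: W' => h1 h2; split=> // j o hj ho.
  rewrite h2 // upd2_X; case: o {ho} => [|[|[|o]]] //=; rewrite /upd.
  by case: eqP.
have [s' S1 x3] := tr_ok hng (@bwork_R R x (B (size x)) ng hB)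
  (@bwork_L R x (B (size x)) ng hB) (@bwork_W R x (B (size x)) ng hB)
  (@bwork_T R x (B (size x)) ng hB) E gd S0.
exists s'; last first.
  rewrite /TS mul0n in x2.
  apply: texle_leq (texle_seq x1 (texle_seq x2 x3)).
  by rewrite addnA [X in X <= _]addnC leq_add2l /c0; lia.
by have [X [Y [_ -> _ _ _]]] := S1.
Qed.

(** The exponent is left open upwards because the catalytic tape of the final machine must also have
    room for all the blocks. *)
Theorem cat_machine : exists M K0, forall K, K0 <= K -> forall x tau0,
  size tau0 = size x ^ K ->
  let f := run x (init M (K * logn2 (size x)) tau0) (size x ^ K + K) in
  halting (cst f) /\
  if size x < 2 then out f = [:: L x] /\ Defs.cat f = tau0
  else [/\ out f = hout (fin a c x (nth false tau0)), size (Defs.cat f) = size tau0 &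
           forall p, nth false (Defs.cat f) p = hmem (fin a c x (nth false tau0)) p].
Proof.
have [b hb] := poly_pB.
(* Registers are at most n^b, and n^b + 1 <= n^(b+1), so (b + 1) log n groups hold their digits; one
   more log n covers the extra group used by carries. *)
pose ng n := logn2 n * (b + 2).
have pn : poly ng.
  apply: poly_mul (poly_cst _); apply: poly_le (poly_add poly_id (poly_cst 1)) => n _.
  by rewrite addn1; apply: logn2_le.
have [d hd] := poly_prog_time pn (poly_cst 1).
(* One summand each for the catalytic space, the time, the work space and the short inputs. *)
exists (tmach (twrap L main_cat)), (b + d + (b + 2) * G + 10) => K hK x tau0 st f.
case: ltnP => hx.
  have [f' [i' H]] := wrap_small L main_cat (nseq (K * logn2 (size x)) false) tau0 (false, false) hx.
  have le : 10 <= size x ^ K + K by lia.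
  have [c' [e h1 h2 h3]] := wrap_run (s' := TSt f' i' _ _ _ _ _) H le.
  by rewrite /f e h1 h2 h3.
have hng v : v <= B (size x) -> (size (rep v)).+1 < ng (size x).
  move=> hv; rewrite /ng.
  have l0 : 0 < logn2 (size x) by [].
  suff : size (rep v) < logn2 (size x) * (b + 1) by lia.
  rewrite -(@ltn_exp2l 2) //; apply: leq_ltn_trans (size_rep v) _.
  rewrite expnM; apply: (@leq_ltn_trans (size x ^ (b + 1))); last first.
    by rewrite ltn_exp2r ?ltn_logn2 // addn1.
  rewrite addn1 expnS; apply: (@leq_trans (size x ^ b).+1).
    by rewrite ltnS; apply: leq_trans hv (hb _ hx).
  have : 0 < size x ^ b by rewrite expn_gt0; lia.
  by have := leq_mul hx (leqnn (size x ^ b)); lia.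
have hB : B (size x) < size tau0.
  rewrite st; apply: leq_ltn_trans (hb _ hx) _; rewrite ltn_exp2l //; lia.
have hw : ng (size x) * G <= K * logn2 (size x).
  rewrite /ng -mulnA mulnC leq_mul2r; apply/orP; right; lia.
have hT : prog_time ng (fun=> 1) (size x) <= size x ^ K + K.
  apply: leq_trans (hd _ hx) _; apply: leq_trans (leq_expn hx _) (leq_addr _ _); lia.
have [s' [e1 e2 e3] H] := main_cat_ok (false, false) hx hB hw hng.
have le : tb x (B (size x)) prog * tau R (ng (size x)) 1 + c0 G + 10 <= size x ^ K + K.
  apply: leq_trans hT; rewrite /prog_time (@tb_size x (nseq (size x) false)) ?size_nseq //; lia.
have := wrap_big L (false, false) hx H; case: s' e1 e2 e3 {H} => f' i' w' h' c' ch' o' /= e1 e2 e3 H.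
have [c2 [e h1 h2 h3]] := wrap_run (s' := TSt f' i' w' h' c' ch' o') H le.
by rewrite /f e h2 h3; split; first exact: h1.
Qed.

Theorem work_machine : exists M k, forall x,
  let f := run x (init M (size x ^ k + k) [::]) (size x ^ k + k) in
  halting (cst f) /\
  out f = if size x < 2 then [:: L x] else hout (fin a c x xpred0).
Proof.
(* Space is no concern here, and each group also carries one cell of the simulated memory, so there
   are more than [B] groups. *)
pose ng n := B n + 2.
have pn : poly ng by apply: poly_add poly_pB (poly_cst _).
have pc : poly (fun n => cW R (ng n)).
  by apply: poly_mul (poly_cst _); apply: poly_add (poly_cst _).
have [d hd] := poly_prog_time pn pc.
have [b hb] := poly_mul pn (poly_cst G).
exists (tmach (twrap L main_work)), (b + d + 10) => x f.
set k := b + d + 10 in f *.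
case: ltnP => hx.
  have [f' [i' H]] := wrap_small L main_work (nseq (size x ^ k + k) false) [::] (false, false) hx.
  have le : 10 <= size x ^ k + k by lia.
  have [c' [e h1 h2 h3]] := wrap_run (s' := TSt f' i' _ _ _ _ _) H le.
  by rewrite /f e h1 h3.
have hw : ng (size x) * G <= size x ^ k + k.
  apply: leq_trans (hb _ hx) _; apply: leq_trans (leq_expn hx _) (leq_addr _ _); lia.
have hT : prog_time ng (fun n => cW R (ng n)) (size x) <= size x ^ k + k.
  apply: leq_trans (hd _ hx) _; apply: leq_trans (leq_expn hx _) (leq_addr _ _); lia.
have hB : (B (size x)).+1 < ng (size x) by rewrite /ng; lia.
have [s' e3 H] := main_work_ok (false, false) hx hw hB.
have le : tb x (B (size x)) prog * tau R (ng (size x)) (cW R (ng (size x))) + 3 * c0 G + 10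
    <= size x ^ k + k.
  apply: leq_trans hT; rewrite /prog_time (@tb_size x (nseq (size x) false)) ?size_nseq //; lia.
have := wrap_big L (false, false) hx H; case: s' e3 {H} => f' i' w' h' c' ch' o' /= e3 H.
have [c2 [e h1 h2 h3]] := wrap_run (s' := TSt f' i' w' h' c' ch' o') H le.
by rewrite /f e h3; split; first exact: h1.
Qed.
End Machines.

(** * Reversible tour of a forest *)

Section Tour.
Variables (V : finType) (fstep : V -> option V) (J : nat).
Variables (cand : V -> nat -> option V) (idx : V -> nat).
Hypothesis idxJ : forall v, idx v < J.
Hypothesis candP : forall v c w, c < J ->
  cand v c = Some w <-> fstep w = Some v /\ idx w = c.

(* [(v, j)] means: at v, the candidate predecessors of index < j have been explored;
   with d the candidates are taken in the opposite order. *)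
Definition tour (d : bool) (z : V * nat) : V * nat :=
  let: (v, j) := z in
  if j < J then
    if cand v (if d then J.-1 - j else j) is Some w then (w, 0) else (v, j.+1)
  else if fstep v is Some w then (w, if d then J - idx v else (idx v).+1) else z.

(** The forward state [(v, j)] and the backward state [(v, J - j)] divide the candidates at the same
    place, so the next candidate of the backward tour is the last one of the forward tour. A
    terminal node is excluded because the tour gets stuck there and such a step has no inverse. *)
Lemma tour_inv v j v' j' : j <= J -> fstep v != None -> tour false (v, j) = (v', j') ->
  j' <= J /\ tour true (v', J - j') = (v, J - j).
Proof.
move=> hj hs; rewrite [tour false _]/=; case: ltnP => lj.
  case e: (cand v j) => [w|] [<- <-].
    have [e1 e2] := (candP _ _ lj).1 e.
    by rewrite subn0 /= ltnn e1 e2; split=> //; lia.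
  split=> //=; rewrite (_ : (J - j.+1 < J) = true); last lia.
  rewrite (_ : J.-1 - (J - j.+1) = j); last lia.
  by rewrite e; congr pair; lia.
have -> : j = J by lia.
case e: (fstep v) hs => [w|//] _ [<- <-]; have iJ := idxJ v.
split=> //=; rewrite (_ : (J - (idx v).+1 < J) = true); last lia.
rewrite (_ : J.-1 - (J - (idx v).+1) = idx v); last lia.
have -> : cand w (idx v) = Some v by apply/candP.
by rewrite subnn.
Qed.

Lemma tour_leJ v j : j <= J -> (tour false (v, j)).2 <= J.
Proof.
move=> hj /=; case: ltnP => lj; first by case: (cand v j).
by case: (fstep v) => //=; apply: idxJ.
Qed.

Definition fnext v := odflt v (fstep v).
(** The graph may contain cycles; nodes that lead into a cycle lie in no tree of a terminal node. *)
Definition tree r := [set v | fconnect fnext v r].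

Lemma tree_root_uniq v r w : fstep r = None -> fstep w = None ->
  v \in tree r -> v \in tree w -> r = w.
Proof.
have fx q n : fstep q = None -> iter n fnext q = q.
  by move=> hq; elim: n => //= n ->; rewrite /fnext hq.
move=> hr hw; rewrite !inE => /iter_findex e1 /iter_findex e2; move: e1 e2.
set i := findex _ _ _; set j := findex _ _ _ => e1 e2.
case: (leqP i j) => [le|/ltnW le].
  by rewrite -e2 -(subnK le) iterD e1 fx.
by rewrite -e1 -(subnK le) iterD e2 fx.
Qed.

Section Root.
Variable r : V.
Hypothesis rterm : fstep r = None.

Lemma tree_next v w : fstep v = Some w -> (v \in tree r) = (w \in tree r).
Proof.
move=> e; have fw : fnext v = w by rewrite /fnext e.
rewrite !inE; apply/idP/idP => h; last first.
  by apply: connect_trans h; rewrite -fw; apply: fconnect1.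
have vr : v != r by apply/eqP => er; rewrite er rterm in e.
move: (h); rewrite fconnect_orbit => _.
case/iter_findex: h; case: (findex _ _ _) => [/= ev|n]; first by rewrite ev eqxx in vr.
by rewrite iterSr fw => <-; apply: fconnect_iter.
Qed.

Lemma tree_term v : fstep v = None -> v \in tree r -> v = r.
Proof. by move=> hv; apply: tree_root_uniq hv rterm _; rewrite inE. Qed.

Lemma tour_tree z : z.2 <= J -> z.1 \in tree r -> (tour false z).1 \in tree r.
Proof.
case: z => v j /= hj h; case: ltnP => lj.
  case e: (cand v j) => [w|//].
  by have [e1 _] := (candP _ _ lj).1 e; rewrite (tree_next e1).
by case e: (fstep v) => [w|//]; rewrite -(tree_next e).
Qed.

Let isdep v d := iter d fnext v = r /\ forall i, i < d -> iter i fnext v <> r.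

Let isdep_child v w d : fstep w = Some v -> isdep v d -> isdep w d.+1.
Proof.
move=> e [h1 h2]; have fw : fnext w = v by rewrite /fnext e.
split; first by rewrite iterSr fw.
case=> [_ /= ew|i hi]; first by rewrite ew rterm in e.
by rewrite iterSr fw; apply: h2.
Qed.

Let isdep_lt v d : isdep v d -> d < #|V|.
Proof.
move=> [h1 h2]; have c : fconnect fnext v r by rewrite -h1; apply: fconnect_iter.
have l : findex fnext v r < #|V| by apply: leq_trans (findex_max c) (max_card _).
case: (leqP d (findex fnext v r)) => [le|/h2]; first exact: leq_ltn_trans le l.
by rewrite iter_findex.
Qed.

Let T := tour false.

(** Depths in a tree stay below [#|V|], which bounds the induction: a child is toured completely by
    the outer induction hypothesis before the candidate index advances. *)
Lemma tour_sub n : forall v d j, isdep v d -> #|V| <= n + d -> j <= J ->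
  exists t, iter t T (v, j) = (v, J).
Proof.
elim: n => [|n IH] v d j hd le hj; first by have := isdep_lt hd; lia.
have [k ek] : exists k, j + k = J by exists (J - j); lia.
elim: k j hj ek => [|k IHk] j hj ek; first by exists 0; rewrite /= -ek addn0.
have lj : j < J by lia.
have next : exists t, iter t T (v, j) = (v, j.+1).
  case e: (cand v j) => [w|]; last by exists 1; rewrite /= lj e.
  have [e1 e2] := (candP _ _ lj).1 e.
  have [|t ht] := IH w d.+1 0 (isdep_child e1 hd) _ (leq0n _); first lia.
  exists (t.+1).+1; rewrite iterS iterSr [T (v, j)]/= lj e ht /T /= ltnn e1.
  by rewrite e2.
have [t1 h1] := next; have [||t2 h2] := IHk j.+1; [lia|lia|].
by exists (t2 + t1); rewrite iterD h1.
Qed.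

(** Induction on the depth: the tour goes to the parent, finishes the remaining candidates there by
    [tour_sub], and is then in the same situation one level higher. *)
Lemma tour_up d : forall v, isdep v d -> exists t, (iter t T (v, J)).1 = r.
Proof.
elim: d => [|d IH] v hd; first by exists 0; case: hd.
have [h1 h2] := hd.
case e: (fstep v) => [w|]; last first.
  case: (h2 0 isT) => /=; rewrite -h1.
  by elim: (d.+1) => //= n <-; rewrite /fnext e.
have fv : fnext v = w by rewrite /fnext e.
have hw : isdep w d.
  split; first by rewrite -h1 iterSr fv.
  by move=> i hi; have := h2 i.+1 hi; rewrite iterSr fv.
have [t1 ht1] := IH w hw.
have [t2 ht2] := @tour_sub #|V| w d (idx v).+1 hw (leq_addr _ _) (idxJ v).
exists (t1 + (t2 + 1)); rewrite !iterD [iter 1 _ _]/= ltnn e.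
by rewrite -[(_, _)]/(w, (idx v).+1) ht2.
Qed.

(** The states before the first visit to the root are pairwise distinct, since after a repetition
    the root would be reached sooner. So there are at most as many as pairs of a tree node and an
    index up to [J]. *)
Lemma tour_hit v : v \in tree r -> exists t,
  [/\ t <= #|tree r| * J.+1, (iter t T (v, J)).1 = r &
      forall i, i < t -> (iter i T (v, J)).1 <> r].
Proof.
move=> hv; have ex0 : exists i, iter i fnext v == r.
  by exists (findex fnext v r); rewrite iter_findex //; rewrite inE in hv.
have hd : isdep v (ex_minn ex0).
  case: ex_minnP => d /eqP h1 h2; split=> // i hi e.
  by have := h2 i; rewrite e eqxx => /(_ isT); lia.
have ex1 : exists t, (iter t T (v, J)).1 == r.
  by have [t e] := tour_up hd; exists t; rewrite e.
case: (ex_minnP ex1) => t /eqP h1 h2.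
have h3 i : i < t -> (iter i T (v, J)).1 <> r.
  by move=> hi e; have := h2 i; rewrite e eqxx => /(_ isT); lia.
exists t; split=> //.
have zJ i : (iter i T (v, J)).2 <= J.
  elim: i => //= i; case: (iter i T _) => v' j' /=; exact: tour_leJ.
have zT i : (iter i T (v, J)).1 \in tree r.
  by elim: i => // i IH; rewrite iterS; apply: tour_tree.
pose g (i : 'I_t) : V * 'I_J.+1 := ((iter i T (v, J)).1, inord (iter i T (v, J)).2).
have gi : injective g.
  suff H (i j : 'I_t) : i < j -> g i <> g j.
    move=> i j e; apply: val_inj => /=; case: (ltngtP i j) => // l.
      by case: (H _ _ l).
    by case: (H _ _ l).
  move=> l [e1 /(congr1 val)]; rewrite /= !inordK ?ltnS // => e2.
  have e : iter i T (v, J) = iter j T (v, J) by apply/eqP; rewrite -pair_eqE /= e1 e2 !eqxx.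
  apply: (h3 (t - j + i)); first by have := ltn_ord j; lia.
  by rewrite iterD e -iterD subnK ?h1 // ltnW.
have -> : #|tree r| * J.+1 = #|setX (tree r) [set: 'I_J.+1]| by rewrite cardsX cardsT card_ord.
rewrite -[X in X <= _](card_ord t) -(card_imset _ gi).
by apply: subset_leq_card; apply/subsetP => z /imsetP[i _ ->]; rewrite in_setX zT inE.
Qed.
End Root.
End Tour.

(** * Counting *)

(** A set of at most r elements is the set of entries of an r-tuple padded with [None]. *)
Lemma card_small_sets (T : finType) r :
  #|[set A : {set T} | #|A| <= r]| <= (#|T|.+1) ^ r.
Proof.
pose f (u : r.-tuple (option T)) := [set i | Some i \in (u : seq _)].
have -> : (#|T|.+1) ^ r = #|{: r.-tuple (option T)}| by rewrite card_tuple card_option.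
apply: leq_trans (leq_imset_card f predT).
apply: subset_leq_card; apply/subsetP => A; rewrite inE => hA.
have sz : size (map Some (enum A) ++ nseq (r - #|A|) None) == r.
  by rewrite size_cat size_map -cardE size_nseq subnKC.
apply/imsetP; exists (Tuple sz) => //; apply/setP => i; rewrite inE /= mem_cat.
rewrite mem_map; last by move=> ? ? [].
by rewrite mem_enum mem_nseq andbF orbF.
Qed.

Lemma hammingE N (t : N.-tuple bool) c :
  hamming t c = #|[set i : 'I_N | nth false t i != nth false c i]|.
Proof.
rewrite /hamming size_tuple -sum1_card big_mkcond /=.
by rewrite [RHS]big_mkcond; apply: eq_bigr => i _; rewrite inE; case: (_ != _).
Qed.

Lemma card_ball N (c : seq bool) r :
  #|[set t : N.-tuple bool | hamming t c <= r]| <= N.+1 ^ r.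
Proof.
pose D (t : N.-tuple bool) := [set i : 'I_N | nth false t i != nth false c i].
have Di : injective D.
  move=> t u /setP e; apply: eq_from_tnth => i; have := e i.
  by rewrite !inE -!tnth_nth; case: (tnth t i) (tnth u i) (nth false c i) => [] [] [].
rewrite -(card_imset _ Di).
have := card_small_sets 'I_N r; rewrite card_ord => /(leq_trans _); apply.
apply: subset_leq_card.
by apply/subsetP => _ /imsetP[t + ->]; rewrite !inE hammingE.
Qed.

Lemma fiber_bound (T U : finType) (f : T -> U) (A : {set T}) b :
  (forall y, #|[set x in A | f x == y]| <= b) -> #|A| <= #|f @: A| * b.
Proof.
move=> h; rewrite -sum1_card (partition_big f (mem (f @: A))) /=; last first.
  by move=> x xA; apply: imset_f.
rewrite -sum_nat_const; apply: leq_sum => y _; rewrite sum1_card.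
by apply: leq_trans (h y); apply: subset_leq_card; apply/subsetP => x; rewrite !inE.
Qed.

Section Count.
Variables (N S e : nat) (V : finType) (fstep : V -> option V).
Variables (root : N.-tuple bool -> V) (fc : N.-tuple bool -> seq bool).
Hypothesis cardV : #|V| = S * 2 ^ N.
Hypothesis rootT : forall t, fstep (root t) = None.
Hypothesis rootF : forall t u, root t = root u -> fc t = fc u.
Hypothesis avg : \sum_(t : N.-tuple bool) hamming t (fc t) <= e * 2 ^ N.

Lemma card_far : 4 * #|[set t : N.-tuple bool | 4 * e < hamming t (fc t)]| <= 2 ^ N.
Proof.
set F := [set t | _].
have h : (4 * e).+1 * #|F| <= e * 2 ^ N.
  apply: leq_trans avg; rewrite mulnC -sum_nat_const.
  rewrite [X in _ <= X](bigID (mem F)) /=; apply: leq_trans (leq_addr _ _).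
  by apply: leq_sum => t; rewrite inE.
(* For [e = 0] the inequality says that no string is far; otherwise [e] is cancelled. *)
case: (e) h => [|e'] h; first by move: h; rewrite /=; lia.
rewrite -(leq_pmul2l (ltn0Sn e')); apply: leq_trans h.
by rewrite mulnA leq_mul2r; apply/orP; right; lia.
Qed.

Variable Z : nat.
Hypothesis hZ : 4 * (N.+1 ^ (4 * e) * S) <= Z.
Hypothesis S0 : 0 < S.

(* Two strings with the same root are both near the same final tape, and the trees of
   distinct roots are disjoint. *)
Lemma card_bad : 2 * #|[set t : N.-tuple bool | Z < #|tree fstep (root t)|]| <= 2 ^ N.
Proof.
set Bad := [set t : N.-tuple bool | Z < _]; set F := [set t : N.-tuple bool | 4 * e < hamming t (fc t)].
pose A := Bad :\: F.
have hA : #|A| <= #|root @: A| * N.+1 ^ (4 * e).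
  apply: fiber_bound => y.
  case: (set_0Vmem [set x in A | root x == y]) => [->|[u]]; first by rewrite cards0.
  rewrite inE => /andP[_ /eqP uy]; apply: leq_trans (card_ball N (fc u) (4 * e)).
  apply: subset_leq_card; apply/subsetP => t; rewrite !inE => /andP[/andP[h _] /eqP ty].
  by rewrite (@rootF u t) ?uy ?ty // leqNgt.
have hR : #|root @: A| * Z <= S * 2 ^ N.
  rewrite -cardV -sum_nat_const.
  apply: (@leq_trans (\sum_(r in root @: A) #|tree fstep r|)).
    by apply: leq_sum => r /imsetP[t + ->]; rewrite !inE => /andP[_ /ltnW].
  have triv : trivIset [set tree fstep r | r in root @: A].
    apply/trivIsetP => _ _ /imsetP[r /imsetP[t _ ->] ->] /imsetP[r' /imsetP[t' _ ->] ->] ne.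
    rewrite -setI_eq0; apply: contraNT ne => /set0Pn[v]; rewrite inE => /andP[v1 v2].
    by apply/eqP; congr tree; apply: tree_root_uniq v1 v2.
  have inj : {in root @: A &, injective (tree fstep)}.
    move=> r r' /imsetP[t _ ->] /imsetP[t' _ ->] /setP /(_ (root t)).
    by rewrite !inE connect0 => /esym h; apply: (@tree_root_uniq _ fstep (root t)); rewrite ?inE ?connect0.
  rewrite -(big_imset (fun B : {set V} => #|B|) inj) /=.
  by rewrite (eqP triv); apply: max_card.
(* With Y the ball bound times S: 4 |A| Y <= |A| Z, and by [hA] and [hR] this is at most 2^N Y. *)
have hA4 : 4 * #|A| <= 2 ^ N.
  have Y0 : 0 < N.+1 ^ (4 * e) * S by rewrite muln_gt0 expn_gt0.
  have hZ' := hZ; set Y := N.+1 ^ (4 * e) * S in hZ' Y0.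
  rewrite -(leq_pmul2r Y0).
  apply: (@leq_trans (#|root @: A| * Z * N.+1 ^ (4 * e))).
    apply: (@leq_trans (#|A| * Z)); first by rewrite -mulnA mulnCA leq_mul2l hZ' orbT.
    by rewrite mulnAC leq_mul2r hA orbT.
  by rewrite /Y mulnC [X in _ <= X]mulnC -mulnA leq_mul2l hR orbT.
have hU : #|Bad| <= #|A| + #|F|.
  rewrite -(cardsID F Bad) addnC leq_add2l.
  by apply: subset_leq_card; apply: subsetIr.
have := card_far; rewrite -/F; lia.
Qed.
End Count.

Definition blk N (t : seq bool) b : N.-tuple bool := [tuple nth false t (b * N + i) | i < N].

Lemma nth_mktuple_nat N (f : nat -> bool) i : i < N ->
  nth false [tuple f j | j < N] i = f i.
Proof. by move=> h; rewrite -[i]/(val (Ordinal h)) nth_mktuple. Qed.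

Lemma nth_blk N t b i : i < N -> nth false (blk N t b) i = nth false t (b * N + i).
Proof. exact: (@nth_mktuple_nat N (fun i => nth false t (b * N + i))). Qed.

(** Independence of the blocks: cutting off the first one maps the strings injectively into pairs of
    a bad block and a shorter string of the same kind, and each bad block gains a factor 2. Cells
    beyond the last block are free. *)
Lemma card_all_blocks N (Bad : {set N.-tuple bool}) m T : m * N <= T -> 2 * #|Bad| <= 2 ^ N ->
  #|[set t : T.-tuple bool | [forall b : 'I_m, blk N t b \in Bad]]| * 2 ^ m <= 2 ^ T.
Proof.
move=> + hB; elim: m T => [|m IH] T hT.
  by rewrite muln1; apply: leq_trans (max_card _) _; rewrite card_tuple card_bool.
rewrite mulSn in hT.
set A := [set t | _].
pose tl (t : seq bool) := [tuple nth false t (N + i) | i < T - N].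
pose g (t : T.-tuple bool) := (blk N t 0, tl t).
have gi : injective g.
  move=> t u e; have e1 i : nth false (g t).1 i = nth false (g u).1 i by rewrite e.
  have e2 i : nth false (g t).2 i = nth false (g u).2 i by rewrite e.
  apply: val_inj; apply: (@eq_from_nth _ false); first by rewrite !size_tuple.
  move=> i; rewrite size_tuple => hi; case: (ltnP i N) => hN.
    by have := e1 i; rewrite !nth_blk.
  have := e2 (i - N); rewrite /= -!/(tl _) /tl.
  rewrite !(@nth_mktuple_nat _ (fun i => nth false _ (N + i))); try lia.
  by rewrite subnKC.
have hT' : m * N <= T - N by lia.
have sub : g @: A \subset setX Bad [set t : (T - N).-tuple bool | [forall b : 'I_m, blk N t b \in Bad]].
  apply/subsetP => _ /imsetP[t + ->]; rewrite inE => /forallP h; rewrite !inE /=.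
  rewrite (h ord0) /=; apply/forallP => b; have hb : b.+1 < m.+1 by rewrite ltnS.
  have := h (Ordinal hb); rewrite (_ : blk N t (Ordinal hb) = blk N (tl t) b) //.
  apply: eq_from_tnth => i; rewrite !tnth_mktuple.
  have hi : b * N + i < T - N.
    have : b.+1 * N <= m * N by rewrite leq_mul2r ltn_ord orbT.
    have := ltn_ord i; lia.
  rewrite /tl (@nth_mktuple_nat _ (fun i => nth false _ (N + i))) //.
  by congr nth; rewrite mulSn; lia.
have := subset_leq_card sub; rewrite card_imset // cardsX => h.
have eT : 2 ^ T = 2 ^ N * 2 ^ (T - N) by rewrite -expnD subnKC //; lia.
have h2 := leq_mul hB (IH _ hT'); rewrite eT; apply: leq_trans h2.
have ac p q r : p * q * (2 * r) <= 2 * p * (q * r) by rewrite mulnACA [p * 2]mulnC.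
by apply: leq_trans (leq_mul h (leqnn _)) _; rewrite expnS ac.
Qed.

(** * The configuration graph *)

Definition num (s : seq bool) : nat := foldr (fun (b : bool) a => b + 2 * a) 0 s.

Lemma num_lt s : num s < 2 ^ size s.
Proof. by elim: s => //= b s IH; rewrite expnS; case: b; lia. Qed.

Lemma num_bit s p : num s %/ 2 ^ p %% 2 = nth false s p.
Proof.
elim: s p => [|b s IH] p; first by rewrite nth_nil div0n.
case: p => [|p] /=; first by rewrite expn0 divn1 mulnC addnC modnMDl; case: b.
by rewrite expnS divnMA (_ : (b + 2 * num s) %/ 2 = num s) ?IH //; case: b; lia.
Qed.

(** The second conclusion makes the truncated subtraction in the first one exact. *)
Lemma num_wr s p b : p < size s ->
  num (wr s p b) = num s - nth false s p * 2 ^ p + b * 2 ^ p /\ nth false s p * 2 ^ p <= num s.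
Proof.
rewrite /wr => h; rewrite h; elim: s p h => // d s IH [|p] /= h.
  by rewrite expn0; case: d {h}; case: (b) => /=; split; lia.
have [h1 h2] := IH p h; rewrite h1 expnS; split; [|lia].
rewrite mulnDr mulnBr; move: h2; set u := nth false s p * 2 ^ p; set v := b * 2 ^ p.
have -> : nth false s p * (2 * 2 ^ p) = 2 * u by rewrite /u mulnCA.
have -> : b * (2 * 2 ^ p) = 2 * v by rewrite /v mulnCA.
by lia.
Qed.

Lemma num_inj s t : size s = size t -> num s = num t -> s = t.
Proof.
elim: s t => [|b s IH] [|d t] //= [e] h.
have bd : b = d by case: b d h => [] []; lia.
by rewrite bd in h *; rewrite (IH t) //; lia.
Qed.

Section Core.
Variable M : machine.

Definition nQ := #|state M|.
Definition st (q : nat) : state M := nth (start M) (enum (state M)) q.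
Definition qi (s : state M) : nat := index s (enum (state M)).

Lemma nQ_gt0 : 0 < nQ. Proof. by apply/card_gt0P; exists (start M). Qed.
Lemma qi_lt s : qi s < nQ. Proof. by rewrite /nQ cardE index_mem mem_enum. Qed.
Lemma qiK s : st (qi s) = s. Proof. by rewrite /st nth_index // mem_enum. Qed.

Definition symo (s : nat) : option bool :=
  match s with 0 => Some false | 1 => Some true | _ => None end.
Definition gi (q s w b : nat) := ((q * 3 + s) * 2 + w) * 2 + b.
Definition trn c : trans (state M) :=
  delta (st (c %/ 12)) (symo (c %/ 4 %% 3)) (c %/ 2 %% 2 == 1) (c %% 2 == 1).
(** The transition function as finite tables of numbers; 12 = 3 * 2 * 2 counts the input symbols,
    work bits and catalytic bits per state. *)
Definition tab (f : state M -> trans (state M) -> nat) :=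
  mkseq (fun c => f (st (c %/ 12)) (trn c)) (nQ * 12).

Lemma tabE f q s (w b : bool) : q < nQ -> s < 3 ->
  nth 0 (tab f) (gi q s w b) = f (st q) (delta (st q) (symo s) w b).
Proof.
move=> hq hs; rewrite nth_mkseq /gi /trn; last by case: w b => [] []; lia.
have -> : (((q * 3 + s) * 2 + w) * 2 + b) %/ 12 = q by case: w b => [] []; lia.
have -> : (((q * 3 + s) * 2 + w) * 2 + b) %/ 4 %% 3 = s by case: w b => [] []; lia.
have -> : ((((q * 3 + s) * 2 + w) * 2 + b) %/ 2 %% 2 == 1) = w by case: w b => [] []; lia.
by have -> : ((((q * 3 + s) * 2 + w) * 2 + b) %% 2 == 1) = b by case: w b => [] []; lia.
Qed.

(** Shifted by one, to be undone by a truncated subtraction, so that a left move at cell 0 stays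
    there. *)
Definition mvn m := match m with MLeft => 0 | MStay => 1 | MRight => 2 end.
(** Twice the factor by which a move changes a head stored as a power of two. A left move from 1
    yields 0 after halving, which [gV] raises to 1 again. *)
Definition mvp m := match m with MLeft => 1 | MStay => 2 | MRight => 4 end.

Definition tabQ := tab (fun _ t => qi (nq t)).
Definition tabW := tab (fun _ t => wbit t).
Definition tabC := tab (fun _ t => cbit t).
(* The runs are followed up to their first output or halting: 0 stands for a silent step,
   [b.+1] for the output of b and 3 for a halting state. *)
Definition tabO := tab (fun q t =>
  if halting q then 3 else if obit t is Some b then b.+1 else 0).
Definition tabI := tab (fun _ t => mvn (mi t)).
Definition tabP := tab (fun _ t => mvp (mw t)).
Definition tabH := tab (fun _ t => mvn (mc t)).

(* The configuration minus the catalytic tape is the mixed radix number with digits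
   state, input head, work tape contents, 2 ^ work head, catalytic head. *)
Definition code n W q i w p c := q + nQ * (i + n.+1 * (w + W * (p + W.+1 * c))).

Section Fun.
Variables (x : seq bool) (W PM N : nat).
Let n := size x.

Definition dq u := u %% nQ.
Definition di u := u %/ nQ %% n.+1.
Definition dw u := u %/ (nQ * n.+1) %% W.
Definition dp u := u %/ (nQ * n.+1 * W) %% W.+1.
Definition dh u := u %/ (nQ * n.+1 * W * W.+1) %% N.
(** With the work head stored as a power of two, reading and writing a work bit is plain arithmetic;
    expressions can raise only to constant exponents. *)
Definition bitw u := dw u %/ dp u %% 2.
Definition gidx u b := gi (dq u) (sym x (di u)) (bitw u) b.
Definition gO u b := nth 0 tabO (gidx u b).
Definition gB u b := nth 0 tabC (gidx u b).
(** Numbers below [nU] that encode no configuration are nodes as well. The remainder and the minima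
    keep even their successors in range, so the node set is a full product and easy to count. *)
Definition gV u b :=
  code n W (nth 0 tabQ (gidx u b))
    (minn n (di u + nth 0 tabI (gidx u b) - 1))
    ((dw u - bitw u * dp u + nth 0 tabW (gidx u b) * dp u) %% W)
    (minn PM (maxn 1 (dp u * nth 0 tabP (gidx u b) %/ 2)))
    (minn (N - 1) (dh u + nth 0 tabH (gidx u b) - 1)).
Definition nU := nQ * (n.+1 * (W * (W.+1 * N))).

Lemma code_lt q i w p c : q < nQ -> i <= n -> w < W -> p <= W -> c < N ->
  code n W q i w p c < nU.
Proof.
have mix a b A B : a < A -> b < B -> a + A * b < A * B.
  move=> h1 h2; have : A * b.+1 <= A * B by rewrite leq_mul2l h2 orbT.
  by rewrite mulnS; lia.
move=> hq hi hw hp hc; rewrite /code /nU.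
by have := mix _ _ _ _ hq (mix _ _ n.+1 _ hi (mix _ _ _ _ hw (mix _ _ W.+1 _ hp hc))).
Qed.

Lemma code_digits q i w p c : q < nQ -> i <= n -> w < W -> p <= W -> c < N ->
  [/\ dq (code n W q i w p c) = q, di (code n W q i w p c) = i,
      dw (code n W q i w p c) = w, dp (code n W q i w p c) = p
    & dh (code n W q i w p c) = c].
Proof.
have md a b A : a < A -> (a + A * b) %% A = a by move=> h; rewrite addnC mulnC modnMDl modn_small.
have dv a b A : a < A -> (a + A * b) %/ A = b.
  by move=> h; rewrite addnC mulnC divnMDl ?divn_small ?addn0 //; lia.
move=> hq hi hw hp hc; rewrite /dq /di /dw /dp /dh /code !divnMA.
by rewrite !(dv q) // !(dv i) // !(dv w) // !(dv p) // !md // modn_small.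
Qed.

Lemma gV_lt u b : 0 < W -> PM <= W -> 0 < N -> gV u b < nU.
Proof.
move=> W0 PW N0; apply: code_lt.
- case: (ltnP (gidx u b) (nQ * 12)) => h; last by rewrite nth_default ?size_mkseq ?nQ_gt0.
  by rewrite nth_mkseq // qi_lt.
- exact: geq_minl.
- by rewrite ltn_mod.
- by apply: leq_trans (geq_minl _ _) PW.
- by apply: leq_ltn_trans (geq_minl _ _) _; lia.
Qed.

Lemma dh_lt u : 0 < N -> dh u < N. Proof. by move=> h; rewrite ltn_mod. Qed.
End Fun.

Section Config.
Variables (x : seq bool) (wl N : nat).
Let n := size x.
Let W := 2 ^ wl.
Let PM := 2 ^ wl.-1.
Hypothesis N0 : 0 < N.

Definition encc (c : config M) : nat :=
  code n W (qi (cst c)) (ihead c) (num (work c)) (2 ^ whead c) (chead c).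

Definition cvalid (c : config M) :=
  [/\ ihead c <= n, size (work c) = wl, whead c <= wl.-1, size (Defs.cat c) = N
    & chead c < N].

Lemma cvalid_step c : cvalid c -> cvalid (step x c).
Proof.
move=> [h1 h2 h3 h4 h5]; rewrite /step; case: ifP => // _.
by split; rewrite /= ?size_wr ?h2 ?h4 ?geq_minr //; rewrite gtn_min prednK // leqnn orbT.
Qed.

Let digs c : cvalid c ->
  [/\ qi (cst c) < nQ, ihead c <= n, num (work c) < W, 2 ^ whead c <= W & chead c < N].
Proof.
move=> [h1 h2 h3 h4 h5]; split=> //; first exact: qi_lt.
  by rewrite /W -h2 num_lt.
by rewrite leq_exp2l //; lia.
Qed.

Lemma dh_encc c : cvalid c -> dh x W N (encc c) = chead c.
Proof. by move=> /digs[h1 h2 h3 h4 h5]; have [] := code_digits h1 h2 h3 h4 h5. Qed.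

Lemma encc_inj c c' : cvalid c -> cvalid c' -> encc c = encc c' ->
  Defs.cat c = Defs.cat c' -> out c = out c' -> c = c'.
Proof.
move=> v v' e ec eo; have [h1 h2 h3 h4 h5] := digs v; have [k1 k2 k3 k4 k5] := digs v'.
have [d1 d2 d3 d4 d5] := code_digits h1 h2 h3 h4 h5.
have [f1 f2 f3 f4 f5] := code_digits k1 k2 k3 k4 k5.
rewrite -/(encc c) e in d1 d2 d3 d4 d5; rewrite -/(encc c') in f1 f2 f3 f4 f5.
rewrite f1 in d1; rewrite f2 in d2; rewrite f3 in d3; rewrite f4 in d4; rewrite f5 in d5.
have [_ s1 _ _ _] := v; have [_ s2 _ _ _] := v'.
case: c c' {v v' h1 h2 h3 h4 h5 k1 k2 k3 k4 k5 f1 f2 f3 f4 f5 e} ec eo d1 d2 d3 d4 d5 s1 s2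
  => [q i w hw t hc o] [q' i' w' hw' t' hc' o'] /= -> -> d1 d2 d3 d4 d5 s1 s2.
rewrite -(qiK q) -d1 qiK d2 d5 (num_inj (etrans s1 (esym s2)) (esym d3)).
by congr Config; apply/eqP; rewrite -(eqn_exp2l _ _ (isT : 1 < 2)) d4.
Qed.

Lemma symoK i : symo (sym x i) = read_in x i.
Proof. by rewrite /sym; case: read_in => // -[]. Qed.

Lemma sym_lt i : sym x i < 3.
Proof. by rewrite /sym; case: read_in => // -[]. Qed.

Variable c : config M.
Hypothesis v : cvalid c.
Let b := nth false (Defs.cat c) (chead c).
Let t := delta (cst c) (read_in x (ihead c)) (nth false (work c) (whead c)) b.

Lemma bitw_encc : bitw x W (encc c) = nth false (work c) (whead c).
Proof.
have [h1 h2 h3 h4 h5] := digs v; have [_ _ d3 d4 _] := code_digits h1 h2 h3 h4 h5.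
by rewrite /bitw d3 d4 num_bit.
Qed.

Lemma tab_encc f : nth 0 (tab f) (gidx x W (encc c) b) = f (cst c) t.
Proof.
have [h1 h2 h3 h4 h5] := digs v; have [d1 d2 _ _ _] := code_digits h1 h2 h3 h4 h5.
by rewrite /gidx d1 d2 bitw_encc tabE ?sym_lt // qiK symoK.
Qed.

Lemma gO_encc : gO x W (encc c) b =
  if halting (cst c) then 3 else if obit t is Some d then d.+1 else 0.
Proof. exact: tab_encc. Qed.

Lemma gB_encc : gB x W (encc c) b = cbit t.
Proof. exact: tab_encc. Qed.

Lemma gV_encc : ~~ halting (cst c) -> gV x W PM N (encc c) b = encc (step x c).
Proof.
move=> /negbTE nh; rewrite /step nh -/b -/t /gV /encc /= !tab_encc bitw_encc -/(encc c).
have [h1 h2 h3 h4 h5] := digs v; have [d1 d2 d3 d4 d5] := code_digits h1 h2 h3 h4 h5.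
have [v1 v2 v3 v4 v5] := v.
rewrite d2 d3 d4 d5; congr code.
- by case: (mi t) => /=; lia.
- case: (ltnP (whead c) (size (work c))) => hw.
    have [-> _] := num_wr (wbit t) hw; rewrite modn_small //.
    have [e1 e2] := num_wr (wbit t) hw.
    rewrite -e1; apply: leq_trans (num_lt _) _; by rewrite size_wr v2.
  (* With an empty work tape [W] is 1 and the remainder discards the bit written. This is the case
     of the fallback machine. *)
  have e0 : wl = 0 by lia.
  by rewrite /W e0 modn1 /wr ltnNge hw /= (size0nil (etrans v2 e0)).
- have mp : forall k, 0 < 2 ^ k by move=> k; rewrite expn_gt0.
  have e : 2 ^ whead c <= PM by rewrite /PM leq_exp2l.
  case: (mw t) => /=; rewrite v2.
  + case: (whead c) e v3 => [|h] e v3; first by rewrite expn0 min0n expn0; have := mp wl.-1; rewrite -/PM; lia.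
    rewrite expnS (_ : 2 * 2 ^ h * 1 %/ 2 = 2 ^ h); last by rewrite muln1 mulKn.
    by rewrite /= (minn_idPl (_ : h <= wl.-1)); have := mp h; move: e; rewrite expnS; lia.
  + by rewrite mulnK // (minn_idPl v3); have := mp (whead c); lia.
  + rewrite (_ : 2 ^ whead c * 4 %/ 2 = 2 ^ (whead c).+1); last first.
      by rewrite expnS (_ : _ * 4 = 2 * (2 * 2 ^ whead c)) ?mulKn //; lia.
    rewrite (maxn_idPr _) //; case: (leqP (whead c).+1 wl.-1) => hh.
      by rewrite (minn_idPr _) // /PM leq_exp2l.
    by rewrite (minn_idPl _) // /PM leq_exp2l // ltnW.
- by rewrite v4; case: (mc t) => /=; lia.
Qed.
End Config.
End Core.

Section BlockMemory.
Variable N : nat.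

Definition upt (t : N.-tuple bool) h b : N.-tuple bool :=
  [tuple if i == h :> nat then b else nth false t i | i < N].

Lemma nth_upt t h b i : i < N -> nth false (upt t h b) i = if i == h then b else nth false t i.
Proof. exact: (@nth_mktuple_nat N (fun i => if i == h then b else nth false t i)). Qed.

Lemma upt_eq (t u : N.-tuple bool) : (forall i, i < N -> nth false t i = nth false u i) -> t = u.
Proof.
move=> h; apply: val_inj; apply: (@eq_from_nth _ false); first by rewrite !size_tuple.
by rewrite size_tuple.
Qed.

(** A simulation works inside a window of the memory, so the memory is described as the fixed [m0]
    with the contents of the window on top. *)
Definition bm (m0 : nat -> bool) base (t : N.-tuple bool) (p : nat) : bool :=
  if base <= p < base + N then nth false t (p - base) else m0 p.

Lemma bm_get m0 base (t : N.-tuple bool) h : h < N -> bm m0 base t (base + h) = nth false t h.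
Proof. by move=> hh; rewrite /bm leq_addr ltn_add2l hh /= addKn. Qed.

Lemma bm_upd m0 base (t : N.-tuple bool) h b : h < N -> upd (bm m0 base t) (base + h) b = bm m0 base (upt t h b).
Proof.
move=> hh; apply: functional_extensionality => p; rewrite /upd /bm.
case: eqP => [->|ne]; first by rewrite leq_addr ltn_add2l hh /= addKn nth_upt // eqxx.
case: ifP => // /andP[h1 h2]; rewrite nth_upt; last lia.
by case: eqP => //; lia.
Qed.

Lemma bm_id m0 base (t : N.-tuple bool) : (forall i, i < N -> nth false t i = m0 (base + i)) -> bm m0 base t = m0.
Proof.
move=> h; apply: functional_extensionality => p; rewrite /bm.
case: ifP => // /andP[h1 h2]; rewrite h; [congr m0|]; lia.
Qed.
End BlockMemory.

Section Graph.
Variables (M : machine) (x : seq bool) (W PM N : nat).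
Hypotheses (W0 : 0 < W) (PW : PM <= W) (N0 : 0 < N).
Let nU := nU M x W N.
Let dh := dh M x W N.
Let gO := gO M x W.
Let gB := gB M x W.
Let gV := gV M x W PM N.

Definition node := ('I_nU * N.-tuple bool)%type.

Definition gVo (u : nat) (b : nat) : 'I_nU := Ordinal (@gV_lt M x W PM N u b W0 PW N0).

Definition bitv (v : node) : bool := nth false v.2 (dh v.1).

(** The edges are the silent steps, so the terminal nodes are those that output or halt. *)
Definition fstep (v : node) : option node :=
  if gO v.1 (bitv v) == 0 then
    Some (gVo v.1 (bitv v), upt v.2 (dh v.1) (gB v.1 (bitv v) != 0))
  else None.

Definition candb (v : node) (p b : nat) : bool :=
  [&& gO p b == 0, gV p b == v.1 & (gB p b != 0) == nth false v.2 (dh p)].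

(** The tape before a step differs from the tape after it at most in the cell under the head of the
    predecessor, and the bit that stood there is part of the candidate index. *)
Definition cand (v : node) (c : nat) : option node :=
  if insub (c %/ 2) is Some p then
    if candb v (c %/ 2) (c %% 2) then Some (p : 'I_nU, upt v.2 (dh (c %/ 2)) (c %% 2 == 1))
    else None
  else None.

(* A predecessor is determined by its core configuration and by the bit that it scanned. *)
Definition idx (v : node) : nat := 2 * v.1 + bitv v.

Lemma idx_lt v : idx v < 2 * nU.
Proof. clear W0 PW N0; rewrite /idx; have := ltn_ord v.1; case: (bitv v); lia. Qed.

Lemma candP v c w : c < 2 * nU -> cand v c = Some w <-> fstep w = Some v /\ idx w = c.
Proof.
move=> hc; rewrite /cand; case: insubP => [p _ ep|]; last by rewrite -leqNgt; lia.
have hp : dh (c %/ 2) < N by apply: dh_lt.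
have cm : c = 2 * (c %/ 2) + c %% 2 by lia.
have cb : c %% 2 = (c %% 2 == 1) :> nat by case: eqP; lia.
split.
  case: ifP => // /and3P[/eqP h1 /eqP h2 /eqP h3] [<-].
  have eb : bitv (p, upt v.2 (dh (c %/ 2)) (c %% 2 == 1)) = (c %% 2 == 1).
    by rewrite /bitv /= ep nth_upt // eqxx.
  rewrite /fstep eb /= ep -cb h1 /=; split; last by rewrite /idx eb /= ep -cb -cm.
  congr Some; case: v h2 h3 {eb} => v t /= h2 h3; congr pair.
    by apply: val_inj; rewrite /= -h2.
  apply: upt_eq => i hi; rewrite !nth_upt // h3.
  by case: eqP => [->|].
case: w => u t [+ ei]; rewrite /fstep; case: ifP => // /eqP h1 [h2].
have eu : (u : nat) = c %/ 2 by move: ei; rewrite /idx /=; case: bitv; lia.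
have ebt : bitv (u, t) = (c %% 2 == 1) by move: ei; rewrite /idx /=; case: bitv; lia.
have hu : dh u < N by rewrite eu.
have ebn : nth false t (dh u) = (c %% 2 == 1) by rewrite -ebt.
rewrite -h2 /candb /= -eu nth_upt // eqxx.
move: h1; rewrite /= ebt -cb => h1; rewrite /= -/gO -/gB -/gV h1 !eqxx /=.
congr Some; congr pair; first by apply: val_inj; rewrite /= ep eu.
apply: upt_eq => i hi; rewrite !nth_upt //.
by case: eqP => [->|].
Qed.

End Graph.

(** * The tour program *)

Local Notation "# c" := (ECst c) (at level 2, format "# c").
Local Notation "$ v" := (EVar v) (at level 2, format "$ v").
Local Infix "+!" := EAdd (at level 50, left associativity).
Local Infix "-!" := ESub (at level 50, left associativity).
Local Infix "*!" := EMul (at level 40, left associativity).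
Local Infix "/!" := EDiv (at level 40, left associativity).
Local Infix "%!" := EMod (at level 40, left associativity).

(* Variables: 1 = input length, 2 = W, 3 = PM, 4 = N, 5 = base of the current block,
   6 = core configuration, 7 = index of the tour, 8 = its direction, 9 = result,
   10 = step counter, 11, 12 = scratch, 13 = answer, 14 = number of candidates, 15 = address. *)
Section Expressions.
Variable M : machine.

Definition eN1 := $1 +! #1.
Definition eQ u := u %! #(nQ M).
Definition eI u := u /! #(nQ M) %! eN1.
Definition eW u := u /! (#(nQ M) *! eN1) %! $2.
Definition eP u := u /! (#(nQ M) *! eN1 *! $2) %! ($2 +! #1).
Definition eH u := u /! (#(nQ M) *! eN1 *! $2 *! ($2 +! #1)) %! $4.
Definition eBit u := eW u /! eP u %! #2.
Definition eIdx u b := ((eQ u *! #3 +! EIn (eI u)) *! #2 +! eBit u) *! #2 +! b.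
Definition eO u b := ETab (tabO M) (eIdx u b).
Definition eB u b := ETab (tabC M) (eIdx u b).
Definition eV u b :=
  ETab (tabQ M) (eIdx u b) +! #(nQ M) *!
  (EMin $1 (eI u +! ETab (tabI M) (eIdx u b) -! #1) +! eN1 *!
  ((eW u -! eBit u *! eP u +! ETab (tabW M) (eIdx u b) *! eP u) %! $2 +! $2 *!
  (EMin $3 (EMax #1 (eP u *! ETab (tabP M) (eIdx u b) /! #2)) +! ($2 +! #1) *!
   EMin ($4 -! #1) (eH u +! ETab (tabH M) (eIdx u b) -! #1)))).
(** The only nonzero digit besides the state is the 1 = 2^0 for the work head on cell 0. *)
Definition eStart := #(qi (start M)) +! #(nQ M) *! (eN1 *! $2).
Definition eNU := #(nQ M) *! (eN1 *! ($2 *! (($2 +! #1) *! $4))).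
End Expressions.

Definition eEq a b := #1 -! ((a -! b) +! (b -! a)).
Definition eCell M u := EMem ($5 +! eH M u).

Lemma eval_eMax x g m a b : eval x g m (EMax a b) = maxn (eval x g m a) (eval x g m b). Proof. by rewrite maxnC maxnE. Qed.
Lemma eval_eEq x g m a b : eval x g m (eEq a b) = (eval x g m a == eval x g m b).
Proof. by rewrite /=; case: eqP => ?; lia. Qed.

Section Eval.
Variables (M : machine) (x : seq bool) (W PM N : nat) (g : nat -> nat) (m : nat -> bool).
Hypotheses (g1 : g 1 = size x) (g2 : g 2 = W) (g3 : g 3 = PM) (g4 : g 4 = N).
Local Notation ev := (eval x g m).

Lemma eval_eH u : ev (eH M u) = dh M x W N (ev u).
Proof. by rewrite /= g1 g2 g4 !addn1. Qed.

Lemma eval_eIdx u b : ev (eIdx M u b) = gidx M x W (ev u) (ev b).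
Proof. by rewrite /gidx /gi /bitw /dq /di /dw /dp /= g1 g2 !addn1. Qed.

Lemma eval_eO u b : ev (eO M u b) = gO M x W (ev u) (ev b).
Proof. by rewrite /gO -eval_eIdx. Qed.

Lemma eval_eB u b : ev (eB M u b) = gB M x W (ev u) (ev b).
Proof. by rewrite /gB -eval_eIdx. Qed.

Lemma eval_eV u b : ev (eV M u b) = gV M x W PM N (ev u) (ev b).
Proof.
rewrite /gV -eval_eIdx -eval_eH /code /eV; move: (eIdx M u b) (eH M u) => i h.
by rewrite /bitw /di /dw /dp !minnE maxnC maxnE /= g1 g2 g3 g4 !addn1.
Qed.

Lemma eval_eStart : ev (eStart M) = code M (size x) W (qi (start M)) 0 0 1 0.
Proof. by rewrite /code /= g1 g2 !muln0 ?addn0 ?muln1 ?add0n addn1. Qed.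

Lemma eval_eNU : ev (eNU M) = nU M x W N.
Proof. by rewrite /nU /= g1 g2 g4 !addn1. Qed.
End Eval.

Section Steps.
Variables (M : machine) (x : seq bool) (W PM N A : nat).
Hypotheses (W0 : 0 < W) (PW : PM <= W) (N0 : 0 < N).
Let nU := nU M x W N.
Let J := 2 * nU.
Hypothesis JA : J.+1 <= A.
Local Notation fs := (@fstep M x W PM N W0 PW N0).

Definition par (g : nat -> nat) :=
  [/\ g 0 = A, g 1 = size x, g 2 = W, g 3 = PM & g 4 = N].

Definition keep (l : seq nat) (g g' : nat -> nat) := forall r, r \notin l -> g' r = g r.

Lemma keep_par l g g' : keep l g g' -> all (leq 5) l -> par g -> par g'.
Proof.
clear W0 PW N0 JA J nU M; move=> k /allP h [h0 h1 h2 h3 h4].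
have nl r : r < 5 -> r \notin l by move=> hr; apply/negP => /h /=; lia.
by split; rewrite k ?nl.
Qed.

Lemma eval_eCell g m base m0 (t : N.-tuple bool) u : par g -> g 5 = base -> m = bm m0 base t ->
  eval x g m (eCell M u) = nth false t (dh M x W N (eval x g m u)).
Proof.
move=> [h0 h1 h2 h3 h4] h5 ->; rewrite /eCell.
rewrite -[LHS]/(nat_of_bool (bm m0 base t (g 5 + eval x g (bm m0 base t) (eH M u)))).
by rewrite (eval_eH _ _ h1 h2 h4) h5 bm_get // dh_lt.
Qed.

Opaque eO eB eV eH eEq eCell eNU eStart EMin.

(** The scanned bit is kept in variable 12 because its cell is overwritten before the next core is
    computed from it. *)
Definition hup := HSeq (HSet 12 (eCell M $6)) (HSeq (HWr ($5 +! eH M $6) (eB M $6 $12))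
  (HSet 6 (eV M $6 $12))).

Lemma hup_ok s m0 base (v w : node M x W N) : par (henv s) -> henv s 5 = base -> henv s 6 = v.1 ->
  hmem s = bm m0 base v.2 -> fs v = Some w ->
  let s' := den x hup s in
  [/\ henv s' 6 = w.1, hmem s' = bm m0 base w.2, hout s' = hout s &
      keep [:: 6; 12] (henv s) (henv s')].
Proof.
move=> P h5 h6 hm; rewrite /fstep; case: ifP => // /eqP h0 [<-] /=.
have [p0 p1 p2 p3 p4] := P.
rewrite (eval_eCell _ P h5 hm) /= h6 -/(bitv v).
set b := bitv v; have bA : minn (henv s 0) b = b by rewrite p0; case: (b); lia.
rewrite bA; set g := upd (henv s) 12 b.
have gP : par g by apply: keep_par P; [|exact: (isT : all (leq 5) [:: 12])]; move=> r;
   rewrite inE /g /upd => /negbTE ->.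
have [q0 q1 q2 q3 q4] := gP.
rewrite (eval_eV M _ q1 q2 q3 q4) (eval_eB M _ q1 q2) /= /g /upd /= -/g h6 p0.
rewrite (minn_idPr _); last first.
  have := @gV_lt M x W PM N v.1 b W0 PW N0; rewrite -/nU; lia.
split=> //.
  rewrite (eval_eH M _ q1 q2 q4) /= {1}/g /upd /= h6 h5 hm.
  by rewrite -bm_upd // dh_lt.
by move=> r; rewrite !inE => /norP[/negbTE h1 /negbTE h2]; rewrite h1 /g /upd h2.
Qed.
End Steps.

Section Programs.
Variables (M : machine).
Definition eCond := eEq (eO M ($11 /! #2) ($11 %! #2)) #0 *!
  eEq (eV M ($11 /! #2) ($11 %! #2)) $6 *!
  eEq (eB M ($11 /! #2) ($11 %! #2)) (eCell M ($11 /! #2)).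

(** Variable 8 selects the direction arithmetically. On the way up, the index of the node is saved
    in variable 11 before [hup] destroys the configuration that determines it. *)
Definition htour :=
  HIf ($14 -! $7)
   (HSeq (HSet 11 ($8 *! ($14 -! #1 -! $7) +! (#1 -! $8) *! $7))
     (HIf eCond
       (HSeq (HWr ($5 +! eH M ($11 /! #2)) ($11 %! #2))
         (HSeq (HSet 6 ($11 /! #2)) (HSet 7 #0)))
       (HSet 7 ($7 +! #1))))
   (HSeq (HSet 11 (#2 *! $6 +! eCell M $6))
     (HSeq (hup M) (HSet 7 ($8 *! ($14 -! $11) +! (#1 -! $8) *! ($11 +! #1))))).

(** Variable 9 is 0 until a terminal node is met and then disables all later rounds, so that a loop
    with a fixed number of rounds can stop early. *)
Definition hprobe (c : hcmd) :=
  HIf $9 HSkip (HSeq (HSet 9 (eO M $6 (eCell M $6))) (HIf $9 HSkip c)).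

(* The forward tour starts as if the subtree of the start node were already explored. Its
   length is kept in variable 10 in order to undo it. *)
Definition hblock (cut : expr) :=
  HSeq (HSet 6 (eStart M)) (HSeq (HSet 7 $14) (HSeq (HSet 8 #0) (HSeq (HSet 9 #0)
    (HSeq (HSet 10 #0) (HSeq (HFor cut (hprobe (HSeq htour (HSet 10 ($10 +! #1)))))
      (HSeq (HSet 8 #1) (HSeq (HSet 7 ($14 -! $7)) (HFor $10 htour)))))))).

Definition hrun (time : expr) :=
  HSeq (HSet 6 (eStart M)) (HSeq (HSet 9 #0) (HFor time (hprobe (hup M)))).
End Programs.

Opaque hup eO eB eV eH eEq eCell eNU eStart EMin.

Section Steps.
Variables (M : machine) (x : seq bool) (W PM N A : nat).
Hypotheses (W0 : 0 < W) (PW : PM <= W) (N0 : 0 < N).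
Let nU := nU M x W N.
Let J := 2 * nU.
Hypothesis JA : J.+1 <= A.
Hypothesis A3 : 3 <= A.
Local Notation fs := (@fstep M x W PM N W0 PW N0).
Local Notation cd := (@cand M x W PM N).
Local Notation ix := (@idx M x W N).
Local Notation par := (@par x W PM N A).
Local Notation node := (@node M x W N).
Local Notation T := (tour fs J cd ix).
Variables (m0 : nat -> bool) (base : nat).

Definition onode (v : node) (s : hst) :=
  [/\ par (henv s), henv s 5 = base, henv s 6 = v.1 & hmem s = bm m0 base v.2].

Definition otour (d : bool) (z : node * nat) (s : hst) :=
  [/\ onode z.1 s, henv s 14 = J, henv s 8 = d & henv s 7 = z.2].

Lemma eval_eCond g m (v : node) : par g -> g 5 = base -> g 6 = v.1 -> m = bm m0 base v.2 ->
  g 11 < J -> eval x g m (eCond M) = candb PM v (g 11 %/ 2) (g 11 %% 2).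
Proof.
move=> P h5 h6 hm hJ; have [p0 p1 p2 p3 p4] := P.
have eM a b : eval x g m (a *! b) = eval x g m a * eval x g m b by [].
rewrite /candb /eCond !eM !eval_eEq (eval_eO M _ p1 p2) (eval_eV M _ p1 p2 p3 p4) (eval_eB M _ p1 p2).
rewrite (eval_eCell M N0 _ P h5 hm) /= h6.
rewrite !mulnb -andbA; congr (nat_of_bool [&& _, _ & _]).
rewrite /gB; set i := gidx _ _ _ _ _.
have : nth 0 (tabC M) i <= 1.
  case: (ltnP i (nQ M * 12)) => hi; last by rewrite nth_default ?size_mkseq.
  by rewrite nth_mkseq //; case: cbit.
by case: (nth 0 _ i) => [|[|k]] //; case: (nth false _ _).
Qed.

Opaque eCond.

Lemma htour_ok s d z : otour d z s -> z.2 <= J -> z.2 < J \/ fs z.1 != None ->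
  let s' := den x (htour M) s in
  [/\ otour d (T d z) s', hout s' = hout s & keep [:: 6; 7; 11; 12] (henv s) (henv s')].
Proof.
case: z => v j [[P h5 h6 hm] h14 h8 h7]; cbn [fst snd] in * => hj hs.
have [p0 p1 p2 p3 p4] := P.
rewrite [den x _ _]/=; rewrite h14 h7.
case: (ltnP j J) => lj.
  rewrite (_ : (J - j != 0) = true); last lia.
  set c := (if d then J.-1 - j else j).
  have cJ : c < J by rewrite /c; case: (d); lia.
  rewrite (_ : minn (henv s 0) _ = c); last first.
    by rewrite p0 h8 /c; case: (d); rewrite ?mul1n ?subnn ?mul0n ?addn0 ?subn0 ?add0n ?mul1n; lia.
  set g := upd (henv s) 11 c.
  have gP : par g.
    apply: keep_par P; last exact: (isT : all (leq 5) [:: 11]).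
    by move=> r; rewrite inE /g /upd => /negbTE ->.
  have [q0 q1 q2 q3 q4] := gP.
  rewrite (@eval_eCond g _ v) //.
  have g11 : g 11 = c by rewrite /g /upd.
  rewrite g11 /= lj -/c /cand.
  case: insubP => [p _ ep|]; last by rewrite -leqNgt; lia.
  case hc: (candb _ _ _ _) => /=; last first.
    split; [split; [split| | |]|by []|]; rewrite /= ?h5 ?h6 //.
    - rewrite {1}/upd /= q0 [g 7]h7; lia.
    - by move=> r; rewrite !inE /g /upd => /norP[_ /norP[/negbTE -> /norP[/negbTE -> _]]].
  have e6 : minn (g 0) (c %/ 2) = p by rewrite ep q0; lia.
  rewrite e6 /=.
  split; [split; [split| | |]|by []|]; rewrite /= ?h5 ?h6 //.
  - rewrite (eval_eH M _ q1 q2 q4) /= g11 {1}/g /upd /= -/upd h5 hm.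
    rewrite [LHS](_ : _ = upd (bm m0 base v.2) (base + dh M x W N (c %/ 2)) (c %% 2 != 0)) //.
    rewrite bm_upd ?dh_lt //; congr bm; congr upt.
    by have := ltn_pmod c (isT : 0 < 2); case: (c %% 2) => [|[|]].
  - by move=> r; rewrite !inE /g /upd => /norP[/negbTE -> /norP[/negbTE -> /norP[/negbTE -> _]]].
have ej : j = J by lia.
case: hs => [|hs]; first by rewrite ej ltnn.
rewrite (_ : (J - j != 0) = false); last lia.
rewrite (eval_eCell M N0 _ P h5 hm) /= h6 -/(bitv v) -/(idx v).
have iJ : idx v < J by apply: idx_lt.
rewrite (_ : minn (henv s 0) (idx v) = idx v); last by rewrite p0; lia.
set g := upd (henv s) 11 _.
have kg : keep [:: 11] (henv s) g by move=> r; rewrite inE /g /upd => /negbTE ->.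
have gP : par g by apply: (keep_par kg _ P).
case e: (fs v) hs => [w|//] _.
have [||||H6 Hm Ho Hk] := @hup_ok M x W PM N A W0 PW N0 JA (Hst g (hmem s) (hout s)) m0 base v w gP.
all: rewrite /= ?(kg 5) ?(kg 6) //.
set s1 := den x (hup M) _ in H6 Hm Ho Hk *.
have {}Hk : keep [:: 6; 12] g (henv s1) := Hk.
have P1 : par (henv s1) by apply: (keep_par Hk _ gP).
have [r0 r1 r2 r3 r4] := P1.
rewrite r0 (Hk 8) // (Hk 14) // (Hk 11) // (kg 8) // (kg 14) // h14 h8.
have -> : g 11 = idx v by rewrite /g /upd.
rewrite ej ltnn.
split; [split; [split| | |]|by []|]; rewrite /= ?H6 ?Hm //.
- by rewrite /upd /=; case: (d); rewrite ?mul1n ?mul0n ?subnn ?subn0 ?mul1n; lia.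
- move=> r; rewrite !inE => /norP[n6 /norP[n7 /norP[n11 n12]]].
  by rewrite /upd (negbTE n7) Hk ?inE ?(negbTE n6) // kg // inE.
Qed.
End Steps.

Lemma keep_trans l g1 g2 g3 : keep l g1 g2 -> keep l g2 g3 -> keep l g1 g3.
Proof. by move=> h1 h2 r hr; rewrite h2 // h1. Qed.

Lemma keep_sub l l' g1 g2 : all (mem l') l -> keep l g1 g2 -> keep l' g1 g2.
Proof. by move=> /allP h k r hr; apply: k; apply: contra hr => /h. Qed.

Lemma keep_upd l g r v : r \in l -> keep l g (upd g r v).
Proof. by move=> h q hq; rewrite /upd; case: eqP => // e; rewrite e h in hq. Qed.

Lemma den_seq x a b s : den x (HSeq a b) s = den x b (den x a s). Proof. by []. Qed.

Lemma den_for x e c s : den x (HFor e c) s = iter (eval x (henv s) (hmem s) e) (den x c) s.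
Proof. by []. Qed.

Lemma den_if x e a b s : den x (HIf e a b) s =
  if eval x (henv s) (hmem s) e != 0 then den x a s else den x b s.
Proof. by []. Qed.

Lemma den_set x v e s k : eval x (henv s) (hmem s) e = k -> k <= henv s 0 ->
  den x (HSet v e) s = Hst (upd (henv s) v k) (hmem s) (hout s).
Proof. by move=> e1 e2; rewrite /= e1 (minn_idPr e2). Qed.

Lemma gO_le3 M x W u b : gO M x W u b <= 3.
Proof.
rewrite /gO; case: (ltnP (gidx M x W u b) (nQ M * 12)) => h; last by rewrite nth_default ?size_mkseq.
by rewrite nth_mkseq //; case: halting => //; case: obit => // -[].
Qed.

Opaque hup htour eO eB eV eH eEq eCell eNU eStart EMin.

Section Blocks.
Variables (M : machine) (x : seq bool) (W PM N A : nat).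
Hypotheses (W0 : 0 < W) (PW : PM <= W) (N0 : 0 < N).
Let nU := nU M x W N.
Let J := 2 * nU.
Hypothesis JA : J.+1 <= A.
Hypothesis A3 : 3 <= A.
Local Notation fs := (@fstep M x W PM N W0 PW N0).
Local Notation cd := (@cand M x W PM N).
Local Notation ix := (@idx M x W N).
Local Notation par := (@par x W PM N A).
Local Notation node := (@node M x W N).
Local Notation T := (tour fs J cd ix).
Local Notation candP' := (@candP M x W PM N W0 PW N0).
Variables (m0 : nat -> bool) (base : nat).
Local Notation onode := (@onode M x W PM N A m0 base).
Local Notation otour := (@otour M x W PM N A m0 base).
Let vars := [:: 6; 7; 8; 9; 10; 11; 12].

Lemma fs_None (v : node) : (fs v == None) = (gO M x W v.1 (bitv v) != 0).
Proof. by rewrite /fstep; case: (gO _ _ _ _ _ == 0). Qed.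

Lemma hprobe_ok c s v : onode v s ->
  let s1 := Hst (upd (henv s) 9 (gO M x W v.1 (bitv v))) (hmem s) (hout s) in
  den x (hprobe M c) s = if henv s 9 != 0 then s else
    if fs v == None then s1 else den x c s1.
Proof.
move=> [P h5 h6 hm]; have [p0 p1 p2 p3 p4] := P.
rewrite fs_None /= (eval_eO M _ p1 p2) (eval_eCell M N0 _ P h5 hm) /= h6 -/(bitv v).
rewrite (minn_idPr _); last by rewrite p0; apply: leq_trans (gO_le3 _ _ _ _ _) A3.
by rewrite /upd /=.
Qed.

Lemma otour_upd d z s r v : r \in [:: 9; 10] -> otour d z s ->
  otour d z (Hst (upd (henv s) r v) (hmem s) (hout s)).
Proof.
by rewrite !inE => /orP[/eqP->|/eqP->] [[P h5 h6 hm] h14 h8 h7].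
Qed.

Variables (t0 : N.-tuple bool) (u0 : 'I_nU) (cut : expr) (C : nat) (r : node).
Hypothesis u0E : u0 = code M (size x) W (qi (start M)) 0 0 1 0 :> nat.
Hypothesis cutE : forall g m, par g -> eval x g m cut = C.
Hypothesis CA : C <= A.
Let v0 : node := (u0, t0).
Hypothesis rT : fs r = None.
Hypothesis v0r : v0 \in tree fs r.
Let z i := iter i (T false) (v0, J).

Let zJ i : (z i).2 <= J.
Proof.
elim: i => [|i IH]; first exact: leqnn.
rewrite /z iterS -/(z i); case: (z i) IH => v j hj.
exact: (tour_leJ fs cd (@idx_lt M x W N) v hj).
Qed.

Let zT i : (z i).1 \in tree fs r.
Proof. by elim: i => // i IH; rewrite /z iterS; apply: (tour_tree candP' rT) => //; apply: zJ. Qed.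

(** The tour has made [k] steps in [i] rounds: one per round as long as nothing was found, and fewer
    once it rests at the root. *)
Definition fwd (g0 : nat -> nat) (o : seq bool) i s := exists k,
  [/\ k <= i, forall l, l < k -> fs (z l).1 != None, otour false (z k) s, henv s 10 = k &
   [/\ if henv s 9 == 0 then k = i else fs (z k).1 = None /\ henv s 9 = gO M x W r.1 (bitv r),
       hout s = o & keep vars g0 (henv s)]].

Lemma fwd_step g0 o i s : i < C -> fwd g0 o i s ->
  fwd g0 o i.+1 (den x (hprobe M (HSeq (htour M) (HSet 10 ($10 +! #1)))) s).
Proof.
move=> iC [k [ki hl ho h10 [h9 hout0 hk]]]; have [on _ _ _] := ho.
rewrite (hprobe_ok _ on); case e9: (henv s 9 == 0) h9 => /=; last first.
  by move=> h9; exists k; split=> //; [lia|rewrite e9; split].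
move=> ek; rewrite {}ek in hl ho h10 on *; case: ifP => hN.
  exists i; split; [by lia|exact: hl|exact: otour_upd|by []|split] => //.
    (* The tour never leaves the tree, and the root is its only terminal node. *)
    have er : (z i).1 = r by apply: (tree_term rT (eqP hN) (zT i)).
    rewrite [henv _ 9](_ : _ = gO M x W r.1 (bitv r)); last by rewrite /= /upd /= er.
    by have := fs_None r; rewrite rT eqxx => /esym /negbTE ->; split=> //; exact/eqP.
  by apply: keep_trans hk _; apply: keep_upd.
set s1 := Hst (upd (henv s) 9 _) (hmem s) (hout s).
have g0' : gO M x W (z i).1.1 (bitv (z i).1) = 0.
  by apply/eqP; move: (fs_None (z i).1); rewrite hN => /esym /negbFE.
have o1 : otour false (z i) s1 by exact: (@otour_upd false (z i) s 9 _ isT ho).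
have D : (z i).2 < J \/ fs (z i).1 != None by right; rewrite hN.
have [H1 H2 H3] := htour_ok JA A3 o1 (zJ i) D.
rewrite [den _ _ _]/=; set s2 := den x (htour M) s1 in H1 H2 H3 *.
have [[[p0 _ _ _ _] _ _ _] _ _ _] := H1.
have e10 : henv s2 10 = i by rewrite H3.
have -> : minn (henv s2 0) (henv s2 10 + 1) = i.+1 by rewrite p0 e10; lia.
exists i.+1; split; [by []| |exact: otour_upd|by []|split] => //.
- by move=> l; rewrite ltnS leq_eqVlt => /orP[/eqP->|/hl //]; rewrite hN.
- by rewrite /= {1}/upd /= H3 //= /upd /= g0'.
- by rewrite H2.
- apply: keep_trans hk _; apply: (@keep_trans _ _ (henv s1)); first exact: keep_upd.
  apply: (@keep_trans _ _ (henv s2)); last exact: keep_upd.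
  exact: keep_sub H3.
Qed.

Lemma bwd_step k s l : (forall i, i < k -> fs (z i).1 != None) -> l < k ->
  otour true ((z (k - l)).1, J - (z (k - l)).2) s ->
  let s' := den x (htour M) s in
  [/\ otour true ((z (k - l.+1)).1, J - (z (k - l.+1)).2) s', hout s' = hout s &
      keep [:: 6; 7; 11; 12] (henv s) (henv s')].
Proof.
move=> hl lk ho; set i := k - l.+1.
have ei : k - l = i.+1 by rewrite /i; lia.
rewrite ei in ho; have hi : fs (z i).1 != None by apply: hl; rewrite /i; lia.
have [zJ' inv] : (z i.+1).2 <= J /\
   T true ((z i.+1).1, J - (z i.+1).2) = ((z i).1, J - (z i).2).
  apply: (tour_inv (@idx_lt M x W N) candP' (zJ i) hi).
  by rewrite -[z i.+1]/(T false (z i)); case: (z i) => ? ?; case: (T _ _).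
(* At a terminal node the backward tour would be stuck; but by [inv] it moves on to the node of
   [z i], which is not terminal. *)
have D : J - (z i.+1).2 < J \/ fs (z i.+1).1 != None.
  case: (ltnP (J - (z i.+1).2) J) => h; [by left|right].
  apply/negP => /eqP hN; move: inv; rewrite /= ltnNge h /= hN => -[e _].
  by rewrite -e hN in hi.
have [H1 H2 H3] := htour_ok JA A3 ho (leq_subr _ _) D.
by rewrite inv in H1.
Qed.

(** The block is restored whether or not the budget [C] was sufficient, so a failed attempt does no
    damage and another block can be tried. *)
Lemma hblock_ok s : par (henv s) -> henv s 14 = J -> henv s 5 = base ->
  hmem s = bm m0 base t0 ->
  let s' := den x (hblock M cut) s in
  [/\ hmem s' = hmem s, hout s' = hout s, keep vars (henv s) (henv s'),
      henv s' 9 = 0 \/ henv s' 9 = gO M x W r.1 (bitv r)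
    & #|tree fs r| * J.+1 < C -> henv s' 9 != 0].
Proof.
move=> P h14 h5 hm; have [p0 p1 p2 p3 p4] := P.
rewrite /hblock 8!den_seq.
have uA : u0 <= A by have := ltn_ord u0; lia.
rewrite (@den_set x 6 _ s u0); [|by rewrite (eval_eStart M _ p1 p2) -u0E|by rewrite p0].
rewrite (@den_set x 7 $14 _ J); [|by rewrite /= /upd /= h14|by rewrite /upd /= p0; lia].
rewrite (@den_set x 8 #0 _ 0) // (@den_set x 9 #0 _ 0) // (@den_set x 10 #0 _ 0) //.
cbn [henv hmem hout].
set s5 := Hst _ _ _.
have e5 : henv s5 = upd (upd (upd (upd (upd (henv s) 6 u0) 7 J) 8 0) 9 0) 10 0 by [].
have P5 : par (henv s5) by rewrite e5.
have o5 : otour false (z 0) s5.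
  by split; rewrite ?e5 //; split; rewrite ?e5.
rewrite (den_for x cut) (cutE _ P5).
have F i : i <= C -> fwd (henv s) (hout s) i
   (iter i (den x (hprobe M (HSeq (htour M) (HSet 10 ($10 +! #1))))) s5).
  elim: i => [|i IH] hi.
    exists 0; split=> //; rewrite ?e5 //; split; rewrite ?e5 //.
    by do !(apply: keep_trans; last exact: keep_upd).
  by rewrite iterS; apply: fwd_step => //; apply: IH; lia.
have := F C (leqnn C); set s6 := iter _ _ _ => -[k [kC hl [on h14' h8 h7] h10 [h9 ho hk]]].
have [P6 h56 h66 hm6] := on; have [q0 q1 q2 q3 q4] := P6.
have hzJ := zJ k.
rewrite (@den_set x 8 #1 s6 1) ?q0 //; last by lia.
rewrite (@den_set x 7 ($14 -! $7) _ (J - (z k).2)); first last.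
- by rewrite /upd /= q0; lia.
- by rewrite /= /upd /= h14' h7.
cbn [henv hmem hout].
set g7 := upd _ 7 _.
have e7 : g7 = upd (upd (henv s6) 8 1) 7 (J - (z k).2) by [].
set s7 := Hst g7 _ _.
rewrite den_for (_ : eval x (henv s7) (hmem s7) $10 = k) //.
have o7 : otour true ((z (k - 0)).1, J - (z (k - 0)).2) s7.
  by rewrite subn0; split; rewrite /s7 /= ?e7 //; split; rewrite /= ?e7.
have Bk l : l <= k -> let s' := iter l (den x (htour M)) s7 in
   [/\ otour true ((z (k - l)).1, J - (z (k - l)).2) s', hout s' = hout s7 &
      keep [:: 6; 7; 11; 12] (henv s7) (henv s')].
  elim: l => [|l IH] hlk; first by split.
  have [H1 H2 H3] := IH (ltnW hlk); rewrite iterS.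
  have [K1 K2 K3] := bwd_step hl hlk H1.
  by split; rewrite ?K2 //; apply: keep_trans H3 K3.
have [[[P8 h58 h68 hm8] _ _ _] K2 K3] := Bk k (leqnn k).
set s8 := iter k _ _ in P8 h58 h68 hm8 K2 K3 *.
rewrite subnn /= -/v0 in hm8.
have e9 : henv s8 9 = henv s6 9 by rewrite K3 //= e7.
split.
- by rewrite hm8 hm.
- by rewrite K2 /= ho.
- apply: keep_trans hk _; apply: (@keep_trans _ _ (henv s7)); last exact: keep_sub K3.
  by rewrite /= e7; apply: keep_trans (keep_upd _ _ _) (keep_upd _ _ _).
- by rewrite e9; case: eqP h9 => [->|_ []]; [left|right].
(* A result 0 means that all [C] steps were made without meeting a terminal node, whereas the root
   of a small tree is hit earlier. *)
move=> hC; rewrite e9; apply/negP => e0; rewrite e0 in h9.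
have [t [tC er _]] := tour_hit (@idx_lt M x W N) candP' rT v0r.
have tk : t < k by rewrite h9; apply: leq_ltn_trans hC.
by have := hl t tk; rewrite -[(z t).1]/((iter t (T false) (v0, J)).1) er rT.
Qed.
End Blocks.

(** * Runs as paths in the graph *)

Lemma out_step M x (c : config M) : exists s, out (step x c) = out c ++ s.
Proof.
rewrite /step; case: ifP => _; first by exists [::]; rewrite cats0.
by rewrite /=; case: obit => [b|]; [exists [:: b]; rewrite cats1|exists [::]; rewrite cats0].
Qed.

Lemma out_run M x (c : config M) t : exists s, out (run x c t) = out c ++ s.
Proof.
elim: t => [|t [s IH]]; first by exists [::]; rewrite cats0.
have [s' e] := out_step x (run x c t).
by exists (s ++ s'); rewrite catA -IH -e.
Qed.

Lemma runS M x (c : config M) t : run x c t.+1 = run x (step x c) t.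
Proof. exact: iterSr. Qed.

Section Link.
Variables (M : machine) (x : seq bool) (wl N : nat).
Hypothesis N0 : 0 < N.
Let W := 2 ^ wl.
Let PM := 2 ^ wl.-1.
Hypotheses (W0 : 0 < W) (PW : PM <= W).
Local Notation fs := (@fstep M x W PM N W0 PW N0).
Local Notation node := (@node M x W N).
Local Notation fn := (fnext fs).

Definition isnode (v : node) (c : config M) :=
  [/\ v.1 = encc x wl c :> nat, v.2 = Defs.cat c :> seq bool, cvalid x wl N c & out c = [::]].

Lemma isnode_bit v c : isnode v c -> bitv v = nth false (Defs.cat c) (chead c).
Proof. by move=> [h1 h2 h3 _]; rewrite /bitv h1 h2 dh_encc. Qed.

Lemma isnode_inj v c c' : isnode v c -> isnode v c' -> c = c'.
Proof.
move=> [h1 h2 h3 h4] [k1 k2 k3 k4]; apply: (encc_inj N0 h3 k3); rewrite -?h1 -?h2 //.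
by rewrite h4 k4.
Qed.

Lemma isnode_step v c : isnode v c -> gO M x W v.1 (bitv v) = 0 ->
  exists2 w, fs v = Some w & isnode w (step x c).
Proof.
move=> iv; have eb := isnode_bit iv; have [h1 h2 h3 h4] := iv; rewrite eb h1 => g0.
have nh : ~~ halting (cst c) /\ obit (delta (cst c) (read_in x (ihead c))
   (nth false (work c) (whead c)) (nth false (Defs.cat c) (chead c))) = None.
  move: g0; rewrite (gO_encc N0 h3); case: halting => //.
  by case: obit.
have [nh1 nh2] := nh.
rewrite /fstep eb h1 g0 /=; eexists; first by [].
have hc : chead c < N by have [] := h3.
split.
- by rewrite /= (gV_encc N0 h3).
- apply: (@eq_from_nth _ false).
    by have [_ _ _ e _] := cvalid_step N0 h3; rewrite e size_tuple.
  move=> i; rewrite size_tuple => hi; rewrite nth_upt // dh_encc // (gB_encc N0 h3) h2.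
  rewrite /step (negbTE nh1) /= nth_wr; last by have [_ _ _ -> _] := h3.
  by case: eqP => // _; case: cbit.
- exact: cvalid_step.
- by rewrite /step (negbTE nh1) /= nh2.
Qed.

(** The output tape only grows, so the first bit written is the whole final output; a run that halts
    before writing would leave it empty. *)
Lemma run_output v c T b : isnode v c -> halting (cst (run x c T)) -> out (run x c T) = [:: b] ->
  exists t, [/\ t < T, forall i, i < t -> fs (iter i fn v) != None,
    fs (iter t fn v) = None, isnode (iter t fn v) (run x c t)
    & gO M x W (iter t fn v).1 (bitv (iter t fn v)) = b.+1].
Proof.
elim: T v c => [|T IH] v c iv; first by have [_ _ _ ->] := iv.
have eb := isnode_bit iv; have [h1 h2 h3 h4] := iv.
case: (boolP (halting (cst c))) => nh.
  by rewrite run_halted // h4.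
case g0: (gO M x W v.1 (bitv v) == 0).
  have [w fw iw] := isnode_step iv (eqP g0).
  rewrite runS => hT oT; have [t [h5 h6 h7 h8 h9]] := IH w (step x c) iw hT oT.
  have fv : fn v = w by rewrite /fnext fw.
  exists t.+1; rewrite iterSr fv runS; split=> //.
  by case=> [_|i hi]; rewrite ?iterSr ?fv /= ?fw //; apply: h6.
move=> hT oT; exists 0; split=> //=.
  by apply/eqP; rewrite fs_None g0.
move: (g0); rewrite eb h1 (gO_encc N0 h3) (negbTE nh).
case eo: (obit _) => [d|//] _.
have : out (step x c) = [:: d] by rewrite /step (negbTE nh) /= eo h4.
move: oT; rewrite runS; have [s ->] := out_run x (step x c) T.
by move=> + e; rewrite e => -[->].
Qed.

Lemma iter_fn_None v k t : (forall i, i < t -> fs (iter i fn v) != None) ->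
  fs (iter k fn v) = None -> t <= k.
Proof. by move=> h e; rewrite leqNgt; apply/negP => /h; rewrite e. Qed.

Variable A : nat.
Let J := 2 * nU M x W N.
Hypothesis JA : J.+1 <= A.
Hypothesis A3 : 3 <= A.
Variables (m0 : nat -> bool) (base : nat).
Local Notation par := (@par x W PM N A).
Local Notation onode := (@onode M x W PM N A m0 base).

Lemma onode_upd9 v s k : onode v s -> onode v (Hst (upd (henv s) 9 k) (hmem s) (hout s)).
Proof. by move=> [P h5 h6 hm]. Qed.

Opaque hup eO eB eV eH eEq eCell eNU eStart EMin.

(** A plain forward simulation is not undone: of the memory it is only known that nothing outside
    the window has changed. *)
Lemma hrun_ok s (v0 : node) time T t b : par (henv s) -> henv s 5 = base ->
  hmem s = bm m0 base v0.2 ->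
  v0.1 = code M (size x) W (qi (start M)) 0 0 1 0 :> nat ->
  (forall g m, par g -> eval x g m time = T) ->
  t < T -> (forall i, i < t -> fs (iter i fn v0) != None) ->
  fs (iter t fn v0) = None -> gO M x W (iter t fn v0).1 (bitv (iter t fn v0)) = b ->
  let s' := den x (hrun M time) s in
  [/\ henv s' 9 = b, hout s' = hout s, keep [:: 6; 9; 12] (henv s) (henv s')
    & exists t' : N.-tuple bool, hmem s' = bm m0 base t'].
Proof.
move=> P h5 hm u0 timeE tT hl hN hb; have [p0 p1 p2 p3 p4] := P.
rewrite /hrun 2!den_seq.
rewrite (@den_set x 6 (eStart M) s v0.1); first last.
- by rewrite p0; have := ltn_ord v0.1; move: JA; rewrite /J; lia.
- by rewrite (eval_eStart M _ p1 p2) -u0.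
rewrite (@den_set x 9 (ECst 0) _ 0) //; cbn [henv hmem hout].
set s2 := Hst _ _ _.
have e2 : henv s2 = upd (upd (henv s) 6 v0.1) 9 0 by [].
have P2 : par (henv s2) by rewrite e2.
rewrite (den_for x time) (timeE _ _ P2).
have o2 : onode v0 s2 by split; rewrite ?e2.
pose z i := iter i fn v0.
have F i : i <= T -> let s' := iter i (den x (hprobe M (hup M))) s2 in
   exists k, [/\ k <= i, k <= t, onode (z k) s',
     if henv s' 9 == 0 then k = i else k = t /\ henv s' 9 = b &
     hout s' = hout s /\ keep [:: 6; 9; 12] (henv s) (henv s')].
  elim: i => [|i IH] hi.
    exists 0; split=> //; split=> //.
    by do !(apply: keep_trans; last exact: keep_upd).
  rewrite iterS.
  have [k [ki kt on h9 [ho hk]]] := IH (ltnW hi).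
  set s3 := iter i _ s2 in on h9 ho hk *.
  rewrite (hprobe_ok W0 PW N0 A3 _ on); case e9: (henv s3 9 == 0) h9 => /=; last first.
    by move=> h9; exists k; rewrite e9; split=> //; lia.
  move=> ek; case: ifP => hNk.
    have kt' : k = t by have := iter_fn_None hl (eqP hNk); lia.
    exists k; split=> //; first lia.
    - rewrite [henv _ 9](_ : _ = b); last by rewrite /= /upd /= kt'.
      by have := fs_None W0 PW N0 (z t); rewrite hN eqxx hb => /esym /negbTE ->.
    - by split=> //; apply: keep_trans hk _; apply: keep_upd.
  have lt : k < t.
    by rewrite ltn_neqAle kt andbT; apply/eqP => e; move: hNk; rewrite /z e hN.
  have g0 : gO M x W (z k).1 (bitv (z k)) = 0.
    by apply/eqP; move: (fs_None W0 PW N0 (z k)); rewrite hNk => /esym /negbFE.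
  case ew: (fs (z k)) hNk => [w|//] _.
  set s4 := Hst _ _ _.
  have [Q q5 q6 qm] : onode (z k) s4 by apply: onode_upd9.
  have [H6 Hm Ho Hk] := hup_ok JA Q q5 q6 qm ew.
  have zk : z k.+1 = w by rewrite /z iterS -/(z k) /fnext ew.
  exists k.+1; split; [by lia|by []| | |].
  - by rewrite zk; split; [exact: (keep_par Hk _ Q)|rewrite Hk|exact: H6|exact: Hm].
  - by rewrite Hk //= /upd /= g0 ek.
  - split; first by rewrite Ho.
    apply: keep_trans hk _; apply: (@keep_trans _ _ (henv s4)); first exact: keep_upd.
    exact: keep_sub Hk.
have := F T (leqnn T); set s' := iter _ _ _ => -[k [_ kt [_ _ _ hm'] h9 [ho hk]]].
split=> //; last by exists (z k).2.
by case: eqP h9 => [_ ek|_ []//]; lia.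
Qed.
End Link.

(** * The main programs *)

(** The language has no logarithm: variable 2 is doubled as long as it is at most n, and ends as the
    least power of 2 above n. *)
Definition hlog := HIf ($1 +! #1 -! $2) (HSet 2 ($2 +! $2)) HSkip.

Definition hsetup M k :=
  HSeq (HSet 2 #1) (HSeq (HFor ($1 +! #1) hlog)
  (HSeq (HSet 2 (epow $2 k)) (HSeq (HSet 3 (EMax #1 ($2 /! #2)))
  (HSeq (HSet 4 (epow $1 k)) (HSet 14 (#2 *! eNU M)))))).

Definition epoly k := epow $1 k +! #k.

(** Variable 9 holds the answer plus one, hence the subtraction in the output. *)
Definition hmain1 M k := HSeq (hsetup M k) (HSeq (hrun M (epoly k)) (HOut ($9 -! #1))).

(** The machine to be run has no work tape, so the radix and the head bound in variables 2 and 3 are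
    1, and its catalytic tape is the first stretch of the real one, cleared beforehand. *)
Definition hfall M kp :=
  HSeq (HSet 15 #0) (HSeq (HFor (epoly kp) (HSeq (HWr $15 #0) (HSet 15 ($15 +! #1))))
  (HSeq (HSet 2 #1) (HSeq (HSet 3 #1) (HSeq (HSet 4 (epoly kp)) (HSeq (HSet 5 #0)
  (HSeq (hrun M (epoly kp)) (HSet 13 $9))))))).

(** There are as many blocks as cells that the fallback may damage, so the chance of a fallback,
    halved by every block, outweighs its cost. *)
Definition hmain2 M M' k c kp :=
  HSeq (hsetup M k)
  (HSeq (HFor (epoly kp) (HIf $13 HSkip
     (HSeq (hblock M (epow $1 c)) (HSeq (HSet 13 $9) (HSet 5 ($5 +! $4))))))
  (HSeq (HIf $13 HSkip (hfall M' kp)) (HOut ($13 -! #1)))).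

Lemma hwf_main1 M k : hwf 16 (hmain1 M k).
Proof. by rewrite /hmain1 /= !evars_epow. Qed.

Lemma hwf_main2 M M' k c kp : hwf 16 (hmain2 M M' k c kp).
Proof. by rewrite /hmain2 /= !evars_epow. Qed.

Section Setup.
Variables (M : machine) (x : seq bool) (k A : nat).
Let n := size x.
Let l := logn2 n.
Let W := 2 ^ (k * l).
Let PM := 2 ^ (k * l).-1.
Let N := n ^ k.
Hypothesis n1 : 1 < n.
Hypotheses (nA : 2 * n <= A) (WA : W <= A) (NA : N <= A) (JA : 2 * nU M x W N <= A).

Opaque eNU EMax epow.

Lemma hlog_ok s i : henv s 0 = A -> henv s 1 = n -> henv s 2 = 2 ^ minn i l ->
  den x hlog s = Hst (upd (henv s) 2 (2 ^ minn i.+1 l)) (hmem s) (hout s).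
Proof.
have tl := trunc_log_bounds (isT : 1 < 2) (ltnW n1).
move=> h0 h1 h2; rewrite /hlog den_if.
rewrite (_ : eval _ _ _ _ = n + 1 - 2 ^ minn i l); last by rewrite /= h1 h2.
case: (ltnP i l) => hi.
  have e : 2 ^ i <= n.
    have /andP[le _] := tl; apply: leq_trans le; rewrite leq_exp2l //.
  rewrite (_ : (n + 1 - 2 ^ i != 0) = true); last lia.
  apply: den_set => /=; first by rewrite h2 (minn_idPl (ltnW hi)) addnn -mul2n -expnS (minn_idPl hi).
  by rewrite (minn_idPl hi) expnS h0; lia.
have e : n < 2 ^ l by have /andP[_] := tl.
rewrite (_ : (n + 1 - 2 ^ l != 0) = false); last lia.
rewrite (minn_idPr (_ : l <= i.+1)) ?leqW // (_ : upd _ _ _ = henv s); first by case: (s).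
apply: functional_extensionality => r; rewrite /upd; case: eqP => // ->.
by rewrite h2 (minn_idPr hi).
Qed.

Opaque hlog.

Lemma hsetup_ok s : henv s 0 = A -> henv s 1 = n ->
  let s' := den x (hsetup M k) s in
  [/\ par x W PM N A (henv s'), henv s' 14 = 2 * nU M x W N,
      keep [:: 2; 3; 4; 14] (henv s) (henv s'), hmem s' = hmem s & hout s' = hout s].
Proof.
move=> h0 h1; rewrite /hsetup 5!den_seq.
have A1 : 1 <= A by lia.
rewrite (@den_set x 2 #1 s 1) ?h0 //.
rewrite (den_for x ($1 +! #1)); cbn [henv hmem hout].
rewrite (_ : eval _ _ _ ($1 +! #1) = n.+1); last by rewrite /= /upd /= h1 addn1.
have F i : iter i (den x hlog) (Hst (upd (henv s) 2 1) (hmem s) (hout s)) =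
    Hst (upd (henv s) 2 (2 ^ minn i l)) (hmem s) (hout s).
  elim: i => [|i IH]; first by rewrite min0n.
  rewrite iterS IH (@hlog_ok _ i) //; congr Hst.
  by apply: functional_extensionality => r; rewrite /upd /=; case: eqP.
rewrite F (minn_idPr (_ : l <= n.+1)); last exact: logn2_le.
set s2 := Hst _ _ _.
have e2 : (2 ^ l) ^ k = W by rewrite -expnM mulnC.
rewrite (@den_set x 2 (epow $2 k) s2 W); first last.
- by rewrite ?/s5 ?/s4 ?/s3 /s2 /upd /= h0.
- by rewrite eval_epow.
cbn [henv hmem hout].
set s3 := Hst _ _ _.
(* The maximum with 1 is for an empty work tape, whose head rests at 2^0. *)
have ePM : maxn 1 (W %/ 2) = PM.
  rewrite /W /PM; case: (k * l) => [|j]; first by [].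
  by rewrite expnS mulKn //= (maxn_idPr _) // expn_gt0.
rewrite (@den_set x 3 (EMax #1 ($2 /! #2)) s3 PM); first last.
- by rewrite ?/s5 ?/s4 ?/s3 /s2 /upd /= h0; apply: leq_trans WA; rewrite /PM /W leq_exp2l // leq_pred.
- by rewrite eval_eMax ?/s3 /upd /= ePM.
cbn [henv hmem hout]; set s4 := Hst _ _ _.
rewrite (@den_set x 4 (epow $1 k) s4 N); first last.
- by rewrite ?/s5 ?/s4 ?/s3 /s2 /upd /= h0.
- by rewrite eval_epow /s4 /s3 /s2 /upd /= h1.
cbn [henv hmem hout]; set s5 := Hst _ _ _.
rewrite (@den_set x 14 (#2 *! eNU M) s5 (2 * nU M x W N)); first last.
- by rewrite ?/s5 ?/s4 ?/s3 /s2 /upd /= h0.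
- by rewrite -(@eval_eNU M x W N (henv s5) (hmem s5)).
split=> //.
by do !(apply: keep_trans; last exact: keep_upd).
Qed.
End Setup.

Opaque hsetup hrun hblock hfall epow epoly.

Lemma eval_epoly x g m k : g 1 = size x -> eval x g m (epoly k) = size x ^ k + k.
Proof. by move=> h; rewrite -h -(eval_epow x g m (EVar 1)). Qed.

Definition outputs M x wl N (W0 : 0 < 2 ^ wl) (PW : 2 ^ wl.-1 <= 2 ^ wl) (N0 : 0 < N)
    (v : node M x (2 ^ wl) N) T (b : bool) :=
  let fs := @fstep M x (2 ^ wl) (2 ^ wl.-1) N W0 PW N0 in
  exists t, [/\ t < T, forall i, i < t -> fs (iter i (fnext fs) v) != None,
    fs (iter t (fnext fs) v) = None
    & gO M x (2 ^ wl) (iter t (fnext fs) v).1 (bitv (iter t (fnext fs) v)) = b.+1].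

Definition start_code M (x : seq bool) wl := code M (size x) (2 ^ wl) (qi (start M)) 0 0 1 0.

Lemma pw_le wl : 2 ^ wl.-1 <= 2 ^ wl. Proof. by rewrite leq_exp2l // leq_pred. Qed.
Lemma p2_gt0 wl : 0 < 2 ^ wl. Proof. by rewrite expn_gt0. Qed.

Section Fallback.
Variables (M : machine) (x : seq bool) (k A : nat) (b : bool).
Let n := size x.
Let PT := n ^ k + k.
Hypothesis N0 : 0 < PT.
Hypotheses (A3 : 3 <= A) (PA : PT <= A) (JA : (2 * nU M x (2 ^ 0) PT).+1 <= A).
Variable v0 : node M x (2 ^ 0) PT.
Hypothesis v0E : v0.1 = start_code M x 0 :> nat.
Hypothesis v0z : v0.2 = nseq PT false :> seq bool.
Hypothesis Hout : outputs (p2_gt0 0) (pw_le 0) N0 v0 PT b.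

Transparent hfall.

Lemma hfall_ok s : henv s 0 = A -> henv s 1 = n ->
  let s' := den x (hfall M k) s in
  [/\ henv s' 13 = b.+1, hout s' = hout s & forall p, PT <= p -> hmem s' p = hmem s p].
Proof.
move=> h0 h1; rewrite /hfall 7!den_seq.
rewrite (@den_set x 15 #0 s 0) // (den_for x (epoly k)); cbn [henv hmem hout].
rewrite (_ : eval _ _ _ (epoly k) = PT); last by rewrite eval_epoly.
have F i : i <= PT -> iter i (den x (HSeq (HWr $15 #0) (HSet 15 ($15 +! #1))))
     (Hst (upd (henv s) 15 0) (hmem s) (hout s)) =
    Hst (upd (henv s) 15 i) (fun p => if p < i then false else hmem s p) (hout s).
  elim: i => [|i IH] hi //; rewrite iterS IH ?(ltnW hi) // den_seq.
  rewrite (_ : den x (HWr _ _) _ = Hst (upd (henv s) 15 i)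
     (upd (fun p => if p < i then false else hmem s p) i false) (hout s)) //.
  rewrite (@den_set x 15 ($15 +! #1) _ i.+1); first last.
  - by rewrite /= /upd /= h0; lia.
  - by rewrite /= /upd /= addn1.
  congr Hst; apply: functional_extensionality => p; rewrite /= /upd.
    by case: eqP.
  by rewrite ltnS; case: (ltngtP p i).
rewrite F //; set s1 := Hst _ _ _.
rewrite (@den_set x 2 #1 s1 1) // ?[henv s1 0]h0; last lia.
rewrite (@den_set x 3 #1 _ 1) //; last by rewrite /= /upd /= h0; lia.
rewrite (@den_set x 4 (epoly k) _ PT); first last.
- by rewrite /= /upd /= h0.
- by rewrite eval_epoly // /= /upd /= h1.
rewrite (@den_set x 5 #0 _ 0) //; cbn [henv hmem hout].
set s5 := Hst _ _ _.
have P5 : par x (2 ^ 0) (2 ^ 0.-1) PT A (henv s5) by split.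
have m5 : hmem s5 = bm (hmem s5) 0 v0.2.
  rewrite bm_id // => i hi; rewrite v0z nth_nseq hi.
  by rewrite /s5 /s1 /= add0n hi.
have [t [tT hl hN hb]] := Hout.
have tE g m : par x (2 ^ 0) (2 ^ 0.-1) PT A g -> eval x g m (epoly k) = PT.
  by move=> [_ g1 _ _ _]; rewrite eval_epoly.
have [H9 Ho Hk [t' Hm]] := hrun_ok JA A3 P5 (erefl _) m5 v0E tE tT hl hN hb.
set s6 := den x _ s5 in H9 Ho Hk Hm *.
have A2 : b.+1 <= henv s6 0 by rewrite Hk //= /upd /= h0; case: (b); lia.
rewrite (@den_set x 13 $9 s6 b.+1) //; split=> //.
move=> p hp; rewrite [LHS]/= Hm /bm add0n ltnNge hp andbF [LHS]/=.
by rewrite ltnNge hp.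
Qed.
End Fallback.

Section Main1.
Variables (M : machine) (x : seq bool) (k A : nat) (b : bool).
Let n := size x.
Let wl := k * logn2 n.
Let N := n ^ k.
Hypotheses (n1 : 1 < n) (N0 : 0 < N).
Hypotheses (A3 : 3 <= A) (nA : 2 * n <= A) (WA : 2 ^ wl <= A) (NA : N <= A)
  (JA : (2 * nU M x (2 ^ wl) N).+1 <= A).
Variable v0 : node M x (2 ^ wl) N.
Hypothesis v0E : v0.1 = start_code M x wl :> nat.
Hypothesis v0z : forall i, nth false v0.2 i = false.
Hypothesis Hout : outputs (p2_gt0 wl) (pw_le wl) N0 v0 (n ^ k + k) b.

Lemma hmain1_ok s : henv s 0 = A -> henv s 1 = n -> henv s 5 = 0 ->
  (forall p, hmem s p = false) -> hout s = [::] -> hout (den x (hmain1 M k) s) = [:: b].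
Proof.
move=> h0 h1 h5 hm ho; rewrite /hmain1 2!den_seq.
have [P h14 hk hm1 ho1] := hsetup_ok n1 nA WA NA (ltnW JA) h0 h1.
set s1 := den x (hsetup M k) s in P h14 hk hm1 ho1 *.
have m1 : hmem s1 = bm (hmem s1) 0 v0.2.
  by rewrite bm_id // => i hi; rewrite v0z hm1 hm.
have [t [tT hl hN hb]] := Hout.
have tE g m : par x (2 ^ wl) (2 ^ wl.-1) N A g -> eval x g m (epoly k) = n ^ k + k.
  by move=> [_ g1 _ _ _]; rewrite eval_epoly.
have h51 : henv s1 5 = 0 by rewrite hk.
have [H9 Ho Hk [t' Hm]] := hrun_ok JA A3 P h51 m1 v0E tE tT hl hN hb.
by rewrite /= H9 Ho ho1 ho; case: (b).
Qed.
End Main1.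

Section Main2.
Variables (M M' : machine) (x : seq bool) (k c kp A : nat) (b : bool).
Let n := size x.
Let wl := k * logn2 n.
Let N := n ^ k.
Let PT := n ^ kp + kp.
Hypotheses (n1 : 1 < n) (N0 : 0 < N) (P0 : 0 < PT).
Let J := 2 * nU M x (2 ^ wl) N.
Hypotheses (A3 : 3 <= A) (nA : 2 * n <= A) (WA : 2 ^ wl <= A) (NA : N <= A) (JA : J.+1 <= A).
Hypotheses (PA : PT * N <= A) (PA' : PT <= A) (JA' : (2 * nU M' x (2 ^ 0) PT).+1 <= A) (CA : n ^ c <= A).

Variable v0' : node M' x (2 ^ 0) PT.
Hypothesis v0E' : v0'.1 = start_code M' x 0 :> nat.
Hypothesis v0z' : v0'.2 = nseq PT false :> seq bool.
Hypothesis Hout' : outputs (p2_gt0 0) (pw_le 0) P0 v0' PT b.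

Local Notation fs := (@fstep M x (2 ^ wl) (2 ^ wl.-1) N (p2_gt0 wl) (pw_le wl) N0).
Variables (u0 : 'I_(nU M x (2 ^ wl) N)) (root : N.-tuple bool -> node M x (2 ^ wl) N).
Hypothesis u0E : u0 = start_code M x wl :> nat.
Hypothesis rootT : forall t, fs (root t) = None.
Hypothesis rootR : forall t, (u0, t) \in tree fs (root t).
Hypothesis rootO : forall t, gO M x (2 ^ wl) (root t).1 (bitv (root t)) = b.+1.

Definition mblk (m : nat -> bool) i : N.-tuple bool := [tuple m (i * N + j) | j < N].

Lemma hmain2_ok s : henv s 0 = A -> henv s 1 = n -> henv s 5 = 0 -> henv s 13 = 0 -> hout s = [::] ->
  let s' := den x (hmain2 M M' k c kp) s in
  [/\ hout s' = [:: b], forall p, PT <= p -> hmem s' p = hmem s p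
    & (exists2 i, i < PT & #|tree fs (root (mblk (hmem s) i))| * J.+1 < n ^ c) -> hmem s' = hmem s].
Proof.
move=> h0 h1 h5 h13 ho; rewrite /hmain2 3!den_seq.
have [P h14 hk hm1 ho1] := hsetup_ok n1 nA WA NA (ltnW JA) h0 h1.
set s1 := den x (hsetup M k) s in P h14 hk hm1 ho1 *.
have [p0 p1 p2 p3 p4] := P.
rewrite (den_for x (epoly kp)) eval_epoly // -/PT.
set body := HIf _ _ (HSeq _ _).
have F i : i <= PT -> let s' := iter i (den x body) s1 in
  [/\ par x (2 ^ wl) (2 ^ wl.-1) N A (henv s'), henv s' 14 = J, hmem s' = hmem s, hout s' = [::] &
      (henv s' 13 = 0 /\ henv s' 5 = i * N /\
        (forall j, j < i -> n ^ c <= #|tree fs (root (mblk (hmem s) j))| * J.+1))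
      \/ henv s' 13 = b.+1].
  elim: i => [|i IH] hi.
    split; rewrite ?hm1 ?ho1 //; left; split; first by rewrite hk.
    by rewrite [henv _ 5]hk.
  have [Q q14 qm qo q13] := IH (ltnW hi).
  rewrite iterS; set s2 := iter i _ s1 in Q q14 qm qo q13 *.
  rewrite /body den_if; case: q13 => [[e13 [e5 ej]]|e13]; last first.
    by rewrite [eval _ _ _ _]/= e13; split=> //; right.
  rewrite [eval _ _ _ _]/= e13 [_ != _]/= 2!den_seq.
  have m2 : hmem s2 = bm (hmem s) (i * N) (mblk (hmem s) i).
    by rewrite qm bm_id // => j hj; rewrite (nth_mktuple_nat (fun j => hmem s (i * N + j))).
  have cE g m : par x (2 ^ wl) (2 ^ wl.-1) N A g -> eval x g m (epow $1 c) = n ^ c.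
    by move=> [_ g1 _ _ _]; rewrite eval_epow /= g1.
  have [Hm Ho Hk H9 HC] := hblock_ok JA A3 u0E cE CA (rootT _) (rootR _) Q q14 e5 m2.
  rewrite rootO in H9.
  set s3 := den x (hblock M _) s2 in Hm Ho Hk H9 HC *.
  have Q3 : par x (2 ^ wl) (2 ^ wl.-1) N A (henv s3) by apply: (keep_par Hk _ Q).
  have [r0 r1 r2 r3 r4] := Q3.
  have b9 : henv s3 9 <= henv s3 0 by rewrite r0; case: H9 => ->; case: (b); lia.
  have e53 : henv s3 5 = i * N by rewrite Hk.
  rewrite (@den_set x 13 $9 s3 (henv s3 9)) // (@den_set x 5 _ _ (i.+1 * N)); first last.
  - by rewrite /= /upd /= r0; apply: leq_trans PA; rewrite leq_mul2r hi orbT.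
  - by rewrite /= /upd /= e53 r4 mulSn addnC.
  split; rewrite /= ?Hm ?Ho //.
  - by rewrite /upd /= Hk.
  - case: H9 => e9; last by right; rewrite /upd /= e9.
    left; rewrite /upd /= e9; split=> //; split=> // j; rewrite ltnS leq_eqVlt => /orP[/eqP->|/ej //].
    by rewrite leqNgt; apply/negP => /HC; rewrite e9.
have [Q q14 qm qo q13] := F PT (leqnn _).
set s2 := iter PT _ s1 in Q q14 qm qo q13 *.
have [r0 r1 r2 r3 r4] := Q.
rewrite den_if; case: q13 => [[e13 [e5 ej]]|e13]; last first.
  rewrite [eval _ _ _ _]/= e13 [_ != _]/= [den x HSkip _]/= [den _ _ _]/= e13 qo.
  by split; rewrite ?qm //; case: (b).
rewrite [eval _ _ _ _]/= e13 [_ != _]/=.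
have [H13 Ho Hm] := hfall_ok A3 PA' JA' v0E' v0z' Hout' r0 r1.
set s3 := den x _ s2 in H13 Ho Hm *.
rewrite [den _ _ _]/= H13 Ho qo; split.
- by case: (b).
- by move=> p hp; rewrite /= Hm // qm.
(* The fallback is reached only if the tree of every block was too large for the budget. *)
- by move=> [i hi]; rewrite ltnNge ej.
Qed.
End Main2.

(** * Comparison of the classes *)

Section Swap.
Variable M : machine.

(* A machine that uses its work tape only becomes one that uses its catalytic tape only. *)
Definition swapM : machine := @Machine (state M) (start M) (@halting M) (fun q i w c =>
  let t := delta q i c w in Trans (nq t) (cbit t) (wbit t) (obit t) (mi t) (mc t) (mw t)).

Definition swapc (c : config M) : config swapM :=
  @Config swapM (cst c) (ihead c) (Defs.cat c) (chead c) (work c) (whead c) (out c).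

Lemma step_swap x c : step x (swapc c) = swapc (step x c).
Proof. by rewrite /step /=; case: ifP. Qed.

Lemma run_swap x c t : run x (swapc c) t = swapc (run x c t).
Proof. by elim: t => //= t ->; rewrite step_swap. Qed.

Lemma init_swap s : swapc (init M s [::]) = init swapM 0 (nseq s false).
Proof. by []. Qed.
End Swap.

Lemma run_halting_eq M x (c : config M) i j : halting (cst (run x c i)) ->
  halting (cst (run x c j)) -> run x c i = run x c j.
Proof.
wlog le : i j / i <= j => [H hi hj|hi _].
  by case: (leqP i j) => [/H|/ltnW /H h]; [apply|rewrite h].
by rewrite -(subnKC le) run_add [RHS]run_halted.
Qed.

Lemma num_nseq m : num (nseq m false) = 0.
Proof. by elim: m => //= m ->. Qed.

Section Start.
Variables (M : machine) (x : seq bool) (wl N : nat).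
Hypothesis N0 : 0 < N.

Lemma start_lt : start_code M x wl < nU M x (2 ^ wl) N.
Proof.
apply: code_lt => //; first exact: qi_lt.
- by rewrite expn_gt0.
- by rewrite expn_gt0.
Qed.

Definition startn (t : N.-tuple bool) : node M x (2 ^ wl) N := (Ordinal start_lt, t).

Lemma isnode_start (t : N.-tuple bool) : isnode (startn t) (init M wl t).
Proof.
split=> //=; first by rewrite /encc /= num_nseq.
by split; rewrite //= ?size_nseq ?size_tuple.
Qed.
End Start.

(** * Roots of the start nodes *)

Section Roots.
Variables (M : machine) (x : seq bool) (wl N : nat) (b : bool).
Hypothesis N0 : 0 < N.
Variable T : N.-tuple bool -> nat.
Hypothesis HT : forall t : N.-tuple bool, let f := run x (init M wl t) (T t) in
  halting (cst f) /\ out f = [:: b].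
Local Notation fs := (@fstep M x (2 ^ wl) (2 ^ wl.-1) N (p2_gt0 wl) (pw_le wl) N0).
Local Notation st := (@startn M x wl N N0).

(** Under [HT] the choice succeeds: every run ends with an output, so its start node leads to a
    terminal node. *)
Definition root (t : N.-tuple bool) :=
  odflt (st t) [pick r | (fs r == None) && (st t \in tree fs r)].

Lemma root_spec (t : N.-tuple bool) : exists i, [/\ i < T t, root t = iter i (fnext fs) (st t),
   fs (root t) = None, isnode (root t) (run x (init M wl t) i)
   & st t \in tree fs (root t) /\ gO M x (2 ^ wl) (root t).1 (bitv (root t)) = b.+1].
Proof.
have [h1 h2] := HT t.
have [i [h3 h4 h5 h6 h7]] := run_output N0 (p2_gt0 wl) (pw_le wl) (isnode_start _ _ _ N0 t) h1 h2.
have tr : st t \in tree fs (iter i (fnext fs) (st t)) by rewrite inE; apply: fconnect_iter.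
have e : root t = iter i (fnext fs) (st t).
  rewrite /root; case: pickP => [r /andP[/eqP r1 r2]|/(_ (iter i (fnext fs) (st t)))] /=.
    exact: tree_root_uniq tr.
  by rewrite h5 tr.
by exists i; rewrite e.
Qed.

(** After the root the machine may still change its tape, but deterministically: equal roots encode
    equal configurations, and the halted configuration reached from there does not depend on how
    long one waits. *)
Lemma root_final (t u : N.-tuple bool) : root t = root u ->
  Defs.cat (run x (init M wl t) (T t)) = Defs.cat (run x (init M wl u) (T u)).
Proof.
move=> e; have [i [h1 _ _ h2 _]] := root_spec t; have [j [k1 _ _ k2 _]] := root_spec u.
have ec := isnode_inj N0 h2 (eq_rect_r (fun r => isnode r _) k2 e).
have [a1 _] := HT t; have [b1 _] := HT u.
move: a1 b1; rewrite -(subnKC (ltnW h1)) -(subnKC (ltnW k1)) !run_add ec => a1 b1.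
by rewrite (run_halting_eq a1 b1).
Qed.
End Roots.

Lemma hamming_le s t m : (forall p, m <= p -> nth false s p = nth false t p) -> hamming s t <= m.
Proof.
move=> h; rewrite /hamming -(big_mkord xpredT (fun i => (nth false s i != nth false t i) : nat)).
have le1 j : \sum_(0 <= i < j) ((nth false s i != nth false t i) : nat) <= j.
  rewrite -{2}[j]subn0 -[j - 0]muln1 -sum_nat_const_nat; apply: leq_sum => i _.
  by case: (_ != _).
case: (leqP (size s) m) => le; first exact: leq_trans (le1 _) le.
rewrite (big_cat_nat _ (ltnW le)) //=.
rewrite (_ : \sum_(m <= i < size s) _ = 0) ?addn0 //.
by rewrite big_nat big1 // => i /andP[hi _]; rewrite h // eqxx.
Qed.

Lemma hamming_eq0 s t : (forall p, nth false s p = nth false t p) -> hamming s t = 0.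
Proof. by move=> h; apply/eqP; rewrite -leqn0; apply: hamming_le => p _. Qed.

Lemma poly_W k : poly (fun n => 2 ^ (k * logn2 n)).
Proof.
apply: (@poly_le _ (fun n => (2 * n) ^ k)).
  move=> n n1; rewrite mulnC expnM; case: k => // k; rewrite leq_exp2r // /logn2 expnS leq_mul2l.
  by have /andP[-> _] := trunc_log_bounds (isT : 1 < 2) (ltnW n1); rewrite orbT.
by apply: poly_exp; apply: poly_mul poly_id; apply: poly_cst.
Qed.

Lemma poly_nU M fW fN : poly fW -> poly fN -> poly (fun n => nU M (nseq n false) (fW n) (fN n)).
Proof.
move=> pW pN; have pS g : poly g -> poly (fun n => (g n).+1).
  by move=> pg; apply: poly_le (poly_add (poly_cst 1) pg) => n _.
rewrite /nU; apply: (poly_mul (poly_cst _)); apply: (poly_mul _ (poly_mul pW (poly_mul (pS _ pW) pN))).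
by apply: poly_le (pS _ poly_id) => n _; rewrite size_nseq.
Qed.

Lemma nU_size M x W N : nU M (nseq (size x) false) W N = nU M x W N.
Proof. by rewrite /nU size_nseq. Qed.

Lemma poly_pow k : poly (fun n => n ^ k).
Proof. exact: poly_exp poly_id. Qed.

(** * The inclusions between the classes *)

Lemma AVG_LCLP_P L : in_AVG_LCLP L -> in_P L.
Proof.
move=> [k [e [M HM]]].
(* The sum of everything the cap on the variables must dominate; with the cap n^(a+1) the
   assignments of the program do not saturate. *)
pose f n := 3 + 2 * n + 2 ^ (k * logn2 n) + n ^ k +
  (2 * nU M (nseq n false) (2 ^ (k * logn2 n)) (n ^ k) + 1).
have [a ha] : poly f.
  exact: (poly_add (poly_add (poly_add (poly_add (poly_cst 3) (poly_mul (poly_cst 2) poly_id))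
    (poly_W k)) (poly_pow k)) (poly_add (poly_mul (poly_cst 2)
    (poly_nU M (poly_W k) (poly_pow k))) (poly_cst 1))).
have [M' [k' H]] := work_machine L (ltn0Sn a) (isT : 1 < 16) (hwf_main1 M k).
exists k', M' => x; have [h1 h2] := H x; split=> //; rewrite h2.
case: ltnP => // n1.
set n := size x in n1 *; have N0 : 0 < n ^ k by rewrite expn_gt0 (ltnW n1).
have fA : f n <= n ^ a.+1 by apply: leq_trans (ha _ n1) _; rewrite leq_exp2l.
pose t : (n ^ k).-tuple bool := nseq_tuple (n ^ k) false.
have [[H1 H2] _] := (conj (proj1 (HM x) t) I).
have [i [r1 r2 r3 r4 r5]] := run_output N0 (p2_gt0 _) (pw_le _) (isnode_start _ _ _ N0 t) H1 H2.
have nUx := nU_size M x (2 ^ (k * logn2 n)) (n ^ k).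
apply: (@hmain1_ok M x k (n ^ a.+1) (L x) n1 N0 _ _ _ _ _ (startn M x _ N0 t)) => //.
all: try by rewrite -?nUx; move: fA; rewrite /f -/n; lia.
- by move=> i0; rewrite nth_nseq if_same.
- by exists i.
Qed.

Lemma AVG_LCLP_AVG L : in_AVG_LCLP L -> in_AVG_LCL L.
Proof.
by move=> [k [e [M HM]]]; exists k, e, M => x; exists (fun=> size x ^ k + k); apply: HM.
Qed.

Lemma AVG_P_LCLP L : in_AVG_LCL L -> in_P L -> in_AVG_LCLP L.
Proof.
move=> [k [e [M HM]]] [kp [MP HP]].
pose M' := swapM MP.
pose W n := 2 ^ (k * logn2 n).
pose S n := nU M (nseq n false) (W n) (n ^ k).
pose Z n := 4 * ((n ^ k).+1 ^ (4 * e) * S n).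
pose PT n := n ^ kp + kp.
have pS : poly S by apply: poly_nU (poly_W _) (poly_pow _).
have pPT : poly PT by apply: poly_add (poly_pow _) (poly_cst _).
have p1 : poly (fun n => (n ^ k).+1).
  by apply: poly_le (poly_add (poly_cst 1) (poly_pow k)) => n _.
(* The budget n^c exceeds Z (J + 1) with J = 2 S, the number of steps within which a tour meets the
   root of a tree of size at most Z. *)
have [c hc] : poly (fun n => Z n * (2 * S n + 1) + 1).
  exact: (poly_add (poly_mul (poly_mul (poly_cst 4) (poly_mul (poly_exp (4 * e) p1) pS))
    (poly_add (poly_mul (poly_cst 2) pS) (poly_cst 1))) (poly_cst 1)).
pose f n := 3 + 2 * n + W n + n ^ k + (2 * S n + 1) + PT n * n ^ k + PT n +
  (2 * nU M' (nseq n false) (2 ^ 0) (PT n) + 1) + n ^ c.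
have [a ha] : poly f.
  exact: (poly_add (poly_add (poly_add (poly_add (poly_add (poly_add (poly_add (poly_add
    (poly_cst 3) (poly_mul (poly_cst 2) poly_id)) (poly_W k)) (poly_pow k))
    (poly_add (poly_mul (poly_cst 2) pS) (poly_cst 1))) (poly_mul pPT (poly_pow k))) pPT)
    (poly_add (poly_mul (poly_cst 2) (poly_nU M' (poly_cst (2 ^ 0)) pPT)) (poly_cst 1)))
    (poly_pow c)).
(* The exponent d makes room for all blocks on the catalytic tape. *)
have [d hd] := poly_mul pPT (poly_pow k).
have [Mc [K0 H]] := cat_machine L (ltn0Sn a) (isT : 1 < 16) (hwf_main2 M M' k c kp).
exists (K0 + d), 1, Mc => x.
have {H} H := H (K0 + d) (leq_addr _ _) x.
case: (ltnP (size x) 2) H => n1 H.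
  split=> [tau|]; first by have [h1 [h2 _]] := H tau (size_tuple tau).
  rewrite big1 // => tau _; have [_ [_ ->]] := H tau (size_tuple tau).
  exact: hamming_eq0.
set n := size x in n1 H *; set K := K0 + d in H *.
have n0 := ltnW n1.
have N0 : 0 < n ^ k by rewrite expn_gt0 n0.
have P0 : 0 < PT n by rewrite /PT addn_gt0 expn_gt0 n0.
have fA : f n <= n ^ a.+1 by apply: leq_trans (ha _ n1) _; rewrite leq_exp2l.
have SE : S n = nU M x (2 ^ (k * logn2 n)) (n ^ k) := nU_size M x _ _.
have SE' := nU_size M' x (2 ^ 0) (PT n).
have [T [HT Havg]] := HM x.
pose rt := @root M x (k * logn2 n) (n ^ k) N0.
pose fs := @fstep M x (2 ^ (k * logn2 n)) (2 ^ (k * logn2 n).-1) (n ^ k) (p2_gt0 _) (pw_le _) N0.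
have RS t := root_spec N0 HT t.
pose Bad := [set t : (n ^ k).-tuple bool | Z n < #|tree fs (rt t)|].
have cB : 2 * #|Bad| <= 2 ^ (n ^ k).
  apply: (@card_bad (n ^ k) (S n) e _ fs rt _ _ _ _ Havg) => //.
  - by rewrite card_prod card_ord card_tuple card_bool SE.
  - by move=> t; have [i [_ _ h _ _]] := RS t.
  - by move=> t u; apply: (root_final HT).
  - by rewrite SE; apply: leq_ltn_trans (start_lt M x _ N0).
have out0 : outputs (p2_gt0 0) (pw_le 0) P0 (startn M' x 0 P0 (nseq_tuple (PT n) false))
    (PT n) (L x).
  have [h1 h2] := HP x.
  have Hs : run x (init M' 0 (nseq (PT n) false)) (PT n) = swapc (run x (init MP (PT n) [::]) (PT n)).
    by rewrite -init_swap run_swap.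
  have [||i [r1 r2 r3 _ r5]] := run_output (T := PT n) (b := L x) P0 (p2_gt0 0) (pw_le 0)
    (isnode_start M' x 0 P0 (nseq_tuple (PT n) false)).
  - by rewrite /= Hs.
  - by rewrite /= Hs.
  by exists i.
have main (tau : (n ^ K).-tuple bool) :
  let f := run x (init Mc (K * logn2 n) tau) (n ^ K + K) in
  [/\ halting (cst f), out f = [:: L x], hamming tau (Defs.cat f) <= PT n
    & tau \notin [set t : (n ^ K).-tuple bool | [forall i : 'I_(PT n), blk (n ^ k) t i \in Bad]] ->
      hamming tau (Defs.cat f) = 0].
  have [h1 [h2 h3 h4]] := H tau (size_tuple tau).
  set A := n ^ a.+1 in fA *.
  have [A1 A2 A4 A5] : [/\ 3 <= A, 2 * n <= A, W n <= A & n ^ k <= A].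
    by move: fA; rewrite /f; split; lia.
  have A6 : (2 * nU M x (2 ^ (k * logn2 n)) (n ^ k)).+1 <= A by rewrite -SE; move: fA; rewrite /f; lia.
  have [A7 A8 A9] : [/\ PT n * n ^ k <= A, PT n <= A & n ^ c <= A].
    by move: fA; rewrite /f; split; lia.
  have A10 : (2 * nU M' x (2 ^ 0) (PT n)).+1 <= A by rewrite -SE' -/n; move: fA; rewrite /f; lia.
  have R1 t : fs (rt t) = None by have [i [_ _ h _ _]] := RS t.
  have R2 t : (Ordinal (start_lt M x (k * logn2 n) N0), t) \in tree fs (rt t).
    by have [i [_ _ _ _ [hr _]]] := RS t.
  have R3 t : gO M x (2 ^ (k * logn2 n)) (rt t).1 (bitv (rt t)) = (L x).+1.
    by have [i [_ _ _ _ [_ ho]]] := RS t.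
  have [m1 m2 m3] := hmain2_ok (s := Hst (env0 a.+1 n) (nth false tau) [::]) n1 A1 A2 A4 A5 A6 A7 A8 A10 A9
    (v0' := startn M' x 0 P0 (nseq_tuple (PT n) false)) erefl erefl out0
    (u0 := Ordinal (start_lt M x (k * logn2 n) N0)) erefl R1 R2 R3
    erefl erefl erefl erefl erefl.
  split=> //; first by rewrite h2.
  - by apply: hamming_le => p hp; rewrite h4 m2.
  rewrite inE negb_forall => /existsP[i]; rewrite inE -leqNgt => hi.
  apply: hamming_eq0 => p; rewrite h4 m3 //.
  exists i => //; apply: leq_ltn_trans (leq_mul hi (_ : _ <= (2 * S n).+1)) _; first by rewrite SE.
  by have := hc n n1; rewrite addn1 addn1.
split=> [tau|]; first by have [] := main tau.
set All := [set t | _] in main.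
have PN : PT n * n ^ k <= n ^ K.
  by apply: leq_trans (hd n n1) _; rewrite leq_exp2l // leq_addl.
have cA := card_all_blocks PN cB.
(* Only strings whose blocks are all bad contribute, at most [PT n] each; since a number is less
   than its power of 2, [card_all_blocks] then gives the error constant 1. *)
apply: (@leq_trans (\sum_(tau in All) PT n)).
  rewrite (bigID (mem All)) /= [X in _ + X]big1 ?addn0.
    by apply: leq_sum => tau _; have [] := main tau.
  by move=> tau ht; have [_ _ _ ->] := main tau.
rewrite sum_nat_const mul1n; apply: leq_trans cA; rewrite leq_mul2l.
by rewrite ltnW ?orbT // ltn_expl.
Qed.

Theorem theorem6p9 (L : seq bool -> bool) :
  in_AVG_LCLP L <-> (in_AVG_LCL L /\ in_P L).
Proof.
split=> [H|[H1 H2]]; last exact: AVG_P_LCLP.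
by split; [apply: AVG_LCLP_AVG|apply: AVG_LCLP_P].
Qed.
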